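(* Let $\mathcal O$ be a commutative integral domain whose field of fractions $\mathbb K$ has characteristic zero, and let $X$ be an $\mathcal O$-superalgebra which is free of finite rank as an $\mathcal O$-supermodule. There is an isomorphism of $\mathcal O$-superalgebras $${}'DX\longrightarrow\mathrm{Inv}\,T_X,\qquad \xi\otimes x\mapsto\xi*\kappa(x)\qquad(\xi\in\mathrm{Inv}\,X,\ x\in{}'\mathrm{Sym}(X^* )).$$
   Context: Super conventions. $\mathbb Z_2=\{\bar0,\bar1\}$; $R$ denotes a base ring ($\mathcal O$ or $\mathbb K$ here). An $R$-superspace is $V=V_{\bar0}\oplus V_{\bar1}$ with both summands free of finite rank over $R$; $\bar v$ is the parity of a homogeneous $v$; formulas with parities are for homogeneous elements, extended linearly. Superalgebras are associative, unital, with parity-compatible product. $V^*=\mathrm{Hom}_R(V,R)$ with its natural $\mathbb Z_2$-grading and $\langle v,\beta\rangle=\langle\beta,v\rangle=\beta(v)$. Put $[u_1,\dots,u_d;w_1,\dots,w_d]=\sum_{1\le a<c\le d}\bar u_c\bar w_a$. Identify $(V_1\otimes\cdots\otimes V_d)^*$ with $V_1^*\otimes\cdots\otimes V_d^*$ by $\langle\beta_1\otimes\cdots\otimes\beta_d,v_1\otimes\cdots\otimes v_d\rangle=(-1)^{[\beta_1,\dots,\beta_d;v_1,\dots,v_d]}\prod_a\langle\beta_a,v_a\rangle$. A tensor product of superalgebras is a superalgebra via $(v_1\otimes\cdots\otimes v_d)(w_1\otimes\cdots\otimes w_d)=(-1)^{[v_1,\dots,v_d;w_1,\dots,w_d]}v_1w_1\otimes\cdots\otimes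 v_dw_d$. The symmetric group $\mathfrak S_d$ acts on the right on $V^{\otimes d}$ by $(v_1\otimes\cdots\otimes v_d)^g=(-1)^{m}v_{g1}\otimes\cdots\otimes v_{gd}$, $m=\sum_{a<c,\ g^{-1}a>g^{-1}c}\bar v_a\bar v_c$. Invariants. $\mathrm{Inv}^dV=(V^{\otimes d})^{\mathfrak S_d}$, $\mathrm{Inv}\,V=\bigoplus_{d\ge0}\mathrm{Inv}^dV$. The shuffle product $*$ on $\bigoplus_d V^{\otimes d}$ is $s*t=\sum_{g}(s\otimes t)^g$ for $s\in V^{\otimes d},t\in V^{\otimes e}$, with $g$ running over shortest coset representatives for $(\mathfrak S_d\times\mathfrak S_e)\backslash\mathfrak S_{d+e}$; it is associative, supercommutative, and preserves $\mathrm{Inv}\,V$. The coproduct $\Delta(v_1\otimes\cdots\otimes v_d)=\sum_{e=0}^d(v_1\otimes\cdots\otimes v_e)\otimes(v_{e+1}\otimes\cdots\otimes v_d)$ restricts to $\mathrm{Inv}\,V\to\mathrm{Inv}\,V\otimes\mathrm{Inv}\,V$; write $\Delta(\xi)=\sum\xi_{(1)}\otimes\xi_{(2)}$. For a superalgebra $X$, $\mathrm{Inv}^dX$ is a subsuperalgebra of $X^{\otimes d}$, and $\mathrm{Inv}\,X$ carries the product which is this one on each $\mathrm{Inv}^dX$ and zero between different $d$; this is the superalgebra structure meant on $\mathrm{Inv}\,T_X$. Doubles. $(\mathrm{Inv}\,X)^*=\bigoplus_d(\mathrm{Inv}^dX)^*$ is a superalgebra with $\langle xy,\xi\rangle=\langle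 x\otimes y,\Delta(\xi)\rangle$, and an $\mathrm{Inv}\,X$-bimodule by $\langle x\cdot\xi,\eta\rangle=\langle x,\xi\eta\rangle$, $\langle\eta,\xi\cdot x\rangle=\langle\eta\xi,x\rangle$ (actions of $\mathrm{Inv}^dX$ on $(\mathrm{Inv}^eX)^*$ being zero for $d\ne e$). The Turner double is $DX=\mathrm{Inv}\,X\otimes(\mathrm{Inv}\,X)^*$ with product $$(\xi\otimes x)(\eta\otimes y)=\sum(-1)^{\bar\xi_{(1)}(\bar\xi_{(2)}+\bar\eta+\bar x)+\bar\eta_{(1)}\bar x}\,\xi_{(2)}\eta_{(1)}\otimes(x\cdot\eta_{(2)})(\xi_{(1)}\cdot y).$$ $\mathrm{Sym}\,V$ is the quotient of the tensor superalgebra of $V$ by the ideal generated by $v\otimes u-(v\otimes u)^{(1,2)}$ ($u,v\in V$) and $v\otimes v$ ($v\in V_{\bar1}$). For an $\mathcal O$-superspace $V$, ${}'\mathrm{Sym}\,V$ is the $\mathcal O$-subalgebra of $\mathrm{Sym}(V\otimes_{\mathcal O}\mathbb K)$ generated by all $v^{(m)}=v^m/m!$ ($v\in V_{\bar0}$, $m\ge0$) and all $v\in V_{\bar1}$. The map $\kappa\colon{}'\mathrm{Sym}\,V\to\mathrm{Inv}\,V$ is the algebra isomorphism (for the $*$-product on $\mathrm{Inv}\,V$) with $\kappa(v^{(m)})=v^{\otimes m}$ for $v\in V_{\bar0}$ and $\kappa(v)=v$ for $v\in V_{\bar1}$; it is applied to $V=X^*$. The natural map $X^*\to(\mathrm{Inv}\,X)^*$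 extends to a superalgebra isomorphism $\mathrm{Sym}(X^* )\cong(\mathrm{Inv}\,X)^*$, used as an identification (also over $\mathbb K$). Then ${}'\mathrm{Sym}(X^* )\subseteq(\mathrm{Inv}\,X_{\mathbb K})^*$, $X_{\mathbb K}=X\otimes_{\mathcal O}\mathbb K$, is stable under the left and right actions of $\mathrm{Inv}\,X$, so ${}'DX:=\mathrm{Inv}\,X\otimes{}'\mathrm{Sym}(X^* )$ is closed under the product $(\xi\otimes x)(\eta\otimes y)=\sum(-1)^{\bar\xi_{(1)}(\bar\xi_{(2)}+\bar\eta+\bar x)+\bar\eta_{(1)}\bar x}\,\xi_{(2)}\eta_{(1)}\otimes(x\cdot\eta_{(2)})(\xi_{(1)}\cdot y)$ in the Turner double $D(X_{\mathbb K})=\mathrm{Inv}\,X_{\mathbb K}\otimes(\mathrm{Inv}\,X_{\mathbb K})^*$. Trivial extension. $X^*$ is an $X$-bimodule by $\langle\alpha\cdot a,b\rangle=\langle\alpha,ab\rangle$, $\langle b,a\cdot\alpha\rangle=\langle ba,\alpha\rangle$; $T_X=X\oplus X^*$ with $(a,\alpha)(b,\beta)=(ab,a\cdot\beta+\alpha\cdot b)$. $\mathrm{Inv}\,X$ and $\mathrm{Inv}(X^* )$ are viewed inside $\bigoplus_dT_X^{\otimes d}$, in which $*$ is taken. *)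

(* Defs.v *)
From HB Require Import structures.
From mathcomp Require Import all_boot all_order all_fingroup all_algebra.
From mathcomp Require Import generic_quotient ring_quotient fraction.
From mathcomp Require Import finmap boolp classical_sets functions.
From mathcomp.multinomials Require Import monalg.

(* {malg R[S]} is used as the free R-module on the set S. *)

Set Implicit Arguments.
Unset Strict Implicit.
Unset Printing Implicit Defensive.

Import GRing.Theory.
Local Open Scope ring_scope.
Local Open Scope quotient_scope.

(** * Linear algebra: linear extension, quotients, tensor products *)

Section Extension.
Variable R : nzRingType.

Definition mlin (S : choiceType) (U : lmodType R) (h : S -> U)
  (f : {malg R[S]}) : U := \sum_(s <- msupp f) f@_s *: h s.

Definition mlin2 (S S' : choiceType) (U : lmodType R) (h : S -> S' -> U)
  (f : {malg R[S]}) (g : {malg R[S']}) : U :=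
  mlin (fun s => mlin (h s) g) f.

End Extension.

Section Span.
Variables (R : nzRingType) (U : lmodType R) (P : U -> Prop).

Definition lspan : {pred U} := fun u =>
  `[< exists2 l : seq (R * U), forall q, q \in l -> P q.2 &
        u = \sum_(q <- l) q.1 *: q.2 >].

Lemma span_submod_closed : submod_closed lspan.
Proof.
split=> [|a u v /asboolP[l Pl ->] /asboolP[m Pm ->]]; apply/asboolP.
  by exists [::] => //; rewrite big_nil.
exists ([seq (a * q.1, q.2) | q <- l] ++ m) => [q|].
  by rewrite mem_cat => /orP[/mapP[p /Pl Pp ->]|/Pm].
rewrite big_cat big_map /=; congr (_ + _); rewrite scaler_sumr.
by apply: eq_bigr => q _; rewrite scalerA.
Qed.

HB.instance Definition _ := GRing.isSubmodClosed.Build R U lspan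
  span_submod_closed.

Definition lquot := {ideal_quot lspan}.
HB.instance Definition _ := GRing.Zmodule.on lquot.
HB.instance Definition _ := @EqQuotient.on lquot.

Definition lquot_scale (a : R) (x : lquot) : lquot := \pi_lquot (a *: repr x).

Lemma lquot_eqP (u v : U) : \pi_lquot u = \pi_lquot v <-> u - v \in lspan.
Proof.
by rewrite Quotient.idealrBE; split=> [h|/eqP]; [apply/eqP; exact: h|exact: id].
Qed.

Lemma pi_lquotD (u v : U) : \pi_lquot (u + v) = \pi_lquot u + \pi_lquot v.
Proof. by rewrite Quotient.pi_add. Qed.

Lemma pi_lquotZ a (u : U) : \pi_lquot (a *: u) = lquot_scale a (\pi u).
Proof.
apply/lquot_eqP; rewrite -scalerBr rpredZ //.
by apply/lquot_eqP; rewrite reprK.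
Qed.

Lemma lquot_ind (P' : lquot -> Prop) : (forall u, P' (\pi u)) -> forall x, P' x.
Proof. by move=> h x; rewrite -[x]reprK. Qed.

Fact lquot_scaleA a b x :
  lquot_scale a (lquot_scale b x) = lquot_scale (a * b) x.
Proof. by elim/lquot_ind: x => u; rewrite -(pi_lquotZ b) -(pi_lquotZ a) -(pi_lquotZ (a * b)) scalerA. Qed.

Fact lquot_scale1 : left_id 1 lquot_scale.
Proof. by elim/lquot_ind => u; rewrite -pi_lquotZ scale1r. Qed.

Fact lquot_scaleDr : right_distributive lquot_scale +%R.
Proof.
move=> a; elim/lquot_ind=> u; elim/lquot_ind=> v.
by rewrite -pi_lquotD -(pi_lquotZ a (u + v)) -(pi_lquotZ a u) -(pi_lquotZ a v)
  scalerDr pi_lquotD.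
Qed.

Fact lquot_scaleDl x : {morph lquot_scale^~ x : a b / a + b}.
Proof.
by elim/lquot_ind: x => u a b; rewrite -(pi_lquotZ (a + b)) -(pi_lquotZ a) -(pi_lquotZ b) scalerDl
  pi_lquotD.
Qed.

HB.instance Definition _ := GRing.Zmodule_isLmodule.Build R lquot
  lquot_scaleA lquot_scale1 lquot_scaleDr lquot_scaleDl.

End Span.

Section TensorProduct.
Variables (R : comNzRingType) (M N : lmodType R).

Inductive bilin_rel : {malg R[(M * N)%type]} -> Prop :=
| BilinL a m m' n :
    bilin_rel (<<(a *: m + m', n)>> - a *: <<(m, n)>> - <<(m', n)>>)
| BilinR a m n n' :
    bilin_rel (<<(m, a *: n + n')>> - a *: <<(m, n)>> - <<(m, n')>>).

Definition tensprod := lquot bilin_rel.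
HB.instance Definition _ := GRing.Lmodule.on tensprod.

Definition tens (m : M) (n : N) : tensprod := \pi_(lquot bilin_rel) <<(m, n)>>.

End TensorProduct.

(** * Superspaces and their tensor algebras *)

(* The R-superspace with a given homogeneous basis [sbasis]: vectors are
   {ffun V -> R}, and the direct sum of the tensor powers of V is the free
   R-module on words in the basis. *)
Record sspace := SSpace { sbasis :> finType; spar : sbasis -> bool }.

(* V^*, through the dual basis, which has the same index set and parities. *)
Definition sdual (V : sspace) : sspace := V.

Definition ssum (V W : sspace) : sspace :=
  @SSpace (V + W)%type
    (fun i => match i with inl j => spar j | inr j => spar j end).

Notation vect R V := {ffun sbasis V -> R}.
Notation talg R V := {malg R[seq (sbasis V)]}.

(* [u_1,...,u_d; w_1,...,w_d] *)
Definition bracket (us ws : seq bool) : nat :=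
  (\sum_(c < size us) \sum_(a < c) (nth false us c && nth false ws a))%N.

Section Tensors.
Variables (R : comNzRingType) (V : sspace).
Implicit Types (t u : talg R V) (v : vect R V) (w : seq V) (e : bool).

Definition homog v e := forall i, v i != 0 -> spar i = e.

Definition wpar w : bool := \big[addb/false]_(i <- w) spar i.

(* the component of parity e *)
Definition tpar e : talg R V -> talg R V :=
  mlin (fun w => if wpar w == e then <<w>> else 0).

Definition tconcat : talg R V -> talg R V -> talg R V :=
  mlin2 (fun w w' => <<w ++ w'>>).

Definition tvec v : talg R V := \sum_i << v i *g [:: i] >>.

(* v tensored with itself m times *)
Definition tpow v m : talg R V := iter m (tconcat (tvec v)) << [::] >>.

(** The right action of the symmetric groups. *)

Definition wact d (g : 'S_d) (w : d.-tuple V) : talg R V :=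
  let m := (\sum_(a < d) \sum_(c < d | (a < c) && (g^-1%g c < g^-1%g a))
              (spar (tnth w a) && spar (tnth w c)))%N in
  << (-1) ^+ m *g tval [tuple tnth w (g a) | a < d] >>.

(* the action on the component of degree d, the others being killed *)
Definition tact d (g : 'S_d) t : talg R V :=
  \sum_(w : d.-tuple V) t@_(tval w) *: wact g w.

Definition tcomp d t : talg R V := \sum_(w : d.-tuple V) << t@_(tval w) *g tval w >>.

Definition is_inv : {pred talg R V} := fun t =>
  `[< forall d (g : 'S_d), tact g t = tcomp d t >].

Lemma is_inv_submod_closed : submod_closed is_inv.
Proof.
split=> [|a t u /asboolP It /asboolP Iu]; apply/asboolP => d g.
  by rewrite /tact /tcomp !big1 // => w _; rewrite mcoeff0 ?monalgU0 ?scale0r.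
rewrite [LHS](_ : _ = a *: tact g t + tact g u).
  rewrite It Iu /tcomp scaler_sumr -big_split; apply: eq_bigr => w _ /=.
  by rewrite mcoeffD mcoeffZ monalgUD; congr (_ + _); apply/malgP => k;
    rewrite mcoeffZ !mcoeffU mulrnAr.
rewrite /tact scaler_sumr -big_split; apply: eq_bigr => w _ /=.
by rewrite mcoeffD mcoeffZ scalerDl scalerA.
Qed.

HB.instance Definition _ := GRing.isSubmodClosed.Build R (talg R V) is_inv
  is_inv_submod_closed.

(** The shuffle product. *)

Definition perm_length d (g : 'S_d) : nat :=
  #|[set x : 'I_d * 'I_d | ((x.1 < x.2) && (g x.2 < g x.1))%N]|.

Definition young (d d' : nat) (h : 'S_(d + d')) := [forall i, (h i < d)%N == (i < d)%N].

(* g * h is first g, then h: it is the product hg for permutations acting on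
   the left, as in the definition of wact, so that the coset at hand is
   (S_d x S_d')g. *)
Definition shortest_rep (d d' : nat) (g : 'S_(d + d')) :=
  [forall h : 'S_(d + d'), young h ==> (perm_length g <= perm_length (g * h)%g)%N].

Definition wshuffle w w' : talg R V :=
  \sum_(g : 'S_(size w + size w') | shortest_rep g)
    wact g (cat_tuple (in_tuple w) (in_tuple w')).

Definition shuffle : talg R V -> talg R V -> talg R V := mlin2 wshuffle.

(** The coproduct, with values in the tensor square of the tensor algebra,
    which is free on pairs of words. *)

Definition coprod : talg R V -> {malg R[(seq V * seq V)%type]} :=
  mlin (fun w => \sum_(e < (size w).+1) << (take e w, drop e w) >>).

Definition tens2 : talg R V -> talg R V -> {malg R[(seq V * seq V)%type]} :=
  mlin2 (fun w w' => << (w, w') >>).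

End Tensors.

(** * Invariants *)

Record invar (R : comNzRingType) (V : sspace) :=
  Inv { inv_val :> talg R V; _ : inv_val \in @is_inv R V }.

HB.instance Definition _ (R : comNzRingType) (V : sspace) :=
  [isSub for @inv_val R V].
HB.instance Definition _ (R : comNzRingType) (V : sspace) :=
  [Choice of invar R V by <:].
HB.instance Definition _ (R : comNzRingType) (V : sspace) :=
  [SubChoice_isSubLmodule of invar R V by <:].

(* Only applied to invariant tensors: the default value 0 never occurs. *)
Definition to_inv (R : comNzRingType) (V : sspace) (t : talg R V) : invar R V :=
  insubd (0 : invar R V) t.

(** * Superalgebras *)

(* A superalgebra with X_0 and X_1 free of finite rank, given with a
   homogeneous basis.  The unit is automatically even, and X = 0 is allowed. *)
Record superalgebra (R : comNzRingType) := SuperAlgebra {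
  sa_sort :> lmodType R;
  sa_space : sspace;
  sa_basis : sa_space -> sa_sort;
  sa_coord : sa_sort -> vect R sa_space;
  sa_coordK : forall x, \sum_i sa_coord x i *: sa_basis i = x;
  sa_sumK : forall v : vect R sa_space,
    sa_coord (\sum_i v i *: sa_basis i) = v;
  sa_mul : sa_sort -> sa_sort -> sa_sort;
  sa_one : sa_sort;
  sa_mulA : associative sa_mul;
  sa_mul1l : left_id sa_one sa_mul;
  sa_mul1r : right_id sa_one sa_mul;
  sa_mulDl : forall a x y z,
    sa_mul (a *: x + y) z = a *: sa_mul x z + sa_mul y z;
  sa_mulDr : forall a x y z,
    sa_mul z (a *: x + y) = a *: sa_mul z x + sa_mul z y;
  sa_mul_par : forall i j,
    homog (sa_coord (sa_mul (sa_basis i) (sa_basis j))) (spar i (+) spar j)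
}.

(* Structure constants: the coordinates of the products of basis vectors. *)
Definition sconst (R : comNzRingType) (V : sspace) := V -> V -> vect R V.

Definition sa_const (R : comNzRingType) (X : superalgebra R) :
  sconst R (sa_space X) :=
  fun i j => sa_coord (sa_mul (sa_basis i) (sa_basis j)).
Arguments sa_const {R} X _ _.

Definition scalar_ext (R S : comNzRingType) (f : R -> S) (V : sspace)
  (c : sconst R V) : sconst S V := fun i j => [ffun k => f (c i j k)].

(* T_X: [inl i] is the basis vector x_i of X and [inr i] the dual basis vector
   x^i of X^*.  The coefficients of x_i.x^j and x^i.x_j at x^k are
   <x_k x_i, x^j> and <x^i, x_j x_k>. *)
Definition trivial_ext (R : comNzRingType) (V : sspace) (c : sconst R V) :
  sconst R (ssum V (sdual V)) := fun p q =>
  [ffun r => match p, q, r with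
   | inl i, inl j, inl k => c i j k
   | inl i, inr j, inr k => c k i j
   | inr i, inl j, inr k => c j k i
   | _, _, _ => 0
   end].

Section TensorPowerAlgebra.
Variables (R : comNzRingType) (V : sspace) (c : sconst R V).

(* the product of the superalgebras X^{(x) d}, zero between different d *)
Definition wmul (w w' : seq V) : talg R V :=
  if size w == size w' then
    (-1) ^+ bracket [seq spar i | i <- w] [seq spar i | i <- w'] *:
      foldr (@tconcat R V) << [::] >>
        [seq tvec (c p.1 p.2) | p <- zip w w']
  else 0.

Definition tmul : talg R V -> talg R V -> talg R V := mlin2 wmul.

Definition inv_mul (xi eta : invar R V) : invar R V := to_inv (tmul xi eta).

End TensorPowerAlgebra.

(** * The Turner double over a field *)

Section TurnerDouble.
Variables (K : fieldType) (V : sspace) (c : sconst K V).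
Local Notation invar := (invar K V).
Implicit Types (xi eta zeta : invar) (e : bool).

Definition inv_par e xi : invar := to_inv (tpar e xi).

(* (Inv X)^*, the direct sum of the duals of the Inv^d X: the linear forms on
   Inv X vanishing on Inv^d X for all large d. *)
Definition is_gdual : {pred invar -> K^o} := fun x => `[<
  (forall a xi eta, x (a *: xi + eta) = a * x xi + x eta) /\
  exists n, forall xi,
    (forall w, w \in msupp (inv_val xi) -> (n <= size w)%N) -> x xi = 0 >].

Lemma is_gdual_submod_closed : submod_closed is_gdual.
Proof.
split=> [|a x y /asboolP[xL [m xm]] /asboolP[yL [n yn]]]; apply/asboolP.
  by split=> [b xi eta|]; [rewrite mulr0 addr0 | exists 0%N].
split=> [b xi eta|].
  rewrite !fctE /= xL yL !mulrDr !scalerDr /=.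
  by rewrite addrACA; congr (_ + _ + _); rewrite scalerA mulrC -scalerA.
exists (maxn m n) => xi h; rewrite !fctE xm ?yn ?scaler0 ?addr0 // => w /h;
by rewrite geq_max => /andP[].
Qed.

HB.instance Definition _ :=
  GRing.isSubmodClosed.Build K (invar -> K^o) is_gdual is_gdual_submod_closed.

Record gdual := GDual { gdual_val :> invar -> K^o; _ : gdual_val \in is_gdual }.
HB.instance Definition _ := [isSub for gdual_val].
HB.instance Definition _ := [Choice of gdual by <:].
HB.instance Definition _ := [SubChoice_isSubLmodule of gdual by <:].

(* Only applied to elements of (Inv X)^*: the default value 0 never occurs. *)
Definition to_gdual (x : invar -> K^o) : gdual := insubd (0 : gdual) x.
Implicit Types (x y : gdual).

Definition gdual_par e x : gdual := to_gdual (fun xi => x (inv_par e xi)).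

(* A choice of xi_(1), xi_(2) with coprod xi = \sum xi_(1) (x) xi_(2).  One
   exists because coprod maps Inv X to Inv X (x) Inv X, and the products below
   do not depend on it. *)
Definition is_sweedler xi (l : seq (invar * invar)) : Prop :=
  coprod xi = \sum_(s <- l) tens2 s.1 s.2.

Definition sweedler xi : seq (invar * invar) := xget [::] (is_sweedler xi).

(* <xy, xi> = <x (x) y, coprod xi>, where
   <x (x) y, xi1 (x) xi2> = (-1)^(par y * par xi1) <x, xi1> <y, xi2> *)
Definition gdual_mul x y : gdual := to_gdual (fun xi =>
  \sum_(s <- sweedler xi) \sum_(e1 : bool) \sum_(e2 : bool)
    (-1) ^+ (e2 * e1)%N *
      (x (inv_par e1 s.1) * gdual_par e2 y s.2)).

Definition gdual_one : gdual := to_gdual (fun xi => (inv_val xi)@_[::]).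

(* xi.x and x.xi *)
Definition lact xi x : gdual := to_gdual (fun eta => x (inv_mul c eta xi)).
Definition ract x xi : gdual := to_gdual (fun eta => x (inv_mul c xi eta)).

Definition turner := tensprod invar gdual.
HB.instance Definition _ := GRing.Lmodule.on turner.

Definition tpure xi x : turner := tens xi x.

(* The product of two pure tensors, made bilinear in [turner_mul] (where the
   choice of repr is immaterial); the summation over a1, ..., e splits
   xi_(1), xi_(2), eta_(1), eta_(2), x into homogeneous components. *)
Definition turner_mul_pure xi x eta y : turner :=
  \sum_(s <- sweedler xi) \sum_(t <- sweedler eta)
  \sum_(a1 : bool) \sum_(a2 : bool) \sum_(b1 : bool) \sum_(b2 : bool)
  \sum_(e : bool)
    (-1) ^+ (a1 * (a2 + (b1 + b2) + e) + b1 * e)%N *: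
      tpure (inv_mul c (inv_par a2 s.2) (inv_par b1 t.1))
            (gdual_mul (ract (gdual_par e x) (inv_par b2 t.2))
                       (lact (inv_par a1 s.1) y)).

Definition turner_mul (F G : turner) : turner :=
  mlin2 (fun p q => turner_mul_pure p.1 p.2 q.1 q.2) (repr F) (repr G).

End TurnerDouble.

(** * Symmetric superalgebras *)

Section Sym.
Variables (R : comNzRingType) (V : sspace).

Inductive sym_rel : talg R V -> Prop :=
| SymComm (u v : vect R V) :
    sym_rel (tconcat (tvec u) (tvec v) -
             tact (tperm ord0 ord_max : 'S_2) (tconcat (tvec u) (tvec v)))
| SymOdd (v : vect R V) : homog v true ->
    sym_rel (tconcat (tvec v) (tvec v)).

Inductive sym_ideal : talg R V -> Prop :=
| SymIdeal s r t : sym_rel r -> sym_ideal (tconcat s (tconcat r t)).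

Definition symalg := lquot sym_ideal.
HB.instance Definition _ := GRing.Lmodule.on symalg.

Definition sym_class (t : talg R V) : symalg := \pi_(lquot sym_ideal) t.

Definition sym_mul (x y : symalg) : symalg :=
  sym_class (tconcat (repr x) (repr y)).

Definition sym_homog (e : bool) (x : symalg) :=
  exists2 t, tpar e t = t & x = sym_class t.

End Sym.

(* The identification Sym(X^* ) = (Inv X)^*: the algebra morphism extending
   the natural map X^* -> (Inv X)^*. *)
Section Identification.
Variables (K : fieldType) (V : sspace).

Definition gdual_nat (i : sdual V) : gdual K V :=
  to_gdual (fun xi : invar K V => (inv_val xi)@_([:: i] : seq V)).

Definition sym_gdual (x : symalg K (sdual V)) : gdual K V :=
  mlin (fun w : seq (sdual V) =>
          foldr (@gdual_mul K V) (gdual_one K V) (map gdual_nat w)) (repr x).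

End Identification.

(** * Divided powers and the form 'DX *)

Section DividedPowers.
Variables (O : idomainType) (V : sspace).
Local Notation K := {fraction O}.
Local Notation "a %:F" := (@tofrac O a).

Definition vect_frac (v : vect O V) : vect K V := [ffun i => (v i)%:F].

Definition talg_frac (t : talg O V) : talg K V :=
  \sum_(w <- msupp t) << (t@_w)%:F *g w >>.

Definition inv_frac (xi : invar O V) : invar K V := to_inv (talg_frac xi).

Definition divpow (v : vect O V) (m : nat) : symalg K V :=
  (m`!%:R)^-1 *: sym_class (tpow (vect_frac v) m).

Inductive dsym : symalg K V -> Prop :=
| DSymEven v m : homog v false -> dsym (divpow v m)
| DSymOdd v : homog v true -> dsym (sym_class (tvec (vect_frac v)))
| DSymAdd x y : dsym x -> dsym y -> dsym (x + y)
| DSymScale (a : O) x : dsym x -> dsym (a%:F *: x)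
| DSymMul x y : dsym x -> dsym y -> dsym (sym_mul x y).

(* These conditions determine kappa on dsym; its values elsewhere are
   irrelevant. *)
Record is_kappa (kappa : symalg K V -> invar O V) : Prop := IsKappa {
  kappaD : forall x y, dsym x -> dsym y -> kappa (x + y) = kappa x + kappa y;
  kappaZ : forall (a : O) x, dsym x -> kappa (a%:F *: x) = a *: kappa x;
  kappaM : forall x y, dsym x -> dsym y ->
    inv_val (kappa (sym_mul x y)) = shuffle (kappa x) (kappa y);
  kappa_even : forall v m, homog v false ->
    inv_val (kappa (divpow v m)) = tpow v m;
  kappa_odd : forall v, homog v true ->
    inv_val (kappa (sym_class (tvec (vect_frac v)))) = tvec v;
  kappa_inj : forall x y, dsym x -> dsym y -> kappa x = kappa y -> x = y;
  kappa_surj : forall t, exists2 x, dsym x & kappa x = t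
}.

End DividedPowers.

Definition frac_const (O : idomainType) (X : superalgebra O) :
  sconst {fraction O} (sa_space X) := scalar_ext (@tofrac O) (sa_const X).
Arguments frac_const {O} X _ _.

Section TurnerForm.
Variables (O : idomainType) (V : sspace).
Local Notation K := {fraction O}.

Definition dturner_pure (xi : invar O V) (x : symalg K (sdual V)) : turner K V :=
  tpure (inv_frac xi) (sym_gdual x).

(* 'DX inside the Turner double of X_K *)
Definition dturner (F : turner K V) : Prop :=
  exists2 l : seq (invar O V * symalg K (sdual V)),
    forall p, p \in l -> dsym p.2 &
    F = \sum_(p <- l) dturner_pure p.1 p.2.

Definition dturner_homog (e : bool) (F : turner K V) : Prop :=
  exists2 l : seq (invar O V * symalg K (sdual V)),
    forall p, p \in l -> dsym p.2 /\
      exists2 e1, tpar e1 (inv_val p.1) = inv_val p.1 &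
                  sym_homog (e1 (+) e) p.2 &
    F = \sum_(p <- l) dturner_pure p.1 p.2.

End TurnerForm.

Definition in_left (R : comNzRingType) (V W : sspace) :
  talg R V -> talg R (ssum V W) :=
  mlin (fun w => << [seq (inl i : ssum V W) | i <- w] >>).
Definition in_right (R : comNzRingType) (V W : sspace) :
  talg R W -> talg R (ssum V W) :=
  mlin (fun w => << [seq (inr i : ssum V W) | i <- w] >>).
Arguments in_left {R V W} _.
Arguments in_right {R V W} _.

(* Main.v *)
Require Import Defs.
From HB Require Import structures.
From mathcomp Require Import all_boot all_order all_fingroup all_algebra fraction.
From mathcomp Require Import generic_quotient.
From mathcomp Require Import finmap boolp classical_sets functions ring zify.
From mathcomp.multinomials Require Import monalg.

(** The map is xi (x) x |-> xi * kappa(x), and all the work is to compute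
    products of such elements of Inv T_X.

    A tensor is replaced by its coefficient function on words in the basis.
    On such functions the componentwise product of the tensor powers, the
    shuffle product and the contractions with basis vectors are given by short
    recursions on the word ([fmul], [fshuf], [der]), and a tensor is invariant
    exactly when exchanging two adjacent letters costs the expected sign
    ([is_invP]).  The norm N(w) of a word w is the shuffle product of its
    letters, that is, the sum of its signed rearrangements.  The Euler identity
    (the sum over i of x_i * d_i t is deg(t) t for invariant t) shows that in
    characteristic zero the norms span the invariants ([euler_words]).  Hence
    (Inv X)^* is spanned by the functionals ev v taking the coefficient at v
    ([gdual_span]); under Sym(X^* ) = (Inv X)^* the product of the dual vectors
    of the letters of v is ev v up to a sign ([gdual_word]), and kappa sends it
    to the norm N(v) of v read as a word of X^* ([psi_sym_gdual]).

    Multiplicativity over K.  Two product rules govern the componentwise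
    product of invariants: in (x * s) t, the vector x meets a letter of t, and
    in s (x * t) it meets a letter of s ([fmul_fins_l], [fmul_fins_r]).  Apply
    them in T_X to (xi * N(v)) (eta * N(v')) for words v, v' of X^*.  As
    X^* X^* = 0, each letter of v has to act on a letter of eta and each letter
    of v' on a letter of xi.  So a sum over words u, u' of X appears, in
    which u acts on v, u' acts on v', and the rest is the product of
    the derivatives of xi along u' and of eta along u ([fmul_double]).  The
    product of the Turner double gives the same sum: its Sweedler components
    are these derivatives ([sum_sweedler]), and the actions of Inv X on ev v and
    ev v' are those of u on v and of u' on v' ([ract_ev], [lact_ev]).  Comparing
    the signs yields [PhiK_mul].

    Injectivity over K.  At a word u v with u in X and v in X^*, the
    coefficient of xi * kappa(x) is the product of the coefficient of xi at u
    and that of kappa(x) at v ([fshuf_split]); so the map is the tensor product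
    of two injective ones ([PhiK_inj]).

    Integrality.  kappa sends v^(m) to the m-th tensor power of v and products
    to shuffle products, so 'DX lands in the integral invariants.  Conversely,
    an integral invariant t of T_X is determined by its coefficients at words
    u v with u in X and v a sorted word of X^*.  The shuffle products of tensor
    powers of dual basis vectors, which are the images under kappa of the
    monomials in divided powers, are dual to the sorted words v; hence t is
    the sum, over sorted v, of the slice of t at v shuffled with the
    corresponding monomial ([surj_decomp]).  No denominators enter, so 'DX is
    exactly the preimage of Inv T_X ([dturnerP]).  Closure under the product,
    bijectivity and multiplicativity over O all follow from this description. *)

Set Implicit Arguments.
Unset Strict Implicit.
Unset Printing Implicit Defensive.

Import GRing.Theory.
Local Open Scope ring_scope.
Local Open Scope quotient_scope.

(** * Coefficient functions, insertions and shuffles *)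

(** Coefficient functions of tensors.  Infinite supports are allowed, so that
    the operators below need no finiteness conditions. *)
Notation fn R W := (seq (sbasis W) -> R^o).

Section Functions.
Variables (R : comNzRingType) (W : sspace).
Implicit Types (s t : fn R W) (k x y : W) (b : bool) (z w : seq W).

Definition sg b : R := (-1) ^+ b.

Lemma sgM a b : sg a * sg b = sg (a (+) b).
Proof. by rewrite /sg signr_addb. Qed.

Lemma sgK b : sg b * sg b = 1.
Proof. by rewrite sgM addbb. Qed.

Lemma fnD (A : Type) (s t : A -> R^o) (z : A) : (s + t) z = s z + t z. Proof. by []. Qed.
Lemma fnZ (A : Type) a (s : A -> R^o) (z : A) : (a *: s) z = a * s z. Proof. by []. Qed.
Lemma fn0 (A : Type) (z : A) : (0 : A -> R^o) z = 0. Proof. by []. Qed.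
Lemma fn_sum (A I : Type) (r : seq I) (P : pred I) (F : I -> A -> R^o) (z : A) :
  (\sum_(i <- r | P i) F i) z = \sum_(i <- r | P i) F i z.
Proof. by rewrite fct_sumE. Qed.

Lemma wpar_cons k z : wpar (k :: z) = spar k (+) wpar z.
Proof. by rewrite /wpar big_cons. Qed.
Lemma wpar_nil : wpar ([::] : seq W) = false.
Proof. by rewrite /wpar big_nil. Qed.
Lemma wpar_cat w z : wpar (w ++ z) = wpar w (+) wpar z.
Proof. by rewrite /wpar big_cat. Qed.

(** The contraction with the dual vector of k on the left. *)
Definition der k s : fn R W := fun z => s (k :: z).
(** For odd b, the sign automorphism (-1)^parity; it appears whenever a letter
    of parity b passes a tensor. *)
Definition tw b s : fn R W := fun z => sg (b && wpar z) * s z.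
Definition ew w : fn R W := fun z => (z == w)%:R.

(** The shuffle product of the letter x with s: x is inserted in all places and
    passes the letters before it. *)
Fixpoint fins x s z {struct z} : R^o :=
  if z is k :: z' then
    (k == x)%:R * s z' + sg (spar x && spar k) * fins x (der k s) z'
  else 0.

(** The shuffle product.  The first letter k of a shuffle comes from s, or from
    t, and then it has passed all of s. *)
Fixpoint fshuf s t z {struct z} : R^o :=
  if z is k :: z' then
    fshuf (der k s) t z' + fshuf (tw (spar k) s) (der k t) z'
  else s [::] * t [::].

Lemma fins_is_linear x : linear (fins x).
Proof.
move=> a s t; apply: funext => z; elim: z s t => [|k z IH] s t /=.
  by rewrite fnD fnZ /=; ring.
have -> : der k (a *: s + t) = a *: der k s + der k t by [].
by rewrite IH !fnD !fnZ /=; ring.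
Qed.
HB.instance Definition _ x :=
  GRing.isLinear.Build R (fn R W) (fn R W) _ (fins x) (fins_is_linear x).
Lemma fins0 x: fins x 0 = 0. Proof. exact: (linear0 (fins x)). Qed.
Lemma finsD x s1 s2 : fins x (s1 + s2) = fins x s1 + fins x s2.
Proof. exact: (linearD (fins x)). Qed.
Lemma finsZ x a s1 : fins x (a *: s1) = a *: fins x s1.
Proof. exact: (linearZ_LR (fins x)). Qed.
Lemma fins_sum x (I : Type) (r : seq I) (P : pred I) (F : I -> fn R W) :
  fins x (\sum_(i <- r | P i) F i) = \sum_(i <- r | P i) fins x (F i).
Proof. exact: (linear_sum (fins x)). Qed.
Definition finsL := (finsD, finsZ).

Lemma der_is_linear k : linear (der k).
Proof. by []. Qed.
HB.instance Definition _ k :=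
  GRing.isLinear.Build R (fn R W) (fn R W) _ (der k) (der_is_linear k).
Lemma derD k s1 s2 : der k (s1 + s2) = der k s1 + der k s2.
Proof. exact: (linearD (der k)). Qed.
Lemma derZ k a s1 : der k (a *: s1) = a *: der k s1.
Proof. exact: (linearZ_LR (der k)). Qed.
Lemma der_sum k (I : Type) (r : seq I) (P : pred I) (F : I -> fn R W) :
  der k (\sum_(i <- r | P i) F i) = \sum_(i <- r | P i) der k (F i).
Proof. exact: (linear_sum (der k)). Qed.
Definition derL := (derD, derZ).

Lemma tw_is_linear b : linear (tw b).
Proof.
by move=> a s t; apply: funext => z; rewrite fnD fnZ /tw fnD fnZ; ring.
Qed.
HB.instance Definition _ b :=
  GRing.isLinear.Build R (fn R W) (fn R W) _ (tw b) (tw_is_linear b).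
Lemma tw0 b: tw b 0 = 0. Proof. exact: (linear0 (tw b)). Qed.
Lemma twD b s1 s2 : tw b (s1 + s2) = tw b s1 + tw b s2.
Proof. exact: (linearD (tw b)). Qed.
Lemma twZ b a s1 : tw b (a *: s1) = a *: tw b s1.
Proof. exact: (linearZ_LR (tw b)). Qed.
Lemma tw_sum b (I : Type) (r : seq I) (P : pred I) (F : I -> fn R W) :
  tw b (\sum_(i <- r | P i) F i) = \sum_(i <- r | P i) tw b (F i).
Proof. exact: (linear_sum (tw b)). Qed.
Definition twL := (twD, twZ).

Lemma fshuf_is_linear s : linear (fshuf s).
Proof.
move=> a t u; apply: funext => z; elim: z s t u => [|k z IH] s t u /=.
  by rewrite !fnD !fnZ /=; ring.
have -> : der k (a *: t + u) = a *: der k t + der k u by [].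
by rewrite !IH !fnD !fnZ /=; ring.
Qed.
HB.instance Definition _ s :=
  GRing.isLinear.Build R (fn R W) (fn R W) _ (fshuf s) (fshuf_is_linear s).
Lemma fshufr0 s: fshuf s 0 = 0. Proof. exact: (linear0 (fshuf s)). Qed.
Lemma fshufrD s s1 s2 : fshuf s (s1 + s2) = fshuf s s1 + fshuf s s2.
Proof. exact: (linearD (fshuf s)). Qed.
Lemma fshufrZ s a s1 : fshuf s (a *: s1) = a *: fshuf s s1.
Proof. exact: (linearZ_LR (fshuf s)). Qed.
Lemma fshufr_sum s (I : Type) (r : seq I) (P : pred I) (F : I -> fn R W) :
  fshuf s (\sum_(i <- r | P i) F i) = \sum_(i <- r | P i) fshuf s (F i).
Proof. exact: (linear_sum (fshuf s)). Qed.
Definition fshufrL := (fshufrD, fshufrZ).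

Definition fshuf_on t := fshuf^~ t.
Lemma fshuf_on_is_linear t : linear (fshuf_on t).
Proof.
rewrite /fshuf_on.
move=> a s u; apply: funext => z; elim: z s t u => [|k z IH] s t u /=.
  by rewrite !fnD !fnZ /=; ring.
have -> : der k (a *: s + u) = a *: der k s + der k u by [].
by rewrite twD twZ !IH !fnD !fnZ /=; ring.
Qed.
HB.instance Definition _ t :=
  GRing.isLinear.Build R (fn R W) (fn R W) _ (fshuf_on t) (fshuf_on_is_linear t).

Lemma fshufl0 t: fshuf 0 t = 0. Proof. exact: (linear0 (fshuf_on t)). Qed.
Lemma fshuflD t s1 s2 : fshuf (s1 + s2) t = fshuf s1 t + fshuf s2 t.
Proof. exact: (linearD (fshuf_on t)). Qed.
Lemma fshuflZ t a s1 : fshuf (a *: s1) t = a *: fshuf s1 t.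
Proof. exact: (linearZ_LR (fshuf_on t)). Qed.
Lemma fshufl_sum t (I : Type) (r : seq I) (P : pred I) (F : I -> fn R W) :
  fshuf (\sum_(i <- r | P i) F i) t = \sum_(i <- r | P i) fshuf (F i) t.
Proof. exact: (linear_sum (fshuf_on t)). Qed.
Definition fshuflL := (fshuflD, fshuflZ).

Lemma twK b b' s : tw b (tw b' s) = tw (b (+) b') s.
Proof.
apply: funext => z; rewrite /tw mulrA sgM; congr (sg _ * _).
by case: b b' (wpar z) => [] [] [].
Qed.
Lemma tw_false s : tw false s = s.
Proof. by apply: funext => z; rewrite /tw /sg mul1r. Qed.
Lemma der_tw k b s : der k (tw b s) = sg (b && spar k) *: tw b (der k s).
Proof.
apply: funext => z; rewrite /der /tw fnZ wpar_cons mulrA sgM; congr (sg _ * _).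
by case: b (spar k) (wpar z) => [] [] [].
Qed.

Lemma der_fins k x s :
  der k (fins x s) = (k == x)%:R *: s + sg (spar x && spar k) *: fins x (der k s).
Proof. by []. Qed.

Lemma der_sum_fins k (a : W -> R) s : der k (\sum_m a m *: fins m s) =
  a k *: s + \sum_m (a m * sg (spar m && spar k)) *: fins m (der k s).
Proof.
rewrite der_sum; under eq_bigr do rewrite derZ der_fins scalerDr !scalerA.
rewrite big_split /=; congr (_ + _).
rewrite (bigD1 k) //= eqxx mulr1 big1 ?addr0 // => m /negPf mk.
by rewrite eq_sym mk mulr0 scale0r.
Qed.

Lemma tw_fins b x s : tw b (fins x s) = sg (b && spar x) *: fins x (tw b s).
Proof.
apply: funext => z; elim: z s => [|k z IH] s; first by rewrite /tw fnZ /= !mulr0.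
rewrite -[LHS]/(der k _ z) -[RHS]/(der k _ z) derZ !(der_tw, der_fins, twL, finsL).
rewrite !(fnD, fnZ) IH fnZ.
case: eqP => [->|_]; rewrite ?mul1r ?mul0r; ring.
Qed.

Lemma der_fshuf k s t :
  der k (fshuf s t) = fshuf (der k s) t + fshuf (tw (spar k) s) (der k t).
Proof. by []. Qed.

Lemma tw_fshuf b s t : tw b (fshuf s t) = fshuf (tw b s) (tw b t).
Proof.
apply: funext => z; elim: z s t => [|k z IH] s t /=.
  by rewrite /tw wpar_nil andbF /sg /= !mul1r.
rewrite -[LHS]/(der k _ z) der_tw der_fshuf !(twL, der_tw, fshuflL, fshufrL) !(fnD, fnZ).
rewrite !IH !twK addbC; ring.
Qed.

(** With [fshuf_fins_r], the cases of associativity and supercommutativity of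
    the shuffle product in which one factor is a letter. *)
Lemma fshuf_fins_l x s t : fshuf (fins x s) t = fins x (fshuf s t).
Proof.
apply: funext => z; elim: z s t => [|k z IH] s t /=; first by rewrite mul0r.
rewrite !(der_fins, der_fshuf, tw_fins, fshuflL, finsL, fnD, fnZ) !IH.
by rewrite andbC; ring.
Qed.

Lemma fshuf_fins_r x s t : fshuf s (fins x t) = fins x (fshuf (tw (spar x) s) t).
Proof.
apply: funext => z; elim: z s t => [|k z IH] s t /=; first by rewrite mulr0.
rewrite !(der_fins, der_fshuf, der_tw, fshufrL, fshuflL, finsL, fnD, fnZ) !IH.
rewrite !twK [spar x (+) _]addbC.
have -> : (k == x)%:R * fshuf (tw (spar k) s) t z = (k == x)%:R * fshuf (tw (spar x) s) t z.
  by case: eqP => [->|]; rewrite // !mul0r.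
by rewrite mulrDr !mulrA sgK mul1r; ring.
Qed.

Lemma fshuf_ew0 s : fshuf s (ew [::]) = s.
Proof.
apply: funext => z; elim: z s => [|k z IH] s /=.
  by rewrite /ew eqxx mulr1.
rewrite IH; suff -> : der k (ew [::]) = 0 by rewrite fshufr0 fn0 addr0.
by apply: funext.
Qed.

Lemma ew0_fshuf s : fshuf (ew [::]) s = s.
Proof.
apply: funext => z; elim: z s => [|k z IH] s /=.
  by rewrite /ew eqxx mul1r.
have -> : der k (ew [::]) = 0 by apply: funext.
have -> : tw (spar k) (ew [::]) = ew [::].
  by apply: funext => -[|? ?]; rewrite /tw /ew /= ?mulr0 // wpar_nil andbF /sg mul1r.
by rewrite IH fshufl0 fn0 add0r.
Qed.

(** The shuffle product of the letters of w with s; for s = 1 it is the norm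
    [nw w], the sum of the signed rearrangements of w. *)
Definition nact w s : fn R W := foldr fins s w.
Definition nw w := nact w (ew [::]).

Lemma nact_cat w w' s : nact (w ++ w') s = nact w (nact w' s).
Proof. by rewrite /nact foldr_cat. Qed.
Lemma nact_is_linear w : linear (nact w).
Proof. by elim: w => [//|x w IH] a s t /=; rewrite IH finsD finsZ. Qed.
HB.instance Definition _ w :=
  GRing.isLinear.Build R (fn R W) (fn R W) _ (nact w) (nact_is_linear w).
Lemma nactZ w a s1 : nact w (a *: s1) = a *: nact w s1.
Proof. exact: (linearZ_LR (nact w)). Qed.

Lemma nact_sum w (I : Type) (r : seq I) (P : pred I) (F : I -> fn R W) :
  nact w (\sum_(i <- r | P i) F i) = \sum_(i <- r | P i) nact w (F i).
Proof. exact: (linear_sum (nact w)). Qed.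

Lemma fshuf_nact w s t : fshuf (nact w s) t = nact w (fshuf s t).
Proof. by elim: w => //= x w IH; rewrite fshuf_fins_l IH. Qed.
Lemma fshuf_nw w t : fshuf (nw w) t = nact w t.
Proof. by rewrite fshuf_nact ew0_fshuf. Qed.
Lemma nw_cat w w' : nw (w ++ w') = fshuf (nw w) (nw w').
Proof. by rewrite fshuf_nw /nw nact_cat. Qed.
Lemma fshuf_nact_r w s t : fshuf s (nact w t) = nact w (fshuf (tw (wpar w) s) t).
Proof.
elim: w s => [|x w IH] s /=; first by rewrite wpar_nil tw_false.
by rewrite fshuf_fins_r IH twK wpar_cons addbC.
Qed.
Lemma tw_nact b w s : tw b (nact w s) = sg (b && wpar w) *: nact w (tw b s).
Proof.
elim: w => [|x w IH] /=; first by rewrite wpar_nil andbF /sg scale1r.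
rewrite tw_fins IH finsZ scalerA sgM wpar_cons; congr (sg _ *: _).
by case: (b) (spar x) (wpar w) => [] [] [].
Qed.
Lemma nw_size w z : size w != size z -> nw w z = 0.
Proof.
rewrite /nw; elim: w z => [|x w IH] [|k z] //=.
rewrite eqSS => /[dup] h /IH ->; rewrite mulr0 add0r.
suff -> : fins x (der k (nact w (ew [::]))) z = 0 by rewrite mulr0.
have: forall s : fn R W, (forall u, (size u).+1 == size z -> s u = 0) -> fins x s z = 0.
  elim: {k w IH h} z => [//|k z IH] s hs /=.
  by rewrite hs ?eqxx // IH ?mulr0 ?addr0 // => u /eqP hu; apply: hs; rewrite /= hu.
apply=> u /eqP hu; rewrite /der.
by apply: IH; rewrite /= hu.
Qed.

(** An insertion into w commutes with an insertion into v, the two words being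
    separate variables; [nw_sym] reads one off on each side of the matrix. *)
Lemma fins_exch x y (M : seq W -> seq W -> R^o) w v :
  fins x (fun w' => fins y (M w') v) w = fins y (fun v' => fins x (M^~ v') w) v.
Proof.
elim: w M => [|k w IHw] M.
  by rewrite /= -[RHS]/(fins y 0 v) fins0.
rewrite -[LHS]/(der k _ w) der_fins fnD !fnZ.
rewrite -[der k _]/(fun w' => fins y (M (k :: w')) v) (IHw (fun w' => M (k :: w'))).
rewrite -!fnZ -!finsZ -!fnD -!finsD; congr (fins y _ v).
Qed.

(** Both sides are the signed count of the permutations taking w to v.  The
    symmetry is what identifies the values of ev v on norms with the
    coefficients of a norm, see [psi_ev]. *)
Lemma nw_sym w v : nw w v = nw v w.
Proof.
have nwE k u z : der k (nw u) z = fins k (fun u' => nw u' z) u.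
  elim: u z => [//|i u IH] z.
  rewrite -[nw (i :: u)]/(fins i (nw u)) der_fins fnD !fnZ /=.
  rewrite eq_sym andbC; congr (_ + _ * _).
  have -> : der k (nw u) = fun z' => fins k (fun u' => nw u' z') u.
    by apply: funext => z'; exact: IH.
  by rewrite (fins_exch _ _ (fun z' u' => nw u' z')).
elim: v w => [|k v IH] w.
  by case: w => [//|k w]; rewrite /nw /= /ew.
rewrite -[LHS]/(der k _ v) nwE -[RHS]/(fins k (nw v) w).
by congr (fins k _ w); apply: funext => u; exact: IH.
Qed.

(** Invariance under adjacent transpositions, which generate the symmetric
    groups; [is_invP] makes the link with the group action. *)
Definition sinv s := forall w i j z,
  s (w ++ i :: j :: z) = sg (spar i && spar j) * s (w ++ j :: i :: z).

Lemma sinv_der k s : sinv s -> sinv (der k s).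
Proof. by move=> h w; exact: (h (k :: w)). Qed.

Lemma sinv_derC i j s : sinv s ->
  der i (der j s) = sg (spar i && spar j) *: der j (der i s).
Proof. by move=> h; apply: funext => z; rewrite andbC; exact: (h [::]). Qed.

Lemma sinvD s t : sinv s -> sinv t -> sinv (s + t).
Proof. by move=> hs ht w i j z; rewrite !fnD hs ht mulrDr. Qed.
Lemma sinv0 : sinv 0.
Proof. by move=> w i j z; rewrite mulr0. Qed.
Lemma sinv_sum (I : Type) (r : seq I) (P : pred I) (F : I -> fn R W) :
  (forall i, P i -> sinv (F i)) -> sinv (\sum_(i <- r | P i) F i).
Proof. by move=> h; apply: (big_ind sinv) => //; [exact: sinv0 | exact: sinvD]. Qed.
Lemma sinv_tw b s : sinv s -> sinv (tw b s).
Proof.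
move=> h w i j z; rewrite /tw h !wpar_cat !wpar_cons (addbCA (spar i)); ring.
Qed.
Lemma sinv_ew0 : sinv (ew [::]).
Proof. by move=> w i j z; rewrite /ew; case: w => [|? ?] /=; rewrite mulr0. Qed.

Lemma sinv_fshuf s t : sinv s -> sinv t -> sinv (fshuf s t).
Proof.
move=> hs ht w i j z; elim: w s t hs ht => [|k w IH] s t hs ht.
  rewrite -[LHS]/(der j (der i _) z) -[X in _ * X]/(der i (der j _) z).
  rewrite !(der_fshuf, der_tw, derL, fshuflL, fshufrL) !(fnD, fnZ).
  rewrite (sinv_derC _ _ hs) (sinv_derC _ _ ht) !(fshuflL, fshufrL, fnZ) !twK.
  rewrite [spar j (+) _]addbC [spar j && _]andbC.
  by rewrite !mulrDr !mulrA sgK !mul1r; ring.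
have e u : fshuf s t ((k :: w) ++ u) =
  fshuf (der k s) t (w ++ u) + fshuf (tw (spar k) s) (der k t) (w ++ u) by [].
rewrite !{}e (IH (der k s) t) ?(IH _ (der k t)) ?mulrDr //; try exact: sinv_der.
exact: sinv_tw.
Qed.

Lemma der_ew_nil k : der k (ew [::]) = 0.
Proof. exact: funext. Qed.

Lemma fins_ew0 x : fins x (ew [::]) = ew [:: x].
Proof.
apply: funext => -[|k z] //=; rewrite der_ew_nil fins0 mulr0 addr0 /ew eqseq_cons.
by case: eqP; rewrite ?mul1r ?mul0r.
Qed.

Lemma sinv_fins x s : sinv s -> sinv (fins x s).
Proof.
move=> hs.
have -> : fins x s = fshuf (fins x (ew [::])) s by rewrite fshuf_fins_l ew0_fshuf.
apply: sinv_fshuf => // w i j z; rewrite fins_ew0 /ew.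
by case: w => [|k [|? ?]]; rewrite /= !eqseq_cons ?andbF mulr0.
Qed.

Lemma sinv_nact w s : sinv s -> sinv (nact w s).
Proof. by move=> hs; elim: w => //= x w; exact: sinv_fins. Qed.
Lemma sinv_nw w : sinv (nw w).
Proof. exact/sinv_nact/sinv_ew0. Qed.

(** For each position in z, invariance moves its letter to the front, where
    contraction and insertion cancel: every position contributes s z. *)
Lemma euler s z : sinv s -> (\sum_i fins i (der i s)) z = (size z)%:R * s z.
Proof.
elim: z s => [|k z IH] s hs; rewrite fn_sum.
  by rewrite mul0r big1.
transitivity (s (k :: z) + \sum_i fins i (der i (der k s)) z).
  rewrite (bigD1 k) //= eqxx mul1r -addrA; congr (_ + _).
  rewrite [in RHS](bigD1 k) //=; congr (_ + _).
    rewrite -fnZ -finsZ; congr (fins k _ z).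
    by rewrite [in RHS](sinv_derC _ _ hs).
  apply: eq_bigr => i ik; rewrite eq_sym (negPf ik) mul0r add0r.
  rewrite -fnZ -finsZ; congr (fins i _ z).
  by rewrite [in RHS](sinv_derC _ _ hs).
have := IH _ (sinv_der k hs); rewrite fn_sum => ->.
by rewrite /der -[size (_ :: _)]/(size z).+1 -natr1; ring.
Qed.

Fixpoint words d : seq (seq W) :=
  if d is d'.+1 then [seq i :: w | i <- enum W, w <- words d'] else [:: [::]].

Lemma mem_words d w : (w \in words d) = (size w == d).
Proof.
elim: d w => [|d IH] [|i w] //=.
  by apply/allpairsP => -[[? ?] []].
rewrite eqSS -IH; apply/allpairsP/idP => [[[i' w'] /= [_ h [_ ->]]] //|h].
by exists (i, w); rewrite mem_enum.
Qed.

Lemma uniq_words d : uniq (words d).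
Proof.
elim: d => [//|d IH] /=; apply: allpairs_uniq => //; first exact: enum_uniq.
by move=> [i w] [i' w'] _ _ /= [-> ->].
Qed.

Lemma big_words (U : nmodType) d (F : seq W -> U) :
  \sum_(w <- words d.+1) F w = \sum_i \sum_(w <- words d) F (i :: w).
Proof. by rewrite /= big_allpairs_dep /= big_enum. Qed.

Definition cut d s : fn R W := fun z => (size z == d)%:R * s z.

Lemma fins_cut d x s : fins x (cut d s) = cut d.+1 (fins x s).
Proof.
apply: funext => z; elim: z d s => [|k z IH] d s; first by rewrite /cut /= mul0r.
rewrite [LHS](_ : _ = (k == x)%:R * cut d s z +
  sg (spar x && spar k) * fins x (der k (cut d s)) z) // /cut.
case: d => [|d] /=.
  rewrite eqSS.
  have -> : der k (cut 0 s) = 0 by apply: funext => u; rewrite /der /cut /= mul0r.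
  rewrite fins0 fn0; case: z {IH} => [|? ?] /=; ring.
have -> : der k (cut d.+1 s) = cut d (der k s) by [].
by rewrite IH /cut !eqSS; ring.
Qed.

Lemma cut_sum d (I : Type) (r : seq I) (P : pred I) (F : I -> fn R W) :
  cut d (\sum_(i <- r | P i) F i) = \sum_(i <- r | P i) cut d (F i).
Proof.
by apply: funext => z; rewrite /cut !fn_sum mulr_sumr.
Qed.

(** The Euler identity iterated d times: up to d!, an invariant tensor of
    degree d is a combination of norms. *)
Lemma euler_words d s : sinv s ->
  \sum_(w <- words d) s w *: nw w = d`!%:R *: cut d s.
Proof.
elim: d s => [|d IH] s hs.
  rewrite big_seq1; apply: funext => z; rewrite !fnZ /nw /cut /= /ew fact0.
  by case: z => [|k z]; rewrite ?mulr1 ?mulr0 ?mul0r ?mul1r.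
rewrite big_words.
transitivity (\sum_i fins i (d`!%:R *: cut d (der i s))).
  apply: eq_bigr => i _; rewrite -IH; last exact: sinv_der.
  by rewrite fins_sum; apply: eq_bigr => w _; rewrite finsZ.
under eq_bigr do rewrite finsZ fins_cut.
rewrite -scaler_sumr -cut_sum; apply: funext => z.
rewrite !fnZ /cut euler // factS natrM.
by case: eqP => [->|_]; rewrite !(mul1r, mul0r) ?mulr0 // !mulrA [d`!%:R * _]mulrC.
Qed.

End Functions.
Arguments sg {R} b.
Arguments fn_sum {R A I}.
Arguments ew R {W} w z.

(** * The componentwise product of tensor powers *)

Section Mul.
Variables (R : comNzRingType) (W : sspace) (c : sconst R W).
Implicit Types (s t : fn R W) (k x y i j m : W) (b : bool) (z w : seq W).

Definition graded := forall i j, homog (c i j) (spar i (+) spar j).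

(** The product of the algebras X^(x)d for all d together: the first letters i
    of s and j of t are multiplied, and j has passed the rest of s. *)
Fixpoint fmul s t z {struct z} : R^o :=
  if z is k :: z' then
    \sum_i \sum_j c i j k * fmul (tw (spar j) (der i s)) (der j t) z'
  else s [::] * t [::].

Lemma der_fmul k s t : der k (fmul s t) =
  \sum_i \sum_j c i j k *: fmul (tw (spar j) (der i s)) (der j t).
Proof.
apply: funext => z; rewrite fn_sum; apply: eq_bigr => i _.
by rewrite fn_sum; apply: eq_bigr.
Qed.

Definition fmul_on t := fmul^~ t.
Lemma fmul_is_linear s : linear (fmul s).
Proof.
move=> a t u; apply: funext => z; elim: z s t u => [|k z IH] s t u.
  by rewrite !(fnD, fnZ) /= !(fnD, fnZ); ring.
rewrite !(fnD, fnZ) /= mulr_sumr -big_split.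
apply: eq_bigr => i _; rewrite mulr_sumr -big_split.
by apply: eq_bigr => j _ /=; rewrite derD derZ IH !(fnD, fnZ); ring.
Qed.
HB.instance Definition _ s :=
  GRing.isLinear.Build R (fn R W) (fn R W) _ (fmul s) (fmul_is_linear s).

Lemma fmul_on_is_linear t : linear (fmul_on t).
Proof.
rewrite /fmul_on => a s u; apply: funext => z; elim: z s t u => [|k z IH] s t u.
  by rewrite !(fnD, fnZ) /= !(fnD, fnZ); ring.
rewrite !(fnD, fnZ) /= mulr_sumr -big_split.
apply: eq_bigr => i _; rewrite mulr_sumr -big_split.
by apply: eq_bigr => j _ /=; rewrite derD derZ twD twZ IH !(fnD, fnZ); ring.
Qed.
HB.instance Definition _ t :=
  GRing.isLinear.Build R (fn R W) (fn R W) _ (fmul_on t) (fmul_on_is_linear t).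

Lemma fmulr0 s : fmul s 0 = 0. Proof. exact: linear0. Qed.
Lemma fmull0 t : fmul 0 t = 0. Proof. exact: (linear0 (fmul_on t)). Qed.
Lemma fmulrD s t u : fmul s (t + u) = fmul s t + fmul s u.
Proof. exact: linearD. Qed.
Lemma fmullD t s u : fmul (s + u) t = fmul s t + fmul u t.
Proof. exact: (linearD (fmul_on t)). Qed.
Lemma fmulrZ s a t : fmul s (a *: t) = a *: fmul s t.
Proof. exact: linearZ_LR. Qed.
Lemma fmullZ t a s : fmul (a *: s) t = a *: fmul s t.
Proof. exact: (linearZ_LR (fmul_on t)). Qed.
Lemma fmulr_sum s (I : Type) (r : seq I) (P : pred I) (F : I -> fn R W) :
  fmul s (\sum_(i <- r | P i) F i) = \sum_(i <- r | P i) fmul s (F i).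
Proof. exact: linear_sum. Qed.
Lemma fmull_sum t (I : Type) (r : seq I) (P : pred I) (F : I -> fn R W) :
  fmul (\sum_(i <- r | P i) F i) t = \sum_(i <- r | P i) fmul (F i) t.
Proof. exact: (linear_sum (fmul_on t)). Qed.
Definition fmulL := (fmullD, fmullZ, fmulrD, fmulrZ).

Hypothesis cgr : graded.

(** Structure constants vanish unless the parities add up, so that this
    relation may be assumed when comparing signs next to one of them. *)
Lemma graded_mul i j k (a b : R) :
  (spar k = spar i (+) spar j -> a = b) -> c i j k * a = c i j k * b.
Proof.
move=> h; have [->|nz] := eqVneq (c i j k) 0; first by rewrite !mul0r.
by rewrite h // (cgr nz).
Qed.

Lemma tw_fmul b s t : tw b (fmul s t) = fmul (tw b s) (tw b t).
Proof.
apply: funext => z; elim: z s t => [|k z IH] s t /=.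
  by rewrite /tw wpar_nil andbF /sg /= !mul1r.
rewrite -[LHS]/(der k _ z) der_tw der_fmul fnZ tw_sum fn_sum mulr_sumr.
apply: eq_bigr => i _; rewrite tw_sum fn_sum mulr_sumr; apply: eq_bigr => j _.
rewrite twZ !fnZ mulrCA. apply: graded_mul => hk.
rewrite IH !der_tw twZ !fmulL !fnZ !twK mulrA sgM addbC; congr (sg _ * _).
by rewrite hk; case: (b) (spar i) (spar j) => [] [] [].
Qed.

(** The symmetric groups act by automorphisms: exchanging the first two letters
    of the product exchanges the first two letters of both factors. *)
Lemma sinv_fmul s t : sinv s -> sinv t -> sinv (fmul s t).
Proof.
move=> hs ht w k l z; elim: w s t hs ht => [|h w IH] s t hs ht; last first.
  rewrite -[LHS]/(der h _ (w ++ _)) -[X in _ * X]/(der h _ (w ++ _)) der_fmul.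
  rewrite !fn_sum mulr_sumr; apply: eq_bigr => i _.
  rewrite !fn_sum mulr_sumr; apply: eq_bigr => j _.
  by rewrite !fnZ IH; [ring | apply: sinv_tw; exact: sinv_der | exact: sinv_der].
have E p q u v : der q (der p (fmul u v)) = \sum_i \sum_j \sum_i' \sum_j'
    (c i j p * c i' j' q * sg (spar j && spar i')) *:
      fmul (tw (spar j (+) spar j') (der i' (der i u))) (der j' (der j v)).
  rewrite der_fmul der_sum; apply: eq_bigr => i _.
  rewrite der_sum; apply: eq_bigr => j _.
  rewrite derZ der_fmul scaler_sumr; apply: eq_bigr => i' _.
  rewrite scaler_sumr; apply: eq_bigr => j' _.
  by rewrite der_tw twZ twK fmulL !scalerA addbC.
rewrite -[LHS]/(der l (der k _) z) -[X in _ * X]/(der k (der l _) z) !E.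
rewrite -fnZ; congr (_ z).
under eq_bigr do rewrite exchange_big.
rewrite exchange_big scaler_sumr; apply: eq_bigr => i _.
under eq_bigr do rewrite exchange_big.
rewrite exchange_big scaler_sumr; apply: eq_bigr => j _.
rewrite scaler_sumr; apply: eq_bigr => i' _.
rewrite scaler_sumr; apply: eq_bigr => j' _.
rewrite (sinv_derC _ _ hs) (sinv_derC _ _ ht) twZ !fmulL !scalerA addbC.
congr (_ *: _); rewrite -!mulrA mulrCA [RHS]mulrCA; apply: graded_mul => ->.
rewrite [RHS]mulrCA; apply: graded_mul => ->; rewrite !sgM; congr sg.
by case: (spar i) (spar j) (spar i') (spar j') => [] [] [] [].
Qed.

(** First product rule.  The inserted vector x meets some letter j of t, and
    invariance of t allows to take it from the front; the product of x and j
    is inserted in turn. *)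
Lemma fmul_fins_l x s t : sinv t -> fmul (fins x s) t =
  \sum_j \sum_m c x j m *: fins m (fmul (tw (spar j) s) (der j t)).
Proof.
move=> ht; apply: funext => z; elim: z s t ht => [|k z IH] s t ht.
  by rewrite /= mul0r fn_sum big1 // => j _; rewrite fn_sum big1 // => m _; rewrite fnZ /= mulr0.
rewrite -[LHS]/(der k _ z) -[RHS]/(der k _ z) der_fmul der_sum !fn_sum.
(* The first letter k of the product comes from x and a letter j of t, or from
   other letters i and l, and then induction applies to what follows. *)
transitivity (\sum_j (c x j k *: fmul (tw (spar j) s) (der j t)) z +
  \sum_l \sum_i \sum_j \sum_m c i l k * (c x j m * (sg (spar x && spar i) *
     sg (spar x && spar l)) *
     fins m (fmul (tw (spar l (+) spar j) (der i s)) (der j (der l t))) z)).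
  transitivity (\sum_i \sum_l c i l k * ((i == x)%:R * fmul (tw (spar l) s) (der l t) z) +
   \sum_i \sum_l c i l k * (sg (spar x && spar i) * sg (spar x && spar l) *
      fmul (fins x (tw (spar l) (der i s))) (der l t) z)).
    rewrite -big_split; apply: eq_bigr => i _ /=.
    rewrite fn_sum -big_split; apply: eq_bigr => l _ /=.
    rewrite fnZ der_fins twD !twZ tw_fins !fmulL !(fnD, fnZ) andbC.
    by rewrite [spar x && spar l]andbC; ring.
  congr (_ + _).
    rewrite (bigD1 x) //= [X in _ + X]big1 ?addr0 => [|i ix].
      by apply: eq_bigr => l _; rewrite eqxx mul1r fnZ.
    by rewrite big1 // => l _; rewrite (negPf ix) mul0r mulr0.
  rewrite exchange_big; apply: eq_bigr => l _; apply: eq_bigr => i _.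
  rewrite IH; last exact: sinv_der.
  rewrite fn_sum !mulr_sumr; apply: eq_bigr => j _.
  rewrite fn_sum !mulr_sumr; apply: eq_bigr => m _.
  by rewrite fnZ twK [_ (+) spar l]addbC; ring.
transitivity (\sum_j (c x j k *: fmul (tw (spar j) s) (der j t)) z +
   \sum_j \sum_m c x j m * (sg (spar m && spar k) *
      fins m (der k (fmul (tw (spar j) s) (der j t))) z)); last first.
  rewrite -big_split; apply: eq_bigr => j _ /=; rewrite der_sum_fins fnD fn_sum.
  by congr (_ + _); apply: eq_bigr => m _; rewrite fnZ mulrA.
congr (_ + _).
under eq_bigr do rewrite exchange_big.
rewrite exchange_big; apply: eq_bigr => j _ /=.
under eq_bigr do rewrite exchange_big.
rewrite exchange_big; apply: eq_bigr => m _ /=.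
rewrite exchange_big der_fmul fins_sum fn_sum !mulr_sumr; apply: eq_bigr => i _.
rewrite fins_sum fn_sum !mulr_sumr; apply: eq_bigr => l _ /=.
rewrite finsZ fnZ !mulrA [RHS]mulrC !mulrA -!mulrA.
rewrite der_tw (sinv_derC _ _ ht) twZ twK !fmulL !finsZ !fnZ.
(* The remaining identity of signs holds as c i l k and c x j m fix the parities
   of k and m. *)
rewrite [RHS](_ : _ = c i l k * (c x j m * (sg (spar m && spar k) * (sg (spar j && spar i) * fins m
     (fmul (tw (spar l (+) spar j) (der i s)) (der l (der j t))) z)))); last by ring.
apply: graded_mul => hk; apply: graded_mul => hm; rewrite !mulrA !sgM.
congr (sg _ * _); rewrite hk hm.
by case: (spar i) (spar j) (spar x) (spar l) => [] [] [] [].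
Qed.

(** Second product rule, with the roles of the factors exchanged. *)
Lemma fmul_fins_r x s t : sinv s -> fmul s (fins x t) =
  \sum_i \sum_m c i x m *: fins m (fmul (tw (spar x) (der i s)) t).
Proof.
move=> hs; apply: funext => z; elim: z s t hs => [|k z IH] s t hs.
  by rewrite /= mulr0 fn_sum big1 // => j _; rewrite fn_sum big1 // => m _; rewrite fnZ /= mulr0.
rewrite -[LHS]/(der k _ z) -[RHS]/(der k _ z) der_fmul der_sum !fn_sum.
transitivity (\sum_i (c i x k *: fmul (tw (spar x) (der i s)) t) z +
  \sum_i \sum_l \sum_j \sum_m c i l k * (c j x m * (sg (spar x && spar l) *
     sg (spar l && spar j)) *
     fins m (fmul (tw (spar x (+) spar l) (der j (der i s))) (der l t)) z)).
  transitivity (\sum_i \sum_l c i l k * ((l == x)%:R * fmul (tw (spar l) (der i s)) t z) +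
   \sum_i \sum_l c i l k * (sg (spar x && spar l) *
      fmul (tw (spar l) (der i s)) (fins x (der l t)) z)).
    rewrite -big_split; apply: eq_bigr => i _ /=.
    rewrite fn_sum -big_split; apply: eq_bigr => l _ /=.
    by rewrite fnZ der_fins !fmulL !(fnD, fnZ); ring.
  congr (_ + _).
    apply: eq_bigr => i _; rewrite (bigD1 x) //= big1 ?addr0 => [|l lx].
      by rewrite eqxx mul1r fnZ.
    by rewrite (negPf lx) mul0r mulr0.
  apply: eq_bigr => i _; apply: eq_bigr => l _.
  rewrite IH; last by apply: sinv_tw; apply: sinv_der.
  rewrite fn_sum !mulr_sumr; apply: eq_bigr => j _.
  rewrite fn_sum !mulr_sumr; apply: eq_bigr => m _.
  by rewrite fnZ der_tw twZ twK fmulL finsZ fnZ; ring.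
transitivity (\sum_i (c i x k *: fmul (tw (spar x) (der i s)) t) z +
   \sum_i \sum_m c i x m * (sg (spar m && spar k) *
      fins m (der k (fmul (tw (spar x) (der i s)) t)) z)); last first.
  rewrite -big_split; apply: eq_bigr => i _ /=; rewrite der_sum_fins fnD fn_sum.
  by congr (_ + _); apply: eq_bigr => m _; rewrite fnZ mulrA.
congr (_ + _).
under eq_bigr do rewrite exchange_big.
rewrite exchange_big; apply: eq_bigr => j _ /=.
under eq_bigr do rewrite exchange_big.
rewrite exchange_big; apply: eq_bigr => m _ /=.
rewrite der_fmul fins_sum fn_sum !mulr_sumr; apply: eq_bigr => i _.
rewrite fins_sum fn_sum !mulr_sumr; apply: eq_bigr => l _ /=.
rewrite (sinv_derC _ _ hs) der_tw !twZ twK !(fmulL, finsZ, fnZ) [spar x (+) _]addbC.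
rewrite [RHS](_ : _ = c i l k * (c j x m * (sg (spar m && spar k) * (sg (spar x && spar i) * fins m
     (fmul (tw (spar l (+) spar x) (der i (der j s))) (der l t)) z)))); last by ring.
rewrite -!mulrA; apply: graded_mul => hk; apply: graded_mul => hm; rewrite !mulrA !sgM.
congr (sg _ * _); rewrite hk hm.
by case: (spar i) (spar j) (spar x) (spar l) => [] [] [] [].
Qed.

End Mul.

(** * Derivatives along words and changes of alphabet *)

Section Derw.
Variables (R : comNzRingType) (W : sspace).
Implicit Types (s t : fn R W) (k x y : W) (b : bool) (z w u v : seq W).

Definition derw u s : fn R W := fun z => s (u ++ z).

Lemma derwZ u a s : derw u (a *: s) = a *: derw u s. Proof. by []. Qed.

Lemma derw_tw u b s : derw u (tw b s) = sg (b && wpar u) *: tw b (derw u s).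
Proof.
apply: funext => z; rewrite /derw /tw fnZ wpar_cat mulrA sgM; congr (sg _ * _).
by case: b (wpar u) (wpar z) => [] [] [].
Qed.

Lemma sinv_derw u s : sinv s -> sinv (derw u s).
Proof. by move=> h w i j z; rewrite /derw !catA h. Qed.

(** An invariant tensor lets a letter, and in [sinv_catC] a word, move at the
    cost of the sign for the letters passed. *)
Lemma sinv_mid s w u k z : sinv s ->
  s (w ++ u ++ k :: z) = sg (spar k && wpar u) * s (w ++ k :: u ++ z).
Proof.
move=> h; elim: u w => [|i u IH] w; first by rewrite wpar_nil andbF /sg mul1r.
rewrite -cat_rcons cat_rcons -[RHS]mulr1.
have := IH (rcons w i); rewrite !cat_rcons /= => ->.
rewrite h mulrA sgM wpar_cons mulr1; congr (sg _ * _).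
by case: (spar i) (spar k) (wpar u) => [] [] [].
Qed.

Lemma sinv_catC s u z : sinv s -> s (z ++ u) = sg (wpar u && wpar z) * s (u ++ z).
Proof.
elim: u s => [|k u IH] s h; first by rewrite cats0 wpar_nil /sg mul1r.
rewrite -[z ++ _]cat0s (sinv_mid [::] z) //= -[s (k :: z ++ u)]/(der k s (z ++ u)).
rewrite (IH _ (sinv_der k h)) mulrA sgM wpar_cons; congr (sg _ * _).
by case: (spar k) (wpar u) (wpar z) => [] [] [].
Qed.

Lemma der_ew_cons k i w : der k (ew R (i :: w)) = (i == k)%:R *: ew R w.
Proof.
apply: funext => z; rewrite fnZ /der /ew eqseq_cons eq_sym.
by case: eqP => _ /=; rewrite ?mul1r ?mul0r.
Qed.
Lemma tw_ew b w : tw b (ew R w) = sg (b && wpar w) *: ew R w.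
Proof.
apply: funext => z; rewrite fnZ /tw /ew.
by case: eqP => [->|] //; rewrite !mulr0.
Qed.

(** The parity of [w; w], the sign in the pairing of a word with the word of
    its dual vectors. *)
Fixpoint eps w : bool := if w is i :: w' then (spar i && wpar w') (+) eps w' else false.

Lemma eps_cat u w : eps (u ++ w) = (wpar u && wpar w) (+) eps u (+) eps w.
Proof.
elim: u => [|i u IH] /=; first by rewrite wpar_nil.
rewrite IH wpar_cat wpar_cons.
by case: (spar i) (wpar u) (wpar w) (eps u) (eps w) => [] [] [] [] [].
Qed.

(** The parity of the bracket [u; w], see [bracket_br]. *)
Fixpoint br u w : bool :=
  match u, w with
  | _ :: u', j :: w' => (spar j && wpar u') (+) br u' w'
  | _, _ => false
  end.

End Derw.
Arguments eps {W} w.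
Arguments br {W} u w.

Section Embedding.
Variables (R : comNzRingType) (V W : sspace) (e : V -> W) (h : W -> option V).
Hypothesis he : pcancel e h.
Hypothesis eh : forall k i, h k = Some i -> e i = k.
Hypothesis epar : forall i, spar (e i) = spar i.
Implicit Types (s t : fn R V) (k : W) (i j : V) (b : bool) (z : seq W) (w u v : seq V).

(** The map of tensor algebras induced by an inclusion e of bases.  The partial
    inverse h of e tells which letters lie in the image; a word with a letter
    outside of it has coefficient 0. *)
Fixpoint finj s z : R^o :=
  if z is k :: z' then if h k is Some i then finj (der i s) z' else 0
  else s [::].

Lemma der_finj k s : der k (finj s) = if h k is Some i then finj (der i s) else 0.
Proof. by apply: funext => z; rewrite /der /=; case: (h k). Qed.
Lemma der_finj_in i s : der (e i) (finj s) = finj (der i s).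
Proof. by rewrite der_finj he. Qed.

Lemma finj_is_linear : linear finj.
Proof.
move=> a s t; apply: funext => z; elim: z s t => [|k z IH] s t //.
rewrite fnD fnZ /=; case: (h k) => [i|]; last by rewrite mulr0 addr0.
by rewrite derD derZ IH.
Qed.
HB.instance Definition _ :=
  GRing.isLinear.Build R (fn R V) (fn R W) _ finj finj_is_linear.
Lemma finjD s t : finj (s + t) = finj s + finj t. Proof. exact: linearD. Qed.
Lemma finjZ a s : finj (a *: s) = a *: finj s. Proof. exact: linearZ_LR. Qed.
Lemma finj0 : finj 0 = 0. Proof. exact: linear0. Qed.
Lemma finj_sum (I : Type) (r : seq I) (P : pred I) (F : I -> fn R V) :
  finj (\sum_(i <- r | P i) F i) = \sum_(i <- r | P i) finj (F i).
Proof. exact: linear_sum. Qed.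

Lemma wpar_map w : wpar (map e w) = wpar w.
Proof. by elim: w => [|i w IH] /=; rewrite ?wpar_nil // !wpar_cons IH epar. Qed.

Lemma finj_map s w : finj s (map e w) = s w.
Proof. by elim: w s => [|i w IH] s //=; rewrite he IH. Qed.

Lemma derw_finj s w : derw (map e w) (finj s) = finj (derw w s).
Proof.
elim: w s => [|i w IH] s //=.
by rewrite -[LHS]/(derw (map e w) (der (e i) _)) der_finj_in IH.
Qed.

Lemma tw_finj b s : tw b (finj s) = finj (tw b s).
Proof.
apply: funext => z; elim: z s => [|k z IH] s /=.
  by rewrite /tw !wpar_nil.
rewrite -[LHS]/(der k _ z) der_tw der_finj.
case E: (h k) => [i|]; last by rewrite tw0 fnZ mulr0.
by rewrite fnZ IH der_tw finjZ fnZ -(epar i) (eh E).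
Qed.

Lemma sinv_finj s : sinv s -> sinv (finj s).
Proof.
move=> hs w k l z; elim: w s hs => [|m w IH] s hs /=; last first.
  by case: (h m) => [i|]; [apply: IH; apply: sinv_der | rewrite mulr0].
case Ek: (h k) => [i|] /=; last by case El: (h l) => [j|] /=; rewrite ?Ek mulr0.
case El: (h l) => [j|] /=; last by rewrite mulr0.
by rewrite (sinv_derC _ _ hs) finjZ fnZ -(eh Ek) -(eh El) !epar andbC.
Qed.

Lemma finj_fins i s : finj (fins i s) = fins (e i) (finj s).
Proof.
apply: funext => z; elim: z s => [|k z IH] s //.
rewrite -[LHS]/(der k _ z) -[RHS]/(der k _ z) der_fins !der_finj.
case E: (h k) => [j|].
  rewrite der_fins finjD !finjZ !(fnD, fnZ) IH -(eh E) !epar.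
  by congr (_%:R * _ + _); rewrite (inj_eq (pcan_inj he)).
rewrite fins0 scaler0 addr0 fnZ; case: eqP => [ke|_]; last by rewrite mul0r.
by rewrite ke he in E.
Qed.

Lemma finj_ew w : finj (ew R w) = ew R (map e w).
Proof.
apply: funext => z; elim: w z => [|i w IH] [|k z] //=.
  by case: (h k) => [j|//]; rewrite der_ew_nil finj0.
case E: (h k) => [j|]; last first.
  by rewrite /ew eqseq_cons; case: eqP => // ke; rewrite ke he in E.
rewrite der_ew_cons finjZ fnZ IH /ew eqseq_cons -(eh E) (inj_eq (pcan_inj he)) eq_sym.
by case: (j == i); rewrite /= ?mul1r ?mul0r.
Qed.

Lemma finj_nact w s : finj (nact w s) = nact (map e w) (finj s).
Proof. by elim: w => //= i w <-; rewrite finj_fins. Qed.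
Lemma finj_nw w : finj (nw R w) = nw R (map e w).
Proof. by rewrite finj_nact finj_ew. Qed.

(** Letters outside the image of e are passed with a sign only.  In T_X,
    derivatives along X pass the letters of X^* in this way. *)
Lemma derw_nact w (x : seq W) (t : fn R W) :
  (forall k, k \in x -> h k = None) ->
  derw (map e w) (nact x t) = sg (wpar w && wpar x) *: nact x (derw (map e w) t).
Proof.
move=> hx; elim: w t => [|i w IH] t; first by rewrite wpar_nil /sg scale1r.
have D y (s : fn R W) : h y = None ->
    der (e i) (fins y s) = sg (spar y && spar i) *: fins y (der (e i) s).
  move=> hy; rewrite der_fins epar; case: eqP => [E|_]; last by rewrite scale0r add0r.
  by move: hy; rewrite -E he.
have -> : derw (map e (i :: w)) (nact x t) =
    derw (map e w) (sg (spar i && wpar x) *: nact x (der (e i) t)).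
  rewrite -[LHS]/(derw (map e w) (der (e i) _)); congr (derw _ _).
  elim: x hx {IH} => [|y x IHx] hx /=; first by rewrite wpar_nil andbF /sg scale1r.
  rewrite D; last by apply: hx; rewrite mem_head.
  rewrite IHx; last by move=> k kx; apply: hx; rewrite inE kx orbT.
  rewrite finsZ scalerA sgM wpar_cons; congr (sg _ *: _).
  by case: (spar i) (spar y) (wpar x) => [] [] [].
rewrite derwZ IH scalerA sgM wpar_cons.
congr (sg _ *: _).
by case: (spar i) (wpar w) (wpar x) => [] [] [].
Qed.

End Embedding.

(** * Products in the trivial extension *)

Section Trivial.
Variables (R : comNzRingType) (V : sspace) (c : sconst R V).
Hypothesis cgr : graded c.
Local Notation T := (ssum V (sdual V)).
Local Notation cT := (trivial_ext c).
Implicit Types (s t xi eta : fn R V) (i j k x : V) (b : bool) (u v w z : seq V) (S Y : fn R T).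

Definition lft (p : T) : option V := if p is inl i then Some i else None.
Definition rgt (p : T) : option V := if p is inr i then Some i else None.
Definition il i : T := inl i.
Definition ir i : T := inr i.
Local Notation linj := (finj (R := R) lft).
Local Notation rinj := (finj (R := R) rgt).

Lemma ilK : pcancel il lft. Proof. by []. Qed.
Lemma irK : pcancel ir rgt. Proof. by []. Qed.
Lemma lftK p i : lft p = Some i -> il i = p. Proof. by case: p => // j [->]. Qed.
Lemma rgtK p i : rgt p = Some i -> ir i = p. Proof. by case: p => // j [->]. Qed.
Lemma il_par i : spar (il i) = spar i. Proof. by []. Qed.
Lemma ir_par i : spar (ir i) = spar i. Proof. by []. Qed.

Lemma tw_linj b s : tw b (linj s) = linj (tw b s).
Proof. exact: (tw_finj lftK il_par). Qed.
Lemma sinv_linj s : sinv s -> sinv (linj s).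
Proof. exact: (sinv_finj lftK il_par). Qed.

Lemma graded_trivial : graded cT.
Proof.
move=> [i|i] [j|j] [k|k]; rewrite ffunE /= ?eqxx //= => /cgr ->;
  by case: (spar i); case: (spar j); case: (spar k).
Qed.

Lemma linj_fmul s t : linj (fmul c s t) = fmul cT (linj s) (linj t).
Proof.
apply: funext => z; elim: z s t => [|k z IH] s t //.
rewrite -[LHS]/(der k _ z) -[RHS]/(der k _ z) der_fmul !der_finj fn_sum big_sumType /=.
rewrite addrC big1 ?add0r; last first.
  move=> i _; rewrite fn_sum big1 // => p _.
  by rewrite der_finj tw0 fmull0 fnZ mulr0.
transitivity (\sum_i \sum_j cT (inl i) (inl j) k * fmul cT (tw (spar j) (linj (der i s))) (linj (der j t)) z); last first.
  apply: eq_bigr => i _; rewrite fn_sum big_sumType /= [X in _ = _ + X]big1 ?addr0; last first.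
    by move=> j _; rewrite [in fmul _ _ _]der_finj fmulr0 fnZ mulr0.
  by apply: eq_bigr => j _; rewrite fnZ !der_finj.
case: k => k /=; last first.
  by rewrite big1 // => i _; rewrite big1 // => j _; rewrite ffunE mul0r.
rewrite der_fmul finj_sum fn_sum; apply: eq_bigr => i _.
rewrite finj_sum fn_sum; apply: eq_bigr => j _.
by rewrite ffunE finjZ fnZ IH tw_linj.
Qed.

(** The structure constants of T_X in the bimodule X^*: the coefficients at x^k
    of x^i . x_j and of x_j . x^i. *)
Definition lconst i j k := c j k i.
Definition rconst i j k := c k j i.
(** The words v of X^* and u of X are multiplied letter by letter, with the
    constants d, and the letters of the result are inserted into S. *)
Fixpoint insm (d : V -> V -> V -> R) v u S : fn R T :=
  match v, u with
  | i :: v', j :: u' => \sum_k d i j k *: fins (ir k) (insm d v' u' S)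
  | _, _ => S
  end.

Lemma insm_is_linear d v u : linear (insm d v u).
Proof.
elim: v u => [|i v IH] [|j u] // a S Y /=.
rewrite scaler_sumr -big_split; apply: eq_bigr => k _ /=.
by rewrite IH finsD finsZ scalerDr !scalerA mulrC.
Qed.
HB.instance Definition _ d v u :=
  GRing.isLinear.Build R (fn R T) (fn R T) _ (insm d v u) (insm_is_linear d v u).
Lemma insmD d v u S Y : insm d v u (S + Y) = insm d v u S + insm d v u Y.
Proof. exact: linearD. Qed.
Lemma insmZ d v u a S : insm d v u (a *: S) = a *: insm d v u S.
Proof. exact: linearZ_LR. Qed.
Lemma insm_sum d v u (I : Type) (r : seq I) (P : pred I) (F : I -> fn R T) :
  insm d v u (\sum_(i <- r | P i) F i) = \sum_(i <- r | P i) insm d v u (F i).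
Proof. exact: linear_sum. Qed.

(** The first product rule for the letters of v in turn.  They only meet
    letters of X, because X^* X^* = 0. *)
Lemma fmul_nact_l v S Y : sinv Y ->
  fmul cT (nact (map ir v) S) Y =
  \sum_(u <- words V (size v)) sg (br v u) *:
    insm lconst v u (fmul cT (tw (wpar u) S) (derw (map il u) Y)).
Proof.
elim: v S Y => [|i v IH] S Y hY; first by rewrite big_seq1 wpar_nil tw_false /sg scale1r.
rewrite big_words /= fmul_fins_l //; last exact: graded_trivial.
rewrite big_sumType /= [X in _ + X]big1 ?addr0; last first.
  by move=> j _; rewrite big1 // => -[k|k] _; rewrite ffunE scale0r.
apply: eq_bigr => j _.
rewrite big_sumType /= big1 ?add0r; last by move=> k _; rewrite ffunE scale0r.
transitivity (\sum_k \sum_(u <- words V (size v)) (sg (spar j && wpar v) * sg (br v u) * c j k i) *: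
   fins (ir k) (insm lconst v u (fmul cT (tw (wpar (j :: u)) S) (derw (map il (j :: u)) Y)))).
  apply: eq_bigr => k _; rewrite ffunE tw_nact fmulL (wpar_map ir_par).
  rewrite IH; last exact: sinv_der.
  rewrite scaler_sumr fins_sum scaler_sumr; apply: eq_bigr => u _.
  rewrite !finsZ !scalerA twK wpar_cons [spar j (+) _]addbC; congr (_ *: _).
  by rewrite mulrC.
rewrite exchange_big; apply: eq_bigr => u _ /=.
by rewrite scaler_sumr; apply: eq_bigr => k _; rewrite scalerA sgM.
Qed.

Lemma fmul_nact_r v S Y : sinv Y ->
  fmul cT Y (nact (map ir v) S) =
  \sum_(u <- words V (size v)) sg (br u v) *:
    insm rconst v u (fmul cT (tw (wpar v) (derw (map il u) Y)) S).
Proof.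
elim: v S Y => [|i v IH] S Y hY; first by rewrite big_seq1 wpar_nil tw_false /sg scale1r.
rewrite big_words /= fmul_fins_r //; last exact: graded_trivial.
rewrite big_sumType /= [X in _ + X]big1 ?addr0; last first.
  by move=> j _; rewrite big1 // => -[k|k] _; rewrite ffunE scale0r.
apply: eq_bigr => j _.
rewrite big_sumType /= big1 ?add0r; last by move=> k _; rewrite ffunE scale0r.
transitivity (\sum_k \sum_(u <- words V (size v)) (sg (spar i && wpar u) * sg (br u v) * c k j i) *:
   fins (ir k) (insm rconst v u (fmul cT (tw (wpar (i :: v)) (derw (map il (j :: u)) Y)) S))).
  apply: eq_bigr => k _; rewrite ffunE.
  rewrite IH; last by apply: sinv_tw; apply: sinv_der.
  rewrite fins_sum scaler_sumr; apply: eq_bigr => u _.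
  rewrite derw_tw (wpar_map il_par) twZ twK fmulL insmZ !finsZ !scalerA wpar_cons.
  rewrite [wpar v (+) _]addbC; congr (_ *: _).
  by ring.
rewrite exchange_big; apply: eq_bigr => u _ /=.
by rewrite scaler_sumr; apply: eq_bigr => k _; rewrite scalerA sgM.
Qed.

(** The product of xi * N(v) and eta * N(v') in T_X: the letters of v consume a
    word u of eta, those of v' a word u' of xi, and what remains of xi and eta is
    multiplied in X. *)
Lemma fmul_double v v' xi eta : sinv xi -> sinv eta ->
  fmul cT (fshuf (linj xi) (nw R (map ir v))) (fshuf (linj eta) (nw R (map ir v'))) =
  \sum_(u <- words V (size v)) \sum_(u' <- words V (size v'))
    sg (br v u (+) br u' v' (+) (wpar u' && (wpar u (+) wpar v))) *:
    insm lconst v u (insm rconst v' u' (linj (fmul c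
      (tw (wpar v (+) wpar u (+) wpar v') (derw u' xi)) (tw (wpar v') (derw u eta))))).
Proof.
move=> hxi heta; rewrite !fshuf_nact_r !fshuf_ew0 !(wpar_map ir_par) !tw_linj.
rewrite fmul_nact_l; last by apply/sinv_nact/sinv_linj; apply: sinv_tw.
apply: eq_bigr => u _.
rewrite (derw_nact ilK) //; last by move=> k /mapP[i _ ->].
rewrite (derw_finj ilK) derw_tw finjZ nactZ scalerA (wpar_map ir_par) [wpar v' && _]andbC sgK scale1r.
rewrite tw_linj twK fmul_nact_r; last by apply: sinv_linj; apply: sinv_tw.
rewrite insm_sum scaler_sumr; apply: eq_bigr => u' _.
rewrite insmZ scalerA (derw_finj ilK) derw_tw !(finjZ, twZ, fmulL, insmZ) scalerA.
rewrite tw_linj twK -linj_fmul !sgM; congr (sg _ *: insm _ _ _ (insm _ _ _ (linj (fmul _ (tw _ _) _)))).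
  by case: (br v u) (br u' v') (wpar u) (wpar v) (wpar u') => [] [] [] [] [].
by case: (wpar u) (wpar v) (wpar v') => [] [] [].
Qed.

Lemma fmul_ew_cons i j k u z v :
  fmul c (ew R (j :: u)) (ew R (k :: z)) (i :: v) =
  c j k i * (sg (spar k && wpar u) * fmul c (ew R u) (ew R z) v).
Proof.
rewrite -[LHS]/(der i _ v) der_fmul fn_sum (bigD1 j) //= [X in _ + X]big1 ?addr0.
  rewrite fn_sum (bigD1 k) //= [X in _ + X]big1 ?addr0.
    by rewrite !der_ew_cons !eqxx !scale1r tw_ew fmulL !fnZ.
  by move=> k' /negPf h; rewrite !der_ew_cons [k == _]eq_sym h scale0r fmulr0 scaler0.
move=> j' /negPf h; rewrite fn_sum big1 // => k' _.
by rewrite !der_ew_cons [j == _]eq_sym h scale0r tw0 fmull0 scaler0.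
Qed.

Lemma fmul_ew_par b u z v :
  sg (b && wpar v) * fmul c (ew R u) (ew R z) v =
  sg (b && (wpar u (+) wpar z)) * fmul c (ew R u) (ew R z) v.
Proof.
rewrite -[LHS]/(tw b _ v) tw_fmul // !tw_ew !fmulL !fnZ mulrA sgM; congr (sg _ * _).
by case: b (wpar u) (wpar z) => [] [] [].
Qed.

(** The letterwise action of u on v is that of u on functionals: the coefficient
    at v of the product of u and z is the value on z of the functional ev v
    acted on by u, as in [ract_ev].  The signs come from reading functionals
    as words of X^*. *)
Lemma insm_lconst u v S : size u = size v ->
  \sum_(z <- words V (size v)) (sg (eps z) * fmul c (ew R u) (ew R z) v) *: nact (map ir z) S =
  sg (eps v (+) br v u) *: insm lconst v u S.
Proof.
elim: v u => [|i v IH] [|j u] //.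
  by rewrite /= big_seq1 /= /ew eqxx !mulr1 /sg !scale1r.
move=> [hs]; rewrite big_words scaler_sumr; apply: eq_bigr => k _.
transitivity (c j k i *: fins (ir k) (sg (spar k && wpar v) *:
    (sg (eps v (+) br v u) *: insm lconst v u S))).
  rewrite -IH // scaler_sumr fins_sum scaler_sumr; apply: eq_bigr => z _.
  rewrite -[nact (map ir (k :: z)) S]/(fins (ir k) (nact (map ir z) S)) !finsZ !scalerA
    fmul_ew_cons -[eps (k :: z)]/((spar k && wpar z) (+) eps z) -!sgM; congr (_ *: _).
  have := fmul_ew_par (spar k) u z v; set f := fmul _ _ _ _ => E.
  transitivity (c j k i * (sg (eps z) * (sg (spar k && wpar v) * f))); last by ring.
  rewrite E; transitivity (c j k i * (sg (eps z) * (sg (spar k && wpar u) * sg (spar k && wpar z) * f))).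
    by ring.
  by rewrite sgM; case: (spar k) (wpar u) (wpar z) => [] [] [].
rewrite !finsZ !scalerA; congr (_ *: _); rewrite -?mulrA [RHS]mulrC; apply: (graded_mul cgr) => hi.
rewrite sgM; congr sg => /=; rewrite hi.
by case: (spar i) (spar j) (spar k) (wpar v) (eps v) (br v u) => [] [] [] [] [] [].
Qed.

(** The same for the left action, as in [lact_ev]. *)
Lemma insm_rconst u v S : size u = size v ->
  \sum_(z <- words V (size v)) (sg (eps z) * fmul c (ew R z) (ew R u) v) *: nact (map ir z) S =
  sg (eps v (+) br u v) *: insm rconst v u S.
Proof.
elim: v u => [|i v IH] [|j u] //.
  by rewrite /= big_seq1 /= /ew eqxx !mulr1 /sg !scale1r.
move=> [hs]; rewrite big_words scaler_sumr; apply: eq_bigr => k _.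
transitivity (c k j i *: fins (ir k) (sg (spar i && (wpar v (+) wpar u)) *:
    (sg (eps v (+) br u v) *: insm rconst v u S))).
  rewrite -IH // scaler_sumr fins_sum scaler_sumr; apply: eq_bigr => z _.
  rewrite -[nact (map ir (k :: z)) S]/(fins (ir k) (nact (map ir z) S)) !finsZ !scalerA
    fmul_ew_cons -[eps (k :: z)]/((spar k && wpar z) (+) eps z) -!sgM; congr (_ *: _).
  have := fmul_ew_par (spar i) z u v; set f := fmul _ _ _ _ => E.
  transitivity (c k j i * (sg (spar k && wpar z) * sg (spar j && wpar z) * (sg (eps z) * f))).
    by ring.
  transitivity (c k j i * (sg (eps z) * (sg (spar i && wpar u) * (sg (spar i && wpar v) * f)))); last first.
    have -> : sg (spar i && (wpar v (+) wpar u)) = sg (spar i && wpar u) * sg (spar i && wpar v) :> R.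
      by rewrite sgM; case: (spar i) (wpar u) (wpar v) => [] [] [].
    by ring.
  apply: (graded_mul cgr) => hi.
  rewrite E mulrCA; congr (_ * _); rewrite !mulrA !sgM; congr (sg _ * _).
  by rewrite hi; case: (spar j) (spar k) (wpar u) (wpar z) => [] [] [] [].
rewrite !finsZ !scalerA; congr (_ *: _); rewrite -?mulrA [RHS]mulrC; congr (_ * _).
rewrite sgM; congr sg => /=.
by case: (spar i) (spar j) (wpar u) (wpar v) (eps v) (br u v) => [] [] [] [] [] [].
Qed.

(** The double sum over z and z' which the two actions on functionals produce
    in the Turner double is the letterwise action found in [fmul_double]. *)
Lemma sum_fshuf_nw u u' v v' (P : fn R V) : size u = size v -> size u' = size v' ->
  \sum_(z <- words V (size v)) \sum_(z' <- words V (size v'))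
    ((sg (eps z) * fmul c (ew R u) (ew R z) v) *
     (sg (eps z') * fmul c (ew R z') (ew R u') v')) *:
    fshuf (linj P) (nw R (map ir (z ++ z'))) =
  sg (eps v (+) eps v' (+) br v u (+) br u' v') *:
   insm lconst v u (insm rconst v' u' (linj
     (tw (wpar u (+) wpar v (+) wpar u' (+) wpar v') P))).
Proof.
move=> hu hu'.
(* A twist may be changed by any relation of parities valid where a <> 0. *)
have tE a b b' (s : fn R V) : (forall e, a * sg (e && b) = a * sg (e && b')) ->
    a *: tw b s = a *: tw b' s.
  move=> h; apply: funext => z; rewrite !fnZ /tw !mulrA.
  by rewrite ![_ && wpar z]andbC h.
(* The product of w and z has parity wpar w + wpar z, hence so has v0. *)
have pE (f : R) e (p q r : bool) :
    sg (e && r) * f = sg (e && (p (+) q)) * f -> f * sg (e && q) = f * sg (e && (p (+) r)).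
  move=> E; transitivity (sg (e && p) * (sg (e && (p (+) q)) * f)).
    by rewrite mulrA sgM [LHS]mulrC; congr (sg _ * _); case: e p q {E} => [] [] [].
  by rewrite -E mulrA sgM [RHS]mulrC; congr (sg _ * _); case: e p r {E} => [] [] [].
have fE w z v0 e : fmul c (ew R w) (ew R z) v0 * (sg (e && wpar z) : R) =
    fmul c (ew R w) (ew R z) v0 * (sg (e && (wpar w (+) wpar v0)) : R).
  by apply: pE; exact: fmul_ew_par.
have fE' w z v0 e : fmul c (ew R z) (ew R w) v0 * (sg (e && wpar z) : R) =
    fmul c (ew R z) (ew R w) v0 * (sg (e && (wpar w (+) wpar v0)) : R).
  by apply: pE; rewrite [wpar w (+) _]addbC; exact: fmul_ew_par.
transitivity (\sum_(z <- words V (size v)) (sg (eps z) * fmul c (ew R u) (ew R z) v) *: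
   nact (map ir z) (\sum_(z' <- words V (size v')) (sg (eps z') * fmul c (ew R z') (ew R u') v') *:
   nact (map ir z') (linj (tw (wpar u (+) wpar v (+) wpar u' (+) wpar v') P)))).
  apply: eq_bigr => z _; rewrite nact_sum scaler_sumr; apply: eq_bigr => z' _.
  rewrite fshuf_nact_r fshuf_ew0 (wpar_map ir_par) tw_linj map_cat nact_cat nactZ scalerA.
  rewrite -!nactZ -!finjZ; congr (nact _ (nact _ (linj _))).
  apply: tE => e; rewrite wpar_cat.
  have sgA a b d : sg (a && (b (+) d)) = sg (a && b) * sg (a && d) :> R.
    by rewrite sgM; case: a b d => [] [] [].
  rewrite -[_ (+) _ (+) wpar u' (+) _]addbA !(sgA e (_ (+) _)) sgA.
  transitivity ((sg (eps z) : R) * (sg (eps z') : R) *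
     ((fmul c (ew R u) (ew R z) v * (sg (e && wpar z) : R)) *
      (fmul c (ew R z') (ew R u') v' * (sg (e && wpar z') : R)))); first by ring.
  rewrite fE fE' !sgA. ring.
rewrite insm_rconst // insm_lconst // insmZ scalerA sgM; congr (sg _ *: _).
by case: (eps v) (eps v') (br v u) (br u' v') => [] [] [] [].
Qed.

End Trivial.

(** * From tensors to coefficient functions *)

Section Mlin.
Variables (R : comNzRingType) (S : choiceType) (U : lmodType R).
Implicit Types (h : S -> U) (f g : {malg R[S]}).

Lemma mlin_supp h f (d : {fset S}) : (msupp f `<=` d)%fset ->
  mlin h f = \sum_(s <- d) f@_s *: h s.
Proof.
move=> sfd; apply: big_fset_incl => // s _ /mcoeff_outdom ->.
by rewrite scale0r.
Qed.

Lemma mlin_is_linear h : linear (mlin h).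
Proof.
move=> a f g; set d := (msupp f `|` msupp g)%fset.
have df : (msupp f `<=` d)%fset by exact: fsubsetUl.
have dg : (msupp g `<=` d)%fset by exact: fsubsetUr.
rewrite (mlin_supp _ df) (mlin_supp _ dg) (@mlin_supp _ _ d); last first.
  apply: fsubset_trans (msuppD_le _ _) _; apply: fsetUSS => //.
  exact: msuppZ_le.
rewrite scaler_sumr -big_split; apply: eq_bigr => s _ /=.
by rewrite mcoeffD mcoeffZ scalerDl scalerA.
Qed.
HB.instance Definition _ h :=
  GRing.isLinear.Build R {malg R[S]} U _ (mlin h) (mlin_is_linear h).

Lemma mlinD h f g : mlin h (f + g) = mlin h f + mlin h g.
Proof. exact: linearD. Qed.
Lemma mlinZ h a f : mlin h (a *: f) = a *: mlin h f.
Proof. exact: linearZ_LR. Qed.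
Lemma mlin_sum h (I : Type) (r : seq I) (P : pred I) (F : I -> {malg R[S]}) :
  mlin h (\sum_(i <- r | P i) F i) = \sum_(i <- r | P i) mlin h (F i).
Proof. exact: linear_sum. Qed.

Lemma malgUZ a (s : S) : << a *g s >> = a *: << s >> :> {malg R[S]}.
Proof. by apply/malgP => k; rewrite mcoeffZ !mcoeffU mulrnAr mulr1. Qed.

Lemma mlinU h s : mlin h << s >> = h s.
Proof.
rewrite (@mlin_supp _ _ [fset s]%fset) ?msuppU_le // big_seq_fset1.
by rewrite mcoeffUU scale1r.
Qed.

Lemma malg_mlin f : f = mlin (fun s => << s >>) f.
Proof. by rewrite {1}[f]monalgE; apply: eq_bigr => s _; rewrite malgUZ. Qed.

Lemma eq_mlin h h' f : (forall s, h s = h' s) -> mlin h f = mlin h' f.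
Proof. by move=> e; apply: eq_bigr => s _; rewrite e. Qed.

End Mlin.

Lemma linear_mlin (R : comNzRingType) (S : choiceType) (U : lmodType R)
  (phi : {linear {malg R[S]} -> U}) f : phi f = mlin (fun s => phi << s >>) f.
Proof.
rewrite {1}[f]malg_mlin linear_sum; apply: eq_bigr => s _.
exact: linearZ_LR.
Qed.

Lemma lin0 (R : nzRingType) (U U' : lmodType R) (f : U -> U') :
  (forall a x y, f (a *: x + y) = a *: f x + f y) -> f 0 = 0.
Proof.
by move=> fl; apply: (addIr (f 0)); rewrite add0r -{1}[f 0]scale1r -fl scaler0 add0r.
Qed.

Lemma lin_sum (R : nzRingType) (U U' : lmodType R) (f : U -> U') :
  (forall a x y, f (a *: x + y) = a *: f x + f y) ->
  forall (I : Type) (r : seq I) (k : I -> R) (F : I -> U),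
  f (\sum_(i <- r) k i *: F i) = \sum_(i <- r) k i *: f (F i).
Proof.
by move=> fl I r k F; elim: r => [|i r IH]; rewrite ?big_nil ?(lin0 fl) // !big_cons fl IH.
Qed.

Lemma mlin_lin (R : comNzRingType) (S : choiceType) (U U' : lmodType R)
  (phi : U -> U') (h : S -> U) f : linear phi ->
  phi (mlin h f) = mlin (fun s => phi (h s)) f.
Proof. by move=> lphi; rewrite /mlin (lin_sum lphi). Qed.

Lemma mlin_hD (R : comNzRingType) (S : choiceType) (U : lmodType R)
  a (h h' : S -> U) f :
  mlin (fun s => a *: h s + h' s) f = a *: mlin h f + mlin h' f.
Proof.
rewrite scaler_sumr -big_split; apply: eq_bigr => s _ /=.
by rewrite scalerDr !scalerA mulrC.
Qed.

Section Coef.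
Variables (R : comNzRingType) (W : sspace).
Implicit Types (f g t : talg R W) (w z : seq W) (i j k : W) (b e : bool).

Definition cf t : fn R W := fun z => t@_z.

Lemma cf_is_linear : linear cf.
Proof. by move=> a f g; apply: funext => z; rewrite /cf mcoeffD mcoeffZ. Qed.
HB.instance Definition _ :=
  GRing.isLinear.Build R (talg R W) (fn R W) _ cf cf_is_linear.
Lemma cfD f g : cf (f + g) = cf f + cf g. Proof. exact: linearD. Qed.
Lemma cfZ a f : cf (a *: f) = a *: cf f. Proof. exact: linearZ_LR. Qed.
Lemma cf0 : cf 0 = 0. Proof. exact: linear0. Qed.
Lemma cf_sum (I : Type) (r : seq I) (P : pred I) (F : I -> talg R W) :
  cf (\sum_(i <- r | P i) F i) = \sum_(i <- r | P i) cf (F i).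
Proof. exact: linear_sum. Qed.

Lemma cf_inj : injective cf.
Proof. by move=> f g e; apply/malgP => z; exact: (congr1 (fun s : fn R W => s z) e). Qed.

Lemma cfU w : cf << w >> = ew R w.
Proof. by apply: funext => z; rewrite /cf mcoeffU /ew eq_sym; case: eqP. Qed.

Lemma cf_mlin f : cf f = mlin (ew R) f.
Proof. by rewrite linear_mlin; apply: eq_mlin => w; exact: cfU. Qed.

(** Bilinear operations on tensors are computed on coefficients once they are
    on pairs of words. *)
Lemma cf_mlin2 (op : seq W -> seq W -> talg R W) (B : fn R W -> fn R W -> fn R W) f g :
  (forall s : fn R W, linear (B s)) -> (forall t : fn R W, linear (B^~ t)) ->
  (forall w w', cf (op w w') = B (ew R w) (ew R w')) ->
  cf (mlin2 op f g) = B (cf f) (cf g).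
Proof.
move=> lr ll e; rewrite /mlin2 (mlin_lin _ _ cf_is_linear).
rewrite (cf_mlin f) (mlin_lin _ _ (ll _)); apply: eq_mlin => w.
rewrite (mlin_lin _ _ cf_is_linear) (cf_mlin g) (mlin_lin _ _ (lr _)).
by apply: eq_mlin => w'.
Qed.

Lemma cf_tvec (v : vect R W) k z : cf (tvec v) (k :: z) = v k * ew R [::] z.
Proof.
rewrite /tvec cf_sum fn_sum (bigD1 k) //= big1 ?addr0.
  rewrite /cf mcoeffU eqseq_cons eqxx /= /ew [_ == z]eq_sym.
  by case: eqP; rewrite ?mulr1 ?mulr0.
by move=> i /negPf ik; rewrite /cf mcoeffU eqseq_cons ik.
Qed.
Lemma cf_tvec_nil (v : vect R W) : cf (tvec v) [::] = 0.
Proof. by rewrite /tvec cf_sum fn_sum big1 // => i _; rewrite /cf mcoeffU. Qed.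

Definition bvec (i : W) : vect R W := [ffun j => (j == i)%:R].

Lemma homog_bvec i : homog (bvec i) (spar i).
Proof. by move=> j; rewrite ffunE; have [->|] := eqVneq j i; rewrite ?eqxx. Qed.

Lemma cf_tvec_bvec i : cf (tvec (bvec i)) = ew R [:: i].
Proof.
apply: funext => -[|k z]; first by rewrite cf_tvec_nil.
by rewrite cf_tvec ffunE /ew eqseq_cons; case: (k == i); rewrite /= ?mul1r ?mul0r.
Qed.

Lemma tconcatUU w w' : tconcat << w >> << w' >> = << w ++ w' >> :> talg R W.
Proof. by rewrite /tconcat /mlin2 mlinU mlinU. Qed.

Lemma tconcat_is_linear f : linear (tconcat f).
Proof.
move=> a g t; rewrite /tconcat /mlin2.
by rewrite -mlin_hD; apply: eq_mlin => w; rewrite linearP.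
Qed.
HB.instance Definition _ f :=
  GRing.isLinear.Build R (talg R W) (talg R W) _ (tconcat f) (tconcat_is_linear f).
Lemma tconcat_on_is_linear g : linear (fun f => tconcat f g).
Proof. by move=> a f t; rewrite /tconcat /mlin2 linearP. Qed.
Definition tconcat_on g f := tconcat f g.
HB.instance Definition _ g :=
  GRing.isLinear.Build R (talg R W) (talg R W) _ (tconcat_on g) (tconcat_on_is_linear g).

Lemma tconcat_suml g (I : Type) (r : seq I) (P : pred I) (F : I -> talg R W) :
  tconcat (\sum_(i <- r | P i) F i) g = \sum_(i <- r | P i) tconcat (F i) g.
Proof. exact: (linear_sum (tconcat_on g)). Qed.
Lemma tconcatZl a f g : tconcat (a *: f) g = a *: tconcat f g.
Proof. exact: (linearZ_LR (tconcat_on g)). Qed.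
Lemma tconcatZr a f g : tconcat f (a *: g) = a *: tconcat f g.
Proof. exact: linearZ_LR. Qed.

(** The basic step for [tpow] and for the product [wmul], both built by
    concatenating vectors on the left. *)
Lemma cf_tvec_concat (v : vect R W) f :
  cf (tconcat (tvec v) f) = fun z => if z is k :: z' then v k * cf f z' else 0.
Proof.
have -> : tconcat (tvec v) f = \sum_i v i *: mlin (fun w => << i :: w >>) f.
  rewrite /tvec tconcat_suml; apply: eq_bigr => i _.
  by rewrite malgUZ tconcatZl /tconcat /mlin2 mlinU.
apply: funext => z; rewrite cf_sum fn_sum /=.
have E i : (mlin (fun w => << i :: w >>) f : talg R W)@_z =
   if z is k :: z' then (k == i)%:R * cf f z' else 0.
  rewrite -[LHS]/(cf _ z) (mlin_lin _ _ cf_is_linear) /mlin fn_sum.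
  case: z => [|k z].
    by rewrite big1 // => w _; rewrite cfU fnZ /ew mulr0.
  rewrite cf_mlin /mlin fn_sum mulr_sumr; apply: eq_bigr => w _.
  rewrite cfU !fnZ /ew eqseq_cons.
  by case: eqP; rewrite /= ?mul1r ?mul0r ?mulr0.
case: z E => [|k z] E.
  by rewrite big1 // => i _; rewrite /cf mcoeffZ E mulr0.
rewrite (bigD1 k) //= {1}/cf mcoeffZ E eqxx mul1r big1 ?addr0 // => i /negPf ik.
by rewrite {1}/cf mcoeffZ E eq_sym ik mul0r mulr0.
Qed.

Lemma cf_tpar e t z : cf (tpar e t) z = (wpar z == e)%:R * cf t z.
Proof.
rewrite /tpar (mlin_lin _ _ cf_is_linear) cf_mlin /mlin !fn_sum mulr_sumr.
apply: eq_bigr => w _; rewrite !fnZ /=.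
have [->|zw] := eqVneq z w; last first.
  by case: eqP => _; rewrite ?cfU ?cf0 /ew ?(negPf zw) ?fn0 /= !mulr0.
by case: eqP => _; rewrite ?cfU ?cf0 ?fn0 ?mul1r ?mulr0 ?mul0r.
Qed.

Lemma bracket_br w w' : size w = size w' ->
  odd (bracket [seq spar i | i <- w] [seq spar i | i <- w']) = br w w'.
Proof.
elim: w w' => [|i w IH] [|j w'] //; first by rewrite /bracket big_ord0.
move=> [hs] /=; rewrite -IH // /bracket /= big_ord_recl big_ord0 add0n.
have -> : (\sum_(i0 < size [seq spar i | i <- w]) \sum_(a < bump 0 i0)
     (nth false (spar i :: [seq spar i | i <- w]) (bump 0 i0) && nth false (spar j :: [seq spar i | i <- w']) a)
  = \sum_(i0 < size [seq spar i | i <- w]) (spar j && nth false [seq spar i | i <- w] i0) +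
   \sum_(i0 < size [seq spar i | i <- w]) \sum_(a < i0)
     (nth false [seq spar i | i <- w] i0 && nth false [seq spar i | i <- w'] a))%N.
  rewrite -big_split; apply: eq_bigr => a _ /=.
  by rewrite big_ord_recl /= andbC.
rewrite oddD; congr (_ (+) _).
rewrite -(big_mkord xpredT (fun n : nat => (spar j && nth false [seq spar i | i <- w] n) : nat)).
rewrite -(big_nth false xpredT (fun x : bool => (spar j && x) : nat)).
elim: {IH hs i} w => [|i w IH]; first by rewrite big_nil wpar_nil andbF.
rewrite big_cons oddD IH wpar_cons.
by case: (spar j) (spar i) (wpar w) => [] [] [].
Qed.

Section Tmul.
Variable c : sconst R W.

Lemma fmul_ew_size w w' : size w != size w' -> fmul c (ew R w) (ew R w') = 0.
Proof.
move=> h; apply: funext => z; elim: z w w' h => [|k z IH] [|i w] [|j w'] //= h.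
- by rewrite /ew mul1r.
- by rewrite /ew mul0r.
- by rewrite /ew mul0r.
- rewrite big1 // => p _; rewrite big1 // => q _.
  by rewrite der_ew_nil tw0 fmull0 mulr0.
- rewrite big1 // => p _; rewrite big1 // => q _.
  by rewrite der_ew_nil fmulr0 mulr0.
- by rewrite -[LHS]/(fmul c (ew R (i :: w)) (ew R (j :: w')) (k :: z)) fmul_ew_cons IH ?mulr0.
Qed.

Lemma cf_wmul w w' : cf (wmul c w w') = fmul c (ew R w) (ew R w').
Proof.
rewrite /wmul; case: eqP => [hs|/eqP hs]; last by rewrite cf0 fmul_ew_size.
rewrite cfZ -signr_odd bracket_br //.
elim: w w' hs => [|i w IH] [|j w'] // => [_|[hs]].
  rewrite /= cfU scale1r; apply: funext => -[|k z].
    by rewrite /ew /= mul1r.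
  by rewrite /= big1 // => p _; rewrite big1 // => q _; rewrite der_ew_nil fmulr0 mulr0.
rewrite [zip _ _]/= [map _ _]/= [foldr _ _ _]/= cf_tvec_concat.
apply: funext => -[|k z]; rewrite fnZ.
  by rewrite mulr0 /= /ew mulr0.
rewrite fmul_ew_cons -IH // fnZ /= mulrCA; congr (_ * _).
by rewrite mulrA -/(sg _) -/(sg _) sgM addbC; congr (_ * _).
Qed.

Lemma cf_tmul f g : cf (tmul c f g) = fmul c (cf f) (cf g).
Proof.
apply: cf_mlin2 => [s|t|w w']; [exact: fmul_is_linear | exact: fmul_on_is_linear | exact: cf_wmul].
Qed.

End Tmul.

Lemma coef_coprod t w w' : (coprod t)@_(w, w') = t@_(w ++ w').
Proof.
rewrite /coprod /mlin raddf_sum /= -[RHS]/(cf t _) cf_mlin /mlin fn_sum.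
apply: eq_bigr => u _; rewrite mcoeffZ fnZ; congr (_ * _).
rewrite raddf_sum /= /ew; case: eqP => [<-|h].
  have lt : (size w < (size (w ++ w')).+1)%N by rewrite ltnS size_cat leq_addr.
  rewrite (bigD1 (Ordinal lt)) //= take_size_cat // drop_size_cat // mcoeffUU.
  rewrite big1 ?addr0 // => i hi; rewrite mcoeffU; case: eqP => // -[h _].
  case/eqP: hi; apply: val_inj => /=; have := congr1 size h.
  by rewrite size_takel // -ltnS ltn_ord.
rewrite big1 // => i _; rewrite mcoeffU; case: eqP => // -[h1 h2].
by case: h; rewrite -h1 -h2 cat_take_drop.
Qed.

Lemma coef_tens2 f g w w' : (tens2 f g)@_(w, w') = f@_w * g@_w'.
Proof.
rewrite /tens2 /mlin2 {1}/mlin raddf_sum /= -[f@_w]/(cf f w) cf_mlin /mlin fn_sum mulr_suml.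
apply: eq_bigr => u _; rewrite mcoeffZ fnZ -mulrA; congr (_ * _).
rewrite raddf_sum /= -[g@_w']/(cf g w') cf_mlin /mlin fn_sum mulr_sumr.
apply: eq_bigr => u' _; rewrite mcoeffZ fnZ mulrCA; congr (_ * _).
rewrite mcoeffU /ew xpair_eqE [u == w]eq_sym [u' == w']eq_sym.
by case: eqP; case: eqP; rewrite /= ?mulr1 ?mulr0.
Qed.

End Coef.

Section Sides.
Variables (R : comNzRingType) (V : sspace).
Local Notation T := (ssum V (sdual V)).

Lemma cf_in_left (t : talg R V) : cf (in_left t : talg R T) = finj (@lft V) (cf t).
Proof.
rewrite /in_left (mlin_lin _ _ (@cf_is_linear R T)) cf_mlin /mlin finj_sum; apply: eq_bigr => w _.
by rewrite finjZ cfU (finj_ew R (@ilK V) (@lftK V)).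
Qed.

Lemma cf_in_right (t : talg R V) : cf (in_right t : talg R T) = finj (@rgt V) (cf t).
Proof.
rewrite /in_right (mlin_lin _ _ (@cf_is_linear R T)) cf_mlin /mlin finj_sum; apply: eq_bigr => w _.
by rewrite finjZ cfU (finj_ew R (@irK V) (@rgtK V)).
Qed.

End Sides.

(** * Invariance under the symmetric groups *)

(** Sorting by adjacent exchanges.  P is a property stable under permutations
    which the exchanges may use, such as the distinctness of keys. *)
Lemma perm_eq_swap (A : eqType) (B : Type) (G : seq A -> B) (P : seq A -> Prop) :
  (forall l l', perm_eq l l' -> P l -> P l') ->
  (forall l1 x y l2, P (l1 ++ x :: y :: l2) ->
     G (l1 ++ x :: y :: l2) = G (l1 ++ y :: x :: l2)) ->
  forall l l', perm_eq l l' -> P l -> G l = G l'.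
Proof.
move=> Pp Gs l; elim: l G P Pp Gs => [|x l IH] G P Pp Gs l' pl Pl.
  by move: pl; rewrite perm_sym => /perm_nilP ->.
have xl' : x \in l' by rewrite -(perm_mem pl) mem_head.
case/splitPr: xl' pl => a b pl.
have pl1 : perm_eq l (a ++ b).
  by rewrite -(perm_cons x) (perm_trans pl) // (perm_catCA a [:: x] b).
have Pab : P (x :: a ++ b) by apply: Pp Pl; rewrite perm_cons.
rewrite (IH (fun l => G (x :: l)) (fun l => P (x :: l)) _ _ _ pl1) //.
- suff H c : P (c ++ x :: a ++ b) -> G (c ++ x :: a ++ b) = G (c ++ a ++ x :: b).
    exact: (H [::]).
  elim: a c {pl pl1 Pab} => [//|y a IHa] c Pc.
  rewrite /= Gs // -![c ++ y :: _]cat_rcons; apply: IHa; rewrite cat_rcons.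
  by apply: Pp Pc; rewrite perm_cat2l; apply/permPl; exact: (perm_catCA [:: x] [:: y]).
- by move=> l1 l2 p12; apply: Pp; rewrite perm_cons.
- by move=> l1 y z l2; exact: (Gs (x :: l1)).
Qed.

Section Keys.
Variables (R : comNzRingType) (W : sspace).
Implicit Types (l : seq (nat * W)) (x y : nat * W).

(** Each letter carries a key, its position before a permutation was applied;
    the sign of the action counts the inversions of keys between odd letters. *)
Fixpoint kinv l : bool :=
  if l is x :: l' then
    (\big[addb/false]_(y <- l' | (y.1 < x.1)%N) (spar x.2 && spar y.2)) (+) kinv l'
  else false.

Lemma kinv_swap l1 x y l2 : x.1 != y.1 ->
  kinv (l1 ++ x :: y :: l2) =
  (spar x.2 && spar y.2) (+) kinv (l1 ++ y :: x :: l2).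
Proof.
move=> xy; elim: l1 => [|z l1 IH] /=.
  rewrite !big_cons.
  have [lt|gt|e] := ltngtP x.1 y.1.
  - rewrite [spar y.2 && _]andbC.
    by set a := \big[addb/false]_(_ <- _ | _) _; set b := \big[addb/false]_(_ <- _ | _) _;
      case: (_ && _) a b (kinv l2) => [] [] [] [].
  - by set a := \big[addb/false]_(_ <- _ | _) _; set b := \big[addb/false]_(_ <- _ | _) _;
      case: (_ && _) a b (kinv l2) => [] [] [] [].
  - by rewrite e eqxx in xy.
rewrite IH addbCA; congr (_ (+) (_ (+) _)); apply: perm_big.
by rewrite perm_cat2l; apply/permPl; exact: (perm_catCA [:: x] [:: y]).
Qed.

(** An adjacent exchange changes both factors by the same sign, by [kinv_swap]
    and by invariance. *)
Lemma sinv_perm (s : fn R W) l l' : sinv s -> uniq (map fst l) -> perm_eq l l' ->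
  sg (kinv l) * s (map snd l) = sg (kinv l') * s (map snd l').
Proof.
move=> hs ul pl.
apply: (perm_eq_swap (G := fun l => sg (kinv l) * s (map snd l))
   (P := fun l => uniq (map fst l)) _ _ pl) => //.
  by move=> l1 l2 p12; rewrite (perm_uniq (perm_map fst p12)).
move=> l1 x y l2; rewrite map_cat cat_uniq /= => /and5P[_ _ nx _ _].
have xy : x.1 != y.1 by move: nx; rewrite inE negb_or => /andP[].
rewrite kinv_swap // !map_cat /= hs mulrA sgM; congr (sg _ * _).
by case: (_ && _) (kinv _) => [] [].
Qed.

Lemma kinv_sorted l : pairwise (fun x y => (x.1 <= y.1)%N) l -> kinv l = false.
Proof.
elim: l => [//|x l IH] /= /andP[/allP h /IH ->]; rewrite addbF.
rewrite big_seq_cond big1 // => y /andP[/h]; lia.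
Qed.

Lemma kinv_enum d (K : 'I_d -> nat * W) (s : seq 'I_d) :
  pairwise (fun a b : 'I_d => (a < b)%N) s ->
  kinv (map K s) = \big[addb/false]_(a <- s)
    \big[addb/false]_(b <- s | (a < b)%N && ((K b).1 < (K a).1)%N) (spar (K a).2 && spar (K b).2).
Proof.
elim: s => [|a s IH]; first by rewrite big_nil.
move=> /= /andP[/allP h /IH ->]; rewrite !big_cons ltnn /= big_map; congr (_ (+) _).
  rewrite big_seq_cond [RHS]big_seq_cond; apply: eq_bigl => b.
  by case: (boolP (b \in s)) => // /h /= ->.
rewrite big_seq [RHS]big_seq; apply: eq_bigr => b /h ab.
by rewrite big_cons ltnNge (ltnW ab).
Qed.

Lemma pairwise_enum d : pairwise (fun a b : 'I_d => (a < b)%N) (enum 'I_d).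
Proof.
have := iota_ltn_sorted 0 d; rewrite -val_enum_ord sorted_map => h.
rewrite sorted_pairwise // in h *.
by move=> a b c; exact: ltn_trans.
Qed.

Definition keyed d (g : 'S_d) (w : d.-tuple W) : seq (nat * W) :=
  [seq (val (g a), tnth w (g a)) | a <- enum 'I_d].

Lemma keyed_snd d (g : 'S_d) (w : d.-tuple W) :
  map snd (keyed g w) = [seq tnth w (g a) | a <- enum 'I_d].
Proof. by rewrite /keyed; elim: (enum _) => //= a s ->. Qed.

Lemma wactE d (g : 'S_d) (w : d.-tuple W) :
  wact R g w = << sg (kinv (keyed g w)) *g map snd (keyed g w) >>.
Proof.
rewrite /wact; congr << _ *g _ >>.
  by rewrite keyed_snd.
rewrite -signr_odd; congr (sg _).
rewrite (kinv_enum _ (pairwise_enum d)) /=.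
rewrite (big_morph odd oddD (erefl : odd 0 = false)).
rewrite (reindex_inj (@perm_inj _ g)) big_enum /=.
transitivity (\big[addb/false]_(a : 'I_d) \big[addb/false]_(b : 'I_d | (b < a)%N && (g a < g b)%N)
   (spar (tnth w (g a)) && spar (tnth w (g b)))).
  apply: eq_bigr => a _; rewrite (big_morph odd oddD (erefl : odd 0 = false)).
  rewrite (reindex_inj (@perm_inj _ g)); apply: eq_big => b; last by rewrite oddb.
  by rewrite !permK andbC.
rewrite (exchange_big_dep xpredT) //=; apply: eq_bigr => a _.
by rewrite big_enum_cond /=; apply: eq_bigr => b _; rewrite andbC.
Qed.

Lemma tactE d (g : 'S_d) (t : talg R W) (w : d.-tuple W) :
  (tact g t)@_(map snd (keyed g w)) = sg (kinv (keyed g w)) * t@_(tval w).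
Proof.
rewrite /tact raddf_sum /= (bigD1 w) //= mcoeffZ wactE mcoeffUU mulrC big1 ?addr0 //.
move=> u uw; rewrite mcoeffZ wactE mcoeffU; case: eqP => [e|_]; last by rewrite mulr0.
case/eqP: uw; apply: eq_from_tnth => a.
have := congr1 (fun s => nth (tnth w a) s (g^-1%g a)) e.
rewrite !keyed_snd (nth_map (g^-1%g a)) ?size_enum_ord // nth_ord_enum.
by rewrite (nth_map (g^-1%g a)) ?size_enum_ord // nth_ord_enum permKV.
Qed.

Lemma tcompE d (t : talg R W) (w : d.-tuple W) : (tcomp d t)@_(tval w) = t@_(tval w).
Proof.
rewrite /tcomp raddf_sum /= (bigD1 w) //= mcoeffUU big1 ?addr0 //.
by move=> u /negPf uw; rewrite mcoeffU -val_eqE in uw *; rewrite uw.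
Qed.

Lemma size_keyed d (g : 'S_d) (w : d.-tuple W) : size (map snd (keyed g w)) = d.
Proof. by rewrite keyed_snd size_map size_enum_ord. Qed.

Lemma coef_tact_size d (g : 'S_d) (t : talg R W) z : size z != d -> (tact g t)@_z = 0.
Proof.
move=> h; rewrite /tact raddf_sum big1 // => w _; rewrite /= mcoeffZ wactE mcoeffU.
by case: eqP => [e|_]; rewrite ?mulr0 //; rewrite -e size_keyed eqxx in h.
Qed.
Lemma coef_tcomp_size d (t : talg R W) z : size z != d -> (tcomp d t)@_z = 0.
Proof.
move=> h; rewrite /tcomp raddf_sum big1 // => w _; rewrite /= mcoeffU.
by case: eqP => [e|_] //; rewrite -e size_tuple eqxx in h.
Qed.

(** In one direction, any permutation is a product of adjacent transpositions
    ([sinv_perm]); in the other, an adjacent transposition is applied, whose only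
    inversion is the pair (i, j). *)
Lemma is_invP (t : talg R W) : t \in @is_inv R W <-> sinv (cf t).
Proof.
split=> [/asboolP h w i j z|hs]; last first.
  apply/asboolP => d g; apply/malgP => z.
  have [e|ne] := eqVneq (size z) d; last by rewrite coef_tact_size // coef_tcomp_size.
  pose u : d.-tuple W := tcast e (in_tuple z).
  pose w := [tuple tnth u (g^-1%g a) | a < d].
  have uE : map snd (keyed g w) = z.
    transitivity (tval u); last by rewrite /u val_tcast.
    rewrite keyed_snd -[RHS]map_tnth_enum; apply: eq_map => a /=.
    by rewrite tnth_mktuple permK.
  have zE : z = tval u by rewrite /u val_tcast.
  rewrite {2}zE tcompE -uE tactE -zE -uE.
  pose l := [seq (val a, tnth w a) | a <- enum 'I_d].
  have ul : uniq (map fst l) by rewrite -map_comp map_inj_uniq ?enum_uniq //; exact: val_inj.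
  have pl : perm_eq l (keyed g w).
    rewrite /l /keyed (map_comp (fun a : 'I_d => (val a, tnth w a)) g); apply: perm_map.
    apply: uniq_perm; first exact: enum_uniq.
      by rewrite (map_inj_uniq (@perm_inj _ g)) enum_uniq.
    move=> a; rewrite mem_enum; apply/esym/mapP; exists (g^-1%g a); rewrite ?permKV //.
    by rewrite mem_enum.
  have := sinv_perm hs ul pl.
  rewrite (kinv_sorted (l := l)); last first.
    rewrite /l pairwise_map; apply: sub_pairwise (pairwise_enum d) => a b.
    exact: ltnW.
  have -> : map snd l = tval w by rewrite /l -map_comp -[RHS]map_tnth_enum.
  by rewrite /sg mul1r -/(sg _) /cf => ->; rewrite mulrA sgK mul1r.
set n := size w; set d := (n + (size z).+2)%N.
have sE : size (w ++ i :: j :: z) == d by rewrite size_cat.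
have ltn0 : (n < d)%N by rewrite /d; lia.
have ltn1 : (n.+1 < d)%N by rewrite /d; lia.
pose W0 := Tuple sE; pose k0 := Ordinal ltn0; pose k1 := Ordinal ltn1.
pose g := tperm k0 k1.
have := congr1 (fun u => u@_(map snd (keyed g W0))) (h d g).
have E : map snd (keyed g W0) = w ++ j :: i :: z.
  rewrite keyed_snd; apply: (@eq_from_nth _ i).
    by rewrite size_map size_enum_ord size_cat.
  move=> k; rewrite size_map size_enum_ord => kd.
  rewrite (nth_map (Ordinal kd)) ?size_enum_ord //= (tnth_nth i) /=.
  rewrite (nth_ord_enum _ (Ordinal kd)) !nth_cat -/n.
  case: tpermP => [/(congr1 val) /= ->|/(congr1 val) /= ->|] /=.
  - by rewrite ltnNge leqnSn subSnn /= ltnn subnn.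
  - by rewrite ltnn subnn ltnNge leqnSn subSnn.
  - move=> /eqP; rewrite -val_eqE /= => n0 /eqP; rewrite -val_eqE /= => n1.
    case: ltnP => // nk; have -> : (k - n = (k - n.+2).+2)%N by lia.
    by [].
have sz : size (w ++ j :: i :: z) == d by rewrite size_cat.
rewrite tactE E -[w ++ j :: i :: z]/(tval (Tuple sz)) tcompE /= /cf => <-.
rewrite mulrA -[LHS]mul1r; congr (_ * _).
rewrite [X in sg X](_ : _ = kinv (keyed g W0)) ?sgK //.
rewrite /keyed (kinv_enum _ (pairwise_enum d)) /= big_enum /=.
rewrite (bigD1 k0) //= big_enum_cond /= (bigD1 k1) /=; last first.
  by rewrite tpermL tpermR /= ltnSn.
rewrite tpermL tpermR !(tnth_nth i) /= !nth_cat -/n ltnn subnn ltnNge leqnSn subSnn /=.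
rewrite [spar j && _]andbC big1; last first.
  move=> b /andP[/andP[b0 ]]; case: tpermP => [->|->|nb0 nb1]; rewrite ?eqxx ?ltnn //=.
  by move: b0 nb1; rewrite -(inj_eq val_inj) /=; lia.
rewrite addbF big1 ?addbF // => a a0; rewrite big_enum_cond big1 // => b /andP[].
rewrite /g; case: (tpermP k0 k1 a) a0 => [->|->|_ _] a0; first by rewrite eqxx in a0.
  by case: (tpermP k0 k1 b) => [->|->|_ _] /=; rewrite /k0 /k1 /=; lia.
by case: (tpermP k0 k1 b) => [->|->|_ _] /=; rewrite /k0 /k1 /=; lia.
Qed.

End Keys.

(** * The shuffle product of tensors *)

Section Shuffles.
Variable A : eqType.
Implicit Types (a b l : seq A).

(** This recursion is the one of [fshuf]. *)
Fixpoint shuffles a : seq A -> seq (seq A) :=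
  if a is x :: a' then
    fix sh b := if b is y :: b' then
      [seq x :: l | l <- shuffles a' b] ++ [seq y :: l | l <- sh b']
      else [:: a]
  else fun b => [:: b].

Lemma shuffles_cons x a y b : shuffles (x :: a) (y :: b) =
  [seq x :: l | l <- shuffles a (y :: b)] ++ [seq y :: l | l <- shuffles (x :: a) b].
Proof. by []. Qed.

Lemma shuffles_nil a : shuffles a [::] = [:: a].
Proof. by case: a. Qed.

Lemma mem_cons_map x y (s : seq (seq A)) l :
  (x :: l \in [seq y :: l' | l' <- s]) = (x == y) && (l \in s).
Proof.
apply/mapP/andP => [[l' l's [-> ->]]|[/eqP -> ls]]; first by rewrite eqxx.
by exists l.
Qed.

Lemma mem_shuffles (P : pred A) l a b : all P a -> all (predC P) b ->
  (l \in shuffles a b) = (filter P l == a) && (filter (predC P) l == b).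
Proof.
elim: l a b => [|z l IH] [|x a] [|y b] Pa Pb //=.
- rewrite mem_cat; apply/negbTE; rewrite negb_or.
  by apply/andP; split; apply/mapP => -[].
- by rewrite inE; case: (P z); rewrite //= ?andbF.
- rewrite inE; case Pz: (P z) => /=.
    by apply/negbTE/eqP => -[e _]; move: Pb; rewrite -e /= Pz.
  rewrite !eqseq_cons [RHS]andbCA; congr (_ && _).
  by rewrite -(IH [::]) // ?inE //; move: Pb => /= /andP[].
- rewrite inE; case Pz: (P z) => /=; last first.
    rewrite andbF; apply/negbTE/eqP => -[e _].
    by move: Pa; rewrite -e /= Pz.
  rewrite !eqseq_cons -andbA; congr (_ && _).
  by rewrite -(IH _ [::]) ?shuffles_nil ?inE //; move: Pa => /= /andP[].
- move: (Pa) (Pb) => /= /andP[Px Pa'] /andP[Py Pb'].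
  rewrite -[_ :: l \in _]/(z :: l \in shuffles (x :: a) (y :: b)).
  rewrite shuffles_cons mem_cat !mem_cons_map IH // IH //=.
  case Pz: (P z) => /=.
    have -> : z == y = false by apply/eqP => e; rewrite -e Pz in Py.
    by rewrite orbF eqseq_cons andbA.
  have -> : z == x = false by apply/eqP => e; rewrite -e Pz in Px.
  by rewrite /= eqseq_cons [in RHS]andbCA andbA.
Qed.

Lemma uniq_shuffles (P : pred A) a b : all P a -> all (predC P) b ->
  uniq (shuffles a b).
Proof.
elim: a b => [|x a IH] // b Pa; elim: b => [//|y b IHb] Pb.
rewrite shuffles_cons cat_uniq; move: (Pa) (Pb) => /= /andP[Px Pa'] /andP[Py Pb'].
have ci (z : A) : injective (cons z) by move=> l l' [].
rewrite !(map_inj_uniq (ci _)) IH //= IHb // andbT.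
apply/hasPn => l /mapP[l' _ ->]; rewrite /= mem_cons_map.
by apply/negP => /andP[/eqP e _]; rewrite e Px in Py.
Qed.

End Shuffles.

Section Shortest.
Variables (d d' : nat).
Local Notation n := (d + d')%N.
Implicit Types (g h : 'S_n) (a b : 'I_n).

Definition block (k : nat) := (k < d)%N.

(** The inverse of g is increasing on {0, ..., d-1} and on {d, ..., d+d'-1}. *)
Definition block_mono g := forall a b, (a < b)%N ->
  block (g a) = block (g b) -> (g a < g b)%N.

(** An inversion of g is then between the two blocks, and a Young subgroup,
    which acts inside the blocks, preserves it. *)
Lemma block_mono_shortest g : block_mono g -> shortest_rep g.
Proof.
move=> hg; apply/forallP => h; apply/implyP => /forallP yh.
apply: subset_leq_card; apply/fintype.subsetP => -[a b]; rewrite !inE /= => /andP[ab gba].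
rewrite ab !permM.
have := hg _ _ ab; rewrite /block => H.
have ya := eqP (yh (g a)); have yb := eqP (yh (g b)).
case: (ltnP (g a) d) (ltnP (g b) d) ya yb H => ha [] hb ya yb H; lia.
Qed.

(** Otherwise the transposition of k and k+1, an element of the Young subgroup,
    would remove one inversion and create none. *)
Lemma shortest_step g (k k1 : 'I_n) : shortest_rep g -> k.+1 = k1 :> nat ->
  block k = block k1 -> (g^-1%g k < g^-1%g k1)%N.
Proof.
move=> /forallP sg kk1 bk; rewrite ltnNge; apply/negP => le.
have lt : (g^-1%g k1 < g^-1%g k)%N.
  rewrite ltn_neqAle le andbT; apply/eqP => /val_inj/perm_inj e.
  by move: kk1; rewrite e; lia.
pose h := tperm k k1.
have yh : @young d d' h.
  apply/forallP => i; rewrite /h; case: tpermP => [->|->|//].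
    by move: bk; rewrite /block => ->.
  by move: bk; rewrite /block => ->.
have := implyP (sg h) yh; rewrite leqNgt => /negP; apply.
apply: proper_card; apply/properP; split.
  apply/fintype.subsetP => -[a b]; rewrite !inE /= !permM => /andP[ab].
  rewrite ab /= /h.
  have ea : g^-1%g (g a) = a by rewrite permK.
  have eb : g^-1%g (g b) = b by rewrite permK.
  have N (i j : 'I_n) : i <> j -> i != j :> nat by move=> ne; apply/eqP => /val_inj.
  case: (tpermP k k1 (g b)) => [eb'|eb'|/N nb0 /N nb1];
  case: (tpermP k k1 (g a)) => [ea'|ea'|/N na0 /N na1];
  rewrite ?eb' ?ea' ?ltnn //; try lia.
  by move: lt; rewrite -eb' eb -ea' ea; lia.
exists (g^-1%g k1, g^-1%g k); first by rewrite inE /= lt !permKV; lia.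
by rewrite inE /= lt !permM !permKV /h tpermL tpermR; lia.
Qed.

Lemma shortest_block_mono g : shortest_rep g -> block_mono g.
Proof.
move=> sg.
have H m (x y : 'I_n) : (y = x + m.+1 :> nat)%N -> block x = block y ->
    (g^-1%g x < g^-1%g y)%N.
  elim: m x y => [|m IH] x y e bxy; first by apply: shortest_step => //; lia.
  have lty := ltn_ord y.
  have ltz : (x + m.+1 < n)%N by lia.
  have bz : block x = block (Ordinal ltz) by move: bxy; rewrite /block /=; lia.
  apply: (ltn_trans (IH x (Ordinal ltz) _ bz)) => //.
  by apply: shortest_step => //=; rewrite -?bz //; lia.
move=> a b ab bab; rewrite ltnNge; apply/negP => le.
have ne : g b != g a :> nat.
  by apply/eqP => /val_inj/perm_inj e; rewrite e ltnn in ab.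
have e : (g a = g b + (g a - g b).-1.+1 :> nat)%N by lia.
by have := H _ _ _ e (esym bab); rewrite !permK; lia.
Qed.

Definition ord_lt (a b : 'I_n) := (a < b)%N.

Lemma pairwise_filter_map (P : pred 'I_n) (f : 'I_n -> 'I_n) (s : seq 'I_n) :
  pairwise ord_lt s ->
  pairwise ord_lt (filter P (map f s)) <->
  (forall a b, a \in s -> b \in s -> (a < b)%N -> P (f a) -> P (f b) -> (f a < f b)%N).
Proof.
elim: s => [|x s IH] //= /andP[/allP xs ps].
split=> [h a b|h].
  have h' : pairwise ord_lt (filter P (map f s)).
    by move: h; case: (P (f x)) => //= /andP[].
  rewrite !inE => /orP[/eqP ->|as_] /orP[/eqP ->|bs] ab Pa Pb.
  - by rewrite ltnn in ab.
  - move: h; rewrite Pa /= => /andP[/allP h _]; apply: h.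
    by rewrite mem_filter Pb map_f.
  - by have := xs _ as_; rewrite /ord_lt /= ltnNge (ltnW ab).
  - by move/(IH ps): h'; apply.
have h' : pairwise ord_lt (filter P (map f s)).
  by apply/(IH ps) => a b as_ bs; apply: h; rewrite inE ?as_ ?bs orbT.
case Px: (P (f x)) => //=; rewrite h' andbT; apply/allP => y.
rewrite mem_filter => /andP[Py /mapP[b bs yE]]; rewrite yE in Py *.
by apply: h => //; rewrite ?mem_head ?inE ?bs ?orbT //; exact: xs.
Qed.

Definition vals g : seq 'I_n := map g (enum 'I_n).

Lemma ord_ltP (s1 s2 : seq 'I_n) : pairwise ord_lt s1 -> pairwise ord_lt s2 ->
  s1 =i s2 -> s1 = s2.
Proof.
have tr : transitive ord_lt by move=> a b c; exact: ltn_trans.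
rewrite -!(sorted_pairwise tr) => h1 h2.
by apply: (irr_sorted_eq tr _ h1 h2) => a; exact: ltnn.
Qed.

Definition lo := filter (fun a : 'I_n => block a) (enum 'I_n).
Definition hi := filter (predC (fun a : 'I_n => block a)) (enum 'I_n).

Lemma mem_vals g a : a \in vals g.
Proof. by apply/mapP; exists (g^-1%g a); rewrite ?permKV // mem_enum. Qed.

(** One-line notations of block monotone permutations are those lists in which
    both blocks appear in increasing order. *)
Lemma block_monoP g :
  block_mono g <-> vals g \in shuffles lo hi.
Proof.
rewrite (@mem_shuffles _ (fun a : 'I_n => block a)) ?filter_all //.
have M P g' : filter P (vals g') =i filter P (enum 'I_n).
  by move=> a; rewrite [LHS]mem_filter [RHS]mem_filter mem_vals mem_enum.
have Pl P : pairwise ord_lt (filter P (enum 'I_n)).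
  exact/pairwise_filter/pairwise_enum.
split=> [h|/andP[/eqP e1 /eqP e2] a b ab bab].
  have E (P : pred 'I_n) : (forall a b, P (g a) -> P (g b) -> block (g a) = block (g b)) ->
      filter P (vals g) = filter P (enum 'I_n).
    move=> hP; apply: ord_ltP; [| exact: Pl | exact: M].
    apply/(pairwise_filter_map _ _ (pairwise_enum _)) => a b _ _ ab Pa Pb.
    by apply: h => //; exact: hP.
  rewrite !E ?eqxx // => a b /=; first by move=> /negPf -> /negPf ->.
  by move=> -> ->.
have H P : filter P (vals g) = filter P (enum 'I_n) -> P (g a) -> P (g b) -> (g a < g b)%N.
  move=> e Pa Pb; have := Pl P; rewrite -e.
  by move/(pairwise_filter_map _ _ (pairwise_enum _)); apply=> //; rewrite mem_enum.
case Ba: (block (g a)).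
  by apply: (H _ e1) => //; rewrite -bab.
by apply: (H _ e2) => /=; rewrite -?bab Ba.
Qed.

Lemma vals_inj : injective vals.
Proof.
move=> g g' /eq_in_map e; apply/permP => a; apply: e; exact: mem_enum.
Qed.

(** The sum over coset representatives becomes a sum with a recursion on the
    words. *)
Lemma sum_shortest (U : nmodType) (F : seq 'I_n -> U) :
  \sum_(g : 'S_n | shortest_rep g) F (vals g) = \sum_(l <- shuffles lo hi) F l.
Proof.
pose r := [seq vals g | g <- enum [pred g : 'S_n | shortest_rep g]].
transitivity (\sum_(l <- r) F l); first by rewrite big_map big_enum.
apply: perm_big; apply: uniq_perm.
- by rewrite (map_inj_uniq vals_inj) enum_uniq.
- apply: (@uniq_shuffles _ (fun a : 'I_n => block a)); exact: filter_all.
move=> l; apply/mapP/idP => [[g]|hl].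
  by rewrite mem_enum inE => /shortest_block_mono/block_monoP h ->.
have hl' := hl; rewrite (@mem_shuffles _ (fun a : 'I_n => block a)) ?filter_all // in hl'.
case/andP: hl' => /eqP e1 /eqP e2.
have pl : perm_eq l (enum 'I_n).
  by rewrite perm_sym -(perm_filterC (fun a : 'I_n => block a)) -/lo -/hi -e1 -e2 perm_filterC.
have sl : size l == n by rewrite (perm_size pl) size_enum_ord.
pose t := Tuple sl.
have ti : injective (tnth t).
  apply/injectiveP/dinjectiveP => a b _ _ e.
  have ul : uniq t by rewrite (perm_uniq pl) enum_uniq.
  by move: e; rewrite !(tnth_nth a) => /eqP; rewrite nth_uniq ?size_tuple // => /eqP/val_inj.
exists (perm ti); last first.
  rewrite /vals -[LHS]/(tval t) -map_tnth_enum; apply: eq_map => a.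
  by rewrite permE.
rewrite mem_enum inE; apply/block_mono_shortest/block_monoP.
suff -> : vals (perm ti) = l by [].
by rewrite /vals -[RHS]/(tval t) -[RHS]map_tnth_enum; apply: eq_map => a; rewrite permE.
Qed.

End Shortest.

Section ShuffleCoef.
Variables (R : comNzRingType) (W : sspace).
Implicit Types (a b l : seq (nat * W)) (w : seq W).

Lemma shuffles_map (A B : eqType) (f : A -> B) (a b : seq A) :
  shuffles (map f a) (map f b) = map (map f) (shuffles a b).
Proof.
elim: a b => [|x a IH] // b; elim: b => [//|y b IHb].
rewrite [LHS]shuffles_cons -[f y :: _]/(map f (y :: b)) -[f x :: _]/(map f (x :: a)).
rewrite IHb IH shuffles_cons map_cat.
by rewrite -!map_comp.
Qed.

Lemma perm_shuffles (A : eqType) (a b l : seq A) : l \in shuffles a b -> perm_eq l (a ++ b).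
Proof.
elim: a b l => [|x a IH] b l; first by rewrite inE => /eqP ->.
elim: b l => [|y b IHb] l; first by rewrite inE cats0 => /eqP ->.
rewrite shuffles_cons mem_cat => /orP[] /mapP[l' hl' ->].
  by rewrite perm_cons; exact: IH.
rewrite perm_sym (perm_catCA (x :: a) [:: y] b) /= perm_cons perm_sym.
exact: IHb.
Qed.

Definition key_lt (x y : nat * W) := (x.1 < y.1)%N.

Lemma kinv_cons x l (p : bool) :
  \big[addb/false]_(y <- l | (y.1 < x.1)%N) (spar x.2 && spar y.2) = p ->
  kinv (x :: l) = p (+) kinv l.
Proof. by move=> <-. Qed.

Lemma cfUZ_cons (a : R) i w k z :
  cf << a *g i :: w >> (k :: z) = (i == k)%:R * cf << a *g w >> z :> R^o.
Proof.
rewrite /cf !mcoeffU eqseq_cons; case: (i == k) => /=; first by rewrite mul1r.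
by rewrite mul0r.
Qed.

(** A letter of a in front of a shuffle creates no inversion, a letter y of b one
    with each letter of a: this is the twist in the recursion of [fshuf]. *)
Lemma sum_shuffles a b : pairwise key_lt a -> pairwise key_lt b -> allrel key_lt a b ->
  cf (\sum_(l <- shuffles a b) << sg (kinv l) *g map snd l >>) =
  fshuf (ew R (map snd a)) (ew R (map snd b)).
Proof.
have pk l : pairwise key_lt l -> kinv l = false.
  by move=> h; apply: kinv_sorted; apply: sub_pairwise h => x y; exact: ltnW.
elim: a b => [|x a IH] b pa pb pab.
  by rewrite big_seq1 pk // ew0_fshuf -cfU.
elim: b pb pab => [|y b IHb] pb pab.
  by rewrite shuffles_nil big_seq1 pk // fshuf_ew0 -cfU.
case/andP: (pa) => xa pa'; case/andP: (pb) => yb pb'; case/andP: (pab) => xyb ayb.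
have ab : allrel key_lt (x :: a) b.
  by move: pab; rewrite allrel_consr => /andP[].
rewrite shuffles_cons big_cat !big_map cfD; apply: funext => -[|k z].
  rewrite !cf_sum fnD !fn_sum !big1 ?addr0 /= ?/ew ?mul0r // => l _;
  by rewrite /cf mcoeffU.
rewrite -[RHS]/(fshuf (der k (ew R (x.2 :: map snd a))) _ z +
   fshuf (tw (spar k) (ew R (x.2 :: map snd a))) (der k (ew R (y.2 :: map snd b))) z).
rewrite !der_ew_cons fnD tw_ew !(fshuflL, fshufrL) !fnZ; congr (_ + _).
  rewrite -IH // !cf_sum !fn_sum mulr_sumr.
  rewrite big_seq [RHS]big_seq; apply: eq_bigr => l hl.
  rewrite (kinv_cons (p := false)) ?cfUZ_cons // big_seq_cond big1 // => u /andP[ul].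
  rewrite (perm_mem (perm_shuffles hl)) mem_cat in ul.
  have : (x.1 < u.1)%N.
    case/orP: ul => hu; first exact: (allP xa).
    exact: (allP xyb).
  by rewrite ltnNge => h /ltnW; rewrite (negPf h).
rewrite -[x.2 :: _]/(map snd (x :: a)) -IHb // !cf_sum !fn_sum !mulr_sumr.
rewrite big_seq [RHS]big_seq; apply: eq_bigr => l hl.
rewrite (kinv_cons (p := spar y.2 && wpar (map snd (x :: a)))); last first.
  rewrite (perm_big _ (perm_shuffles hl)) big_cat /= addbC big_seq_cond big1 ?addFb; last first.
    move=> u /andP[/(allP yb) yu /(ltn_trans yu)].
    by rewrite ltnn.
  have -> : \big[addb/false]_(y0 <- x :: a | (y0.1 < y.1)%N) (spar y.2 && spar y0.2) =
     \big[addb/false]_(u <- x :: a) (spar y.2 && spar u.2).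
    rewrite big_seq_cond [RHS]big_seq; apply: eq_bigl => u.
    case hu: (u \in _) => //=.
    by move: pab => /allrelP/(_ u y hu (mem_head _ _)).
  rewrite /wpar -[x.2 :: _]/(map snd (x :: a)) big_map; case: (spar y.2) => //=.
  by rewrite big1.
rewrite cfUZ_cons; case: eqP => [<-|_]; last by rewrite !mul0r.
by rewrite !mul1r -sgM /cf !mcoeffU mulrnAr.
Qed.

Lemma lo_map d d' : lo d d' = map (@lshift d d') (enum 'I_d).
Proof.
apply: ord_ltP.
- exact/pairwise_filter/pairwise_enum.
- by rewrite pairwise_map; exact: pairwise_enum.
move=> k; rewrite [LHS]mem_filter mem_enum andbT; apply/idP/mapP => [h|[i _ ->]].
  by exists (Ordinal h); rewrite ?mem_enum //; apply: val_inj.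
by rewrite /block /=.
Qed.

Lemma hi_map d d' : hi d d' = map (@rshift d d') (enum 'I_d').
Proof.
apply: ord_ltP.
- exact/pairwise_filter/pairwise_enum.
- rewrite pairwise_map; apply: sub_pairwise (pairwise_enum d') => i j.
  by rewrite /ord_lt /= ltn_add2l.
move=> k; rewrite [LHS]mem_filter mem_enum andbT; apply/idP/mapP => [h|[i _ ->]].
  have lt : (k - d < d')%N by have := ltn_ord k; rewrite /= /block in h; lia.
  exists (Ordinal lt); rewrite ?mem_enum //; apply: val_inj => /=.
  by rewrite /= /block in h; lia.
by rewrite /= /block /=; lia.
Qed.

Lemma cf_wshuffle w w' : cf (wshuffle R w w') = fshuf (ew R w) (ew R w').
Proof.
set d := size w; set d' := size w'.
pose t := cat_tuple (in_tuple w) (in_tuple w').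
pose K (i : 'I_(d + d')) := (val i, tnth t i).
transitivity (@cf R W (\sum_(l <- shuffles (map K (lo d d')) (map K (hi d d')))
    << sg (kinv l) *g map snd l >>)).
  rewrite shuffles_map big_map -sum_shortest; congr cf; apply: eq_bigr => g _.
  by rewrite wactE /keyed /vals -(map_comp K).
have E (I : Type) (f : I -> 'I_(d + d')) (s : seq I) :
    map snd (map K (map f s)) = [seq (K (f i)).2 | i <- s].
  by rewrite -!map_comp.
rewrite sum_shuffles.
- congr (fshuf (ew R _) (ew R _)).
    rewrite lo_map E; transitivity (tval (in_tuple w)) => //.
    by rewrite -[RHS]map_tnth_enum; apply: eq_map => i; rewrite /= tnth_lshift.
  rewrite hi_map E; transitivity (tval (in_tuple w')) => //.
  by rewrite -[RHS]map_tnth_enum; apply: eq_map => i; rewrite /= tnth_rshift.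
- by rewrite pairwise_map; exact/pairwise_filter/pairwise_enum.
- by rewrite pairwise_map; exact/pairwise_filter/pairwise_enum.
apply/allrelP => x y /mapP[i] /[swap] -> /=; rewrite mem_filter => /andP[hi _].
move=> /mapP[j] /[swap] -> /=; rewrite mem_filter /= => /andP[hj _].
by rewrite /key_lt /=; rewrite /block in hi hj; lia.
Qed.

Lemma cf_shuffle (f g : talg R W) : cf (shuffle f g) = fshuf (cf f) (cf g).
Proof.
apply: cf_mlin2 => [s|t|w w'].
- exact: fshuf_is_linear.
- exact: fshuf_on_is_linear.
- exact: cf_wshuffle.
Qed.

End ShuffleCoef.

(** * Components of a tensor *)

Section Words.
Variables (R : comNzRingType) (W : sspace).
Implicit Types (s t : fn R W) (u v w z : seq W).

Definition words_upto n : seq (seq W) := flatten [seq words W d | d <- iota 0 n].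

Lemma big_words_upto (U : nmodType) n (F : seq W -> U) :
  \sum_(w <- words_upto n) F w = \sum_(0 <= d < n) \sum_(w <- words W d) F w.
Proof. by rewrite /words_upto big_flatten big_map /index_iota subn0. Qed.

Lemma sum_ew n s z : (\sum_(w <- words W n) s w *: ew R w) z = (size z == n)%:R * s z.
Proof.
rewrite fn_sum; under eq_bigr do rewrite fnZ /ew.
case: eqP => [e|ne].
  rewrite (bigD1_seq z) ?mem_words ?e ?uniq_words //= eqxx mulr1 mul1r big1 ?addr0 //.
  by move=> w /negPf wz; rewrite eq_sym wz mulr0.
rewrite mul0r big_seq big1 // => w; rewrite mem_words => /eqP ws.
by case: eqP => [zw|]; rewrite ?mulr0 //; case: ne; rewrite zw.
Qed.

(** Only tensors of the same degree are multiplied. *)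
Lemma fmul_local (c : sconst R W) s s' t t' z :
  (forall w, size w = size z -> s w = s' w) ->
  (forall w, size w = size z -> t w = t' w) -> fmul c s t z = fmul c s' t' z.
Proof.
elim: z s s' t t' => [|k z IH] s s' t t' hs ht /=; first by rewrite hs // ht.
apply: eq_bigr => i _; apply: eq_bigr => j _; congr (_ * _); apply: IH => w hw.
  by rewrite /tw /der hs //= hw.
by rewrite /der ht //= hw.
Qed.

Lemma fmul_expand_l (c : sconst R W) s t v :
  fmul c s t v = \sum_(u <- words W (size v)) s u * fmul c (ew R u) t v.
Proof.
transitivity (fmul c (\sum_(u <- words W (size v)) s u *: ew R u) t v).
  by apply: fmul_local => // w hw; rewrite sum_ew hw eqxx mul1r.
by rewrite fmull_sum fn_sum; apply: eq_bigr => u _; rewrite fmulL.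
Qed.
Lemma fmul_expand_r (c : sconst R W) s t v :
  fmul c s t v = \sum_(u <- words W (size v)) t u * fmul c s (ew R u) v.
Proof.
transitivity (fmul c s (\sum_(u <- words W (size v)) t u *: ew R u) v).
  by apply: fmul_local => // w hw; rewrite sum_ew hw eqxx mul1r.
by rewrite fmulr_sum fn_sum; apply: eq_bigr => u _; rewrite fmulL.
Qed.

Definition proj (e : bool) s : fn R W := fun z => (wpar z == e)%:R * s z.

Lemma sinv_swap_par w i j z : wpar (w ++ i :: j :: z) = wpar (w ++ j :: i :: z) :> bool.
Proof. by rewrite !wpar_cat !wpar_cons addbCA [X in _ (+) X]addbCA addbCA; case: (wpar w) (spar i) (spar j) (wpar z) => [] [] [] []. Qed.

Lemma sinv_proj e s : sinv s -> sinv (proj e s).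
Proof. by move=> hs w i j z; rewrite /proj sinv_swap_par hs mulrCA. Qed.

Lemma proj_lin e a s t : proj e (a *: s + t) = a *: proj e s + proj e t.
Proof. by apply: funext => z; rewrite /proj !fnD !fnZ; ring. Qed.

(** The sums over parities in the definition of the Turner double are sign
    automorphisms. *)
Lemma sum_sg_proj b s : \sum_(e : bool) sg (b && e) *: proj e s = tw b s.
Proof.
apply: funext => z; rewrite fn_sum /= big_bool /= !fnZ /proj /tw.
by case: (wpar z); case: b; rewrite /= ?mul0r ?mul1r ?mulr0 ?addr0 ?add0r ?mul1r.
Qed.

Definition eps_tw s : fn R W := fun z => sg (eps z) * s z.

Lemma eps_tw_fins i s : eps_tw (fins i s) = fins i (eps_tw (tw (spar i) s)).
Proof.
have D k t : der k (eps_tw t) = eps_tw (tw (spar k) (der k t)).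
  apply: funext => z; rewrite /der /eps_tw /tw /= mulrA sgM [eps z (+) _]addbC.
  by [].
have eps_twZ a t : eps_tw (a *: t) = a *: eps_tw t.
  by apply: funext => z; rewrite /eps_tw !fnZ mulrCA.
apply: funext => z; elim: z s => [|k z IH] s; first by rewrite /eps_tw /= mulr0.
rewrite -[LHS]/(der k _ z) -[RHS]/(der k _ z) D !der_fins !(twL, tw_fins).
rewrite [in RHS]D der_tw !(twL, eps_twZ, finsZ, fnD, fnZ) twK.
rewrite [LHS](_ : _ = (k == i)%:R * eps_tw (tw (spar k) s) z +
   sg (spar i && spar k) * (sg (spar k && spar i) * eps_tw (fins i (tw (spar k) (der k s))) z)).
  rewrite IH twK [_ (+) spar k]addbC; congr (_ + _); last first.
    by rewrite [spar k && _]andbC.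
  by case: eqP => [->|_]; rewrite ?mul0r.
by rewrite /eps_tw !fnD !fnZ /=; ring.
Qed.

(** All words in N(v) are rearrangements of v, and [eps] depends only on the
    number of odd letters. *)
Lemma eps_tw_nw v : eps_tw (nw R v) = sg (eps v) *: nw R v.
Proof.
elim: v => [|i v IH].
  apply: funext => z; rewrite /eps_tw fnZ /nw /= /ew.
  by case: eqP => [->|] //; rewrite !mulr0.
rewrite [nw _ _]/(fins i (nw R v)) eps_tw_fins.
have -> : tw (spar i) (nw R v) = sg (spar i && wpar v) *: nw R v.
  rewrite /nw tw_nact; congr (_ *: nact v _).
  by rewrite tw_ew wpar_nil andbF /sg scale1r.
have eps_twZ a t : eps_tw (a *: t) = a *: eps_tw t.
  by apply: funext => z; rewrite /eps_tw !fnZ mulrCA.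
by rewrite eps_twZ IH scalerA finsZ sgM.
Qed.

End Words.

Section Iv.
Variables (R : comNzRingType) (V : sspace).
Implicit Types (xi eta : invar R V).

Lemma to_invK (t : talg R V) : t \in @is_inv R V -> inv_val (to_inv t) = t.
Proof. by move=> h; rewrite /to_inv; exact: insubdK. Qed.

Definition iv xi := cf (inv_val xi).
Lemma sinv_iv xi : sinv (iv xi).
Proof. by apply/is_invP; case: xi. Qed.

Lemma ivD xi eta : iv (xi + eta) = iv xi + iv eta.
Proof. by rewrite /iv -cfD. Qed.
Lemma ivZ a xi : iv (a *: xi) = a *: iv xi.
Proof. by rewrite /iv -cfZ. Qed.
Lemma iv_inj : injective iv.
Proof. by move=> xi eta /cf_inj/val_inj. Qed.
Lemma iv_to_inv (t : talg R V) : sinv (cf t) -> iv (to_inv t) = cf t.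
Proof. by move=> h; rewrite /iv to_invK //; apply/is_invP. Qed.

Lemma iv_sum (I : Type) (r : seq I) (P : pred I) (F : I -> invar R V) :
  iv (\sum_(i <- r | P i) F i) = \sum_(i <- r | P i) iv (F i).
Proof. by apply: (big_morph iv ivD); exact: (@cf0 R V). Qed.

End Iv.
Arguments iv {R V} xi.

(** * The graded dual of the invariants *)

Section Gdual.
Variables (K : fieldType) (V : sspace) (c : sconst K V).
Hypothesis charK : [pchar K] =i pred0.
Hypothesis cgr : graded c.
Local Notation invar := (invar K V).
Implicit Types (xi eta : invar) (x y : gdual K V) (v w u z : seq V) (e : bool).

Lemma iv_inv_par e xi : iv (inv_par e xi) = proj e (iv xi).
Proof.
have E : cf (tpar e (inv_val xi)) = proj e (iv xi) by apply: funext => z; exact: cf_tpar.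
by rewrite /inv_par iv_to_inv E //; apply/sinv_proj/sinv_iv.
Qed.

Lemma iv_inv_mul xi eta : iv (inv_mul c xi eta) = fmul c (iv xi) (iv eta).
Proof.
by rewrite /inv_mul iv_to_inv cf_tmul //; apply: sinv_fmul => //; exact: sinv_iv.
Qed.

Lemma gdual_lin x a xi eta : x (a *: xi + eta) = a * x xi + x eta.
Proof. by case: x => f hf; have /asboolP[h _] := hf; exact: h. Qed.
Lemma gdualD x xi eta : x (xi + eta) = x xi + x eta.
Proof. by rewrite -[xi]scale1r gdual_lin mul1r scale1r. Qed.
Lemma gdual0 x : x 0 = 0.
Proof. by apply: (addIr (x 0)); rewrite -gdualD !add0r. Qed.
Lemma gdualZ x a xi : x (a *: xi) = a * x xi.
Proof. by rewrite -[a *: xi]addr0 gdual_lin gdual0 addr0. Qed.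
Lemma gdual_sum x (I : Type) (r : seq I) (P : pred I) (F : I -> invar) :
  x (\sum_(i <- r | P i) F i) = \sum_(i <- r | P i) x (F i).
Proof. by apply: (big_morph x) => [? ?|]; [exact: gdualD | exact: gdual0]. Qed.

Lemma gdual_bound x : exists n, forall xi, (forall w, (size w < n)%N -> iv xi w = 0) -> x xi = 0.
Proof.
case: x => f hf; have /asboolP[_ [n h]] := hf; exists n => xi hxi; apply: h => w.
rewrite leqNgt; apply: contraL => /hxi.
by rewrite /iv /cf => /eqP; rewrite mcoeff_eq0.
Qed.

Lemma gdualE x y xi a : (a *: x + y) xi = a * x xi + y xi.
Proof. by []. Qed.
Lemma gdual_scaleE a x xi : (a *: x) xi = a * x xi. Proof. by []. Qed.
Lemma gdual_sumE (I : Type) (r : seq I) (P : pred I) (F : I -> gdual K V) xi :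
  (\sum_(i <- r | P i) F i) xi = \sum_(i <- r | P i) F i xi.
Proof. exact: (big_morph (fun x : gdual K V => x xi)). Qed.
Lemma gdual_ext x y : (forall xi, x xi = y xi) -> x = y.
Proof. by move=> h; apply: val_inj; apply/funext => xi; exact: h. Qed.
Lemma to_gdualE (f : invar -> K^o) x : (forall xi, f xi = x xi) -> to_gdual f = x.
Proof.
move=> h; have -> : f = \val x by apply/funext => xi; exact: h.
exact: valKd.
Qed.
Lemma to_gdualK (f : invar -> K^o) xi : f \in @is_gdual K V -> to_gdual f xi = f xi.
Proof. by move=> h; rewrite -[gdual_val _]/(\val _) insubdK. Qed.

(** The tensor with coefficient function [nw w]. *)
Definition mnorm (R : comNzRingType) (W : sspace) (w : seq W) : talg R W :=
  foldr (fun i t => shuffle << [:: i] >> t) << [::] >> w.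

Lemma cf_mnorm (R : comNzRingType) (W : sspace) (w : seq W) : cf (mnorm R w) = nw R w.
Proof.
elim: w => [|i w IH] /=; first by rewrite cfU.
by rewrite cf_shuffle IH cfU -fins_ew0 fshuf_fins_l ew0_fshuf.
Qed.

Definition inorm v : invar := to_inv (mnorm K v).
Lemma iv_inorm v : iv (inorm v) = nw K v.
Proof. by rewrite /inorm iv_to_inv cf_mnorm //; exact: sinv_nw. Qed.

Lemma fact_neq0 n : (n`!%:R : K) != 0.
Proof. by have /pcharf0P -> := charK; rewrite -lt0n fact_gt0. Qed.

Lemma euler_upto (s : fn K V) n z : sinv s ->
  (\sum_(w <- words_upto V n) (s w / (size w)`!%:R) *: nw K w) z = (size z < n)%N%:R * s z.
Proof.
move=> hs; rewrite big_words_upto fn_sum.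
transitivity (\sum_(0 <= d < n) (size z == d)%:R * s z).
  apply: eq_bigr => d _.
  rewrite (_ : \sum_(w <- words V d) _ = d`!%:R^-1 *: \sum_(w <- words V d) s w *: nw K w).
    rewrite euler_words // !fnZ /cut mulrA mulVf ?mul1r //; exact: fact_neq0.
  rewrite scaler_sumr big_seq [RHS]big_seq; apply: eq_bigr => w.
  by rewrite mem_words scalerA => /eqP ->; rewrite mulrC.
rewrite -mulr_suml; congr (_ * _).
case: ltnP => h.
  rewrite (bigD1_seq (size z)) ?mem_index_iota ?iota_uniq //= eqxx big1 ?addr0 //.
  by move=> d /negPf; rewrite eq_sym => ->.
rewrite big_nat big1 // => d /andP[_ dn]; rewrite gtn_eqF //.
exact: leq_trans dn h.
Qed.

Lemma ev_is_gdual v : (fun xi => iv xi v : K^o) \in @is_gdual K V.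
Proof.
apply/asboolP; split=> [a xi eta|]; first by rewrite ivD ivZ.
exists (size v).+1 => xi h; apply/eqP; rewrite mcoeff_eq0.
by apply/negP => /h; rewrite ltnn.
Qed.
(** The functionals to which all computations in (Inv X)^* are reduced. *)
Definition ev v : gdual K V := GDual (ev_is_gdual v).
Lemma evE v xi : ev v xi = iv xi v. Proof. by []. Qed.

(** By the Euler identity, a tensor of degree d is the sum of the ev w / d! of it
    times N(w), so x is the corresponding combination of the ev w. *)
Lemma gdual_span x : exists n, x =
  \sum_(w <- words_upto V n) ((x (inorm w) : K) / (size w)`!%:R) *: ev w.
Proof.
have [n hn] := gdual_bound x; exists n; apply: gdual_ext => xi.
rewrite gdual_sumE.
set xi' := \sum_(w <- words_upto V n) (iv xi w / (size w)`!%:R) *: inorm w.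
have Exi' : iv xi' = \sum_(w <- words_upto V n) (iv xi w / (size w)`!%:R) *: nw K w.
  by rewrite iv_sum; apply: eq_bigr => w _; rewrite ivZ iv_inorm.
have : x (xi - xi') = 0.
  apply: hn => w hw; rewrite -scaleN1r ivD ivZ Exi' fnD fnZ euler_upto; last exact: sinv_iv.
  by rewrite hw mul1r mulN1r subrr.
rewrite -scaleN1r gdualD gdualZ mulN1r => /subr0_eq ->.
rewrite /xi' gdual_sum; apply: eq_bigr => w _.
by rewrite gdualZ gdual_scaleE evE; ring.
Qed.

(** The map (Inv X)^* -> Inv(X^* ) which is kappa under Sym(X^* ) = (Inv X)^*,
    see [psi_sym_gdual]: a functional is evaluated at the norms, with the sign of
    the pairing between words and words of dual vectors. *)
Definition psi x : fn K V := fun w => sg (eps w) * x (inorm w).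
Lemma psi_is_linear : linear psi.
Proof. by move=> a x y; apply: funext => w; rewrite /psi gdualE fnD fnZ /=; ring. Qed.
HB.instance Definition _ :=
  GRing.isLinear.Build K (gdual K V) (fn K V) _ psi psi_is_linear.
Lemma psiZ a x : psi (a *: x) = a *: psi x. Proof. exact: linearZ_LR. Qed.

Lemma psi_ev v : psi (ev v) = sg (eps v) *: nw K v.
Proof.
rewrite -eps_tw_nw; apply: funext => w.
by rewrite /psi evE iv_inorm /eps_tw nw_sym.
Qed.

(** The coproduct of an invariant is invariant in both factors separately; the
    Euler identity, applied in each of them, writes it in terms of norms. *)
Lemma sweedlerP xi : is_sweedler xi (sweedler xi).
Proof.
pose n := (\max_(w <- msupp (inv_val xi)) size w).+1.
have hn w : (n <= size w)%N -> iv xi w = 0.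
  move=> nw; apply/eqP; rewrite mcoeff_eq0; apply: contraL nw => hw.
  by rewrite -ltnNge ltnS; exact: (@leq_bigmax_seq _ _ xpredT size).
(* The coproduct of xi is the sum over u1 and u2 of the tensors
   xi(u1 u2) / (|u1|! |u2|!) N(u1) (x) N(u2). *)
pose l := [seq ((iv xi (u1 ++ u2) / ((size u1)`!%:R * (size u2)`!%:R)) *: inorm u1, inorm u2)
   | u1 <- words_upto V n, u2 <- words_upto V n].
apply: (@xgetPex _ [::] (is_sweedler xi)); exists l.
apply/malgP => -[z1 z2]; rewrite coef_coprod raddf_sum big_allpairs_dep /=.
have E (a : K) u1 u2 :
    (tens2 (a *: inorm u1 : invar) (inorm u2))@_(z1, z2) = a * nw K u1 z1 * nw K u2 z2.
  rewrite coef_tens2 -[(inv_val (inorm u2))@_z2]/(iv _ z2) iv_inorm; congr (_ * _).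
  by rewrite -[LHS]/(iv _ z1) ivZ iv_inorm.
under eq_bigr do under eq_bigr do rewrite E.
transitivity (\sum_(u1 <- words_upto V n) (nw K u1 z1 / (size u1)`!%:R) *
   (\sum_(u2 <- words_upto V n) (derw u1 (iv xi) u2 / (size u2)`!%:R) *: nw K u2) z2); last first.
  apply: eq_bigr => u1 _; rewrite fn_sum mulr_sumr; apply: eq_bigr => u2 _.
  by rewrite fnZ /derw invfM; ring.
have hr : sinv (fun u1 => iv xi (u1 ++ z2)).
  by move=> w i j z; rewrite -!catA /= (sinv_iv xi).
transitivity ((size z2 < n)%N%:R * (\sum_(u1 <- words_upto V n)
   ((fun u1 => iv xi (u1 ++ z2)) u1 / (size u1)`!%:R) *: nw K u1) z1); last first.
  rewrite fn_sum mulr_sumr; apply: eq_bigr => u1 _.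
  rewrite euler_upto; last exact/sinv_derw/sinv_iv.
  by rewrite fnZ /derw; ring.
rewrite euler_upto //; rewrite -[(inv_val xi)@_(z1 ++ z2)]/(iv xi (z1 ++ z2)).
case: ltnP => h2; case: ltnP => h1; rewrite ?mul1r // hn ?mulr0 // size_cat.
- exact: leq_trans h1 (leq_addr _ _).
- exact: leq_trans h2 (leq_addl _ _).
- exact: leq_trans h1 (leq_addr _ _).
Qed.

(** In particular the contraction of the first factor with w is the derivative
    of xi along w. *)
Lemma sum_sweedler xi w w' :
  \sum_(s <- sweedler xi) iv s.1 w * iv s.2 w' = iv xi (w ++ w').
Proof.
rewrite -[RHS]coef_coprod sweedlerP raddf_sum /=.
by apply: eq_bigr => s _; rewrite coef_tens2.
Qed.

Lemma inv_par_linear e a xi eta : inv_par e (a *: xi + eta) = a *: inv_par e xi + inv_par e eta.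
Proof.
apply: iv_inj; move: (inv_par e) (iv_inv_par e) => P PE.
by rewrite ivD ivZ !PE ivD ivZ proj_lin.
Qed.

Lemma gdual_parE e x xi : gdual_par e x xi = x (inv_par e xi).
Proof.
rewrite /gdual_par to_gdualK //.
move: (inv_par e) (inv_par_linear e) (iv_inv_par e) => P PL PE.
apply/asboolP; split=> [a xi' eta|]; first by rewrite PL gdual_lin.
have [n hn] := gdual_bound x; exists n => xi' h; apply: hn => w hw.
rewrite PE /proj; have [->|ne] := eqVneq (iv xi' w) 0; first by rewrite mulr0.
by move: ne; rewrite mcoeff_neq0 => /h; rewrite leqNgt hw.
Qed.

Lemma ev_inv_par e v xi : ev v (inv_par e xi) = (wpar v == e)%:R * iv xi v.
Proof. by rewrite evE (iv_inv_par e xi). Qed.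

Lemma gdual_par_ev e v : gdual_par e (ev v) = (wpar v == e)%:R *: ev v.
Proof. by apply: gdual_ext => xi; rewrite gdual_parE ev_inv_par gdual_scaleE. Qed.

Lemma iv_small n xi : (forall w, w \in msupp (inv_val xi) -> (n <= size w)%N) ->
  forall w, (size w < n)%N -> iv xi w = 0.
Proof.
move=> h w hw; apply/eqP; rewrite mcoeff_eq0; apply/negP => /h.
by rewrite leqNgt hw.
Qed.

Lemma ract_val x xi eta : Defs.ract c x xi eta = x (inv_mul c xi eta).
Proof.
rewrite /Defs.ract to_gdualK //; move: (inv_mul c) iv_inv_mul => M ME.
apply/asboolP; split=> [a xi' eta'|].
  rewrite -gdual_lin; congr (gdual_val x _); apply: iv_inj.
  by rewrite ivD ivZ !ME ivD ivZ !fmulL.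
have [n hn] := gdual_bound x; exists n => xi' /iv_small h; apply: hn => w hw.
rewrite ME (@fmul_local _ _ _ _ (iv xi) _ 0) ?fmulr0 // => u hu.
by apply: h; rewrite hu.
Qed.

Lemma lact_val x xi eta : Defs.lact c xi x eta = x (inv_mul c eta xi).
Proof.
rewrite /Defs.lact to_gdualK //; move: (inv_mul c) iv_inv_mul => M ME.
apply/asboolP; split=> [a xi' eta'|].
  rewrite -gdual_lin; congr (gdual_val x _); apply: iv_inj.
  by rewrite ivD ivZ !ME ivD ivZ !fmulL.
have [n hn] := gdual_bound x; exists n => xi' /iv_small h; apply: hn => w hw.
rewrite ME (@fmul_local _ _ _ _ 0 _ (iv xi)) ?fmull0 // => u hu.
by apply: h; rewrite hu.
Qed.

(** The value of ev v on a product is expanded in the coefficients of the other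
    factor. *)
Lemma ract_ev v xi :
  Defs.ract c (ev v) xi = \sum_(z <- words V (size v)) (fmul c (iv xi) (ew K z) v : K) *: ev z.
Proof.
apply: gdual_ext => eta; rewrite ract_val evE iv_inv_mul fmul_expand_r gdual_sumE.
by apply: eq_bigr => z _; rewrite gdual_scaleE evE mulrC.
Qed.

Lemma lact_ev v xi :
  Defs.lact c xi (ev v) = \sum_(z <- words V (size v)) (fmul c (ew K z) (iv xi) v : K) *: ev z.
Proof.
apply: gdual_ext => eta; rewrite lact_val evE iv_inv_mul fmul_expand_l gdual_sumE.
by apply: eq_bigr => z _; rewrite gdual_scaleE evE mulrC.
Qed.

(** The values of [gdual_mul x y], before this is known to be a functional of
    bounded degree. *)
Definition gmul_val x y xi : K^o :=
  \sum_(s <- sweedler xi) \sum_(e1 : bool) \sum_(e2 : bool)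
    (-1) ^+ (e2 * e1)%N * (x (inv_par e1 s.1) * gdual_par e2 y s.2).

Lemma gmul_val_ev v w xi :
  gmul_val (ev v) (ev w) xi = (sg (wpar v && wpar w) *: ev (v ++ w)) xi.
Proof.
rewrite gdual_scaleE evE -sum_sweedler mulr_sumr; apply: eq_bigr => s _.
transitivity (\sum_(e1 : bool) \sum_(e2 : bool) (-1) ^+ (e2 * e1)%N *
    (((wpar v == e1)%:R * iv s.1 v) * ((wpar w == e2)%:R * iv s.2 w))).
  by apply: eq_bigr => e1 _; apply: eq_bigr => e2 _; rewrite gdual_parE !ev_inv_par.
move: (iv s.1 v) (iv s.2 w) => a b; rewrite !big_bool /sg.
by case: (wpar v); case: (wpar w); rewrite /= ?expr0 ?expr1; ring.
Qed.

Lemma gmul_val_linl a x x' y xi :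
  gmul_val (a *: x + x') y xi = a * gmul_val x y xi + gmul_val x' y xi.
Proof.
rewrite mulr_sumr -big_split; apply: eq_bigr => s _.
rewrite mulr_sumr -big_split; apply: eq_bigr => e1 _.
rewrite mulr_sumr -big_split; apply: eq_bigr => e2 _.
rewrite gdualE; move: (x _) (x' _) (gdual_par e2 y _) => p q r; rewrite /=; ring.
Qed.

Lemma gmul_val_linr a x y y' xi :
  gmul_val x (a *: y + y') xi = a * gmul_val x y xi + gmul_val x y' xi.
Proof.
rewrite mulr_sumr -big_split; apply: eq_bigr => s _.
rewrite mulr_sumr -big_split; apply: eq_bigr => e1 _.
rewrite mulr_sumr -big_split; apply: eq_bigr => e2 _.
rewrite !gdual_parE gdualE; move: (x _) (y _) (y' _) => p q r; rewrite /=; ring.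
Qed.

Lemma gdual_ind (P : gdual K V -> Prop) :
  P 0 -> (forall a v x, P x -> P (a *: ev v + x)) -> forall x, P x.
Proof.
move=> P0 PS x; have [n ->] := gdual_span x.
by elim: (words_upto V n) => [|w r IH]; rewrite ?big_nil // big_cons; exact: PS.
Qed.

(** True for x = ev v and y = ev w, by [gmul_val_ev], hence in general. *)
Lemma gmul_val_is_gdual x y : exists t : gdual K V, forall xi, gmul_val x y xi = t xi.
Proof.
elim/gdual_ind: x => [|a v x [z hz]].
  exists 0 => xi; rewrite /gmul_val big1 // => s _; rewrite big1 // => e1 _.
  by rewrite big1 // => e2 _; rewrite mul0r mulr0.
suff [z' hz'] : exists t : gdual K V, forall xi, gmul_val (ev v) y xi = t xi.
  by exists (a *: z' + z) => xi; rewrite gmul_val_linl hz hz' gdualE.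
elim/gdual_ind: y {hz} => [|b w y [z' hz']].
  exists 0 => xi; rewrite /gmul_val big1 // => s _; rewrite big1 // => e1 _.
  by rewrite big1 // => e2 _; rewrite gdual_parE !mulr0.
exists (b *: (sg (wpar v && wpar w) *: ev (v ++ w)) + z') => xi.
by rewrite gmul_val_linr hz' gmul_val_ev gdualE.
Qed.

Lemma gdual_mulE x y xi : gdual_mul x y xi = gmul_val x y xi.
Proof.
have [z hz] := gmul_val_is_gdual x y.
by rewrite /gdual_mul (to_gdualE (x := z)).
Qed.

Lemma gdual_mul_ev v w : gdual_mul (ev v) (ev w) = sg (wpar v && wpar w) *: ev (v ++ w).
Proof. by apply: gdual_ext => xi; rewrite gdual_mulE gmul_val_ev. Qed.

Lemma gdual_mul_linl a x x' y :
  gdual_mul (a *: x + x') y = a *: gdual_mul x y + gdual_mul x' y.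
Proof. by apply: gdual_ext => xi; rewrite gdualE !gdual_mulE gmul_val_linl. Qed.
Lemma gdual_mul_linr a x y y' :
  gdual_mul x (a *: y + y') = a *: gdual_mul x y + gdual_mul x y'.
Proof. by apply: gdual_ext => xi; rewrite gdualE !gdual_mulE gmul_val_linr. Qed.

End Gdual.

(** * The map on the Turner double and its multiplicativity *)

Section Lquot.
Variables (R : comNzRingType) (S : choiceType) (U : lmodType R).
Variables (P : {malg R[S]} -> Prop) (h : S -> U).

Lemma lspan_mlin t : (forall r, P r -> mlin h r = 0) -> t \in lspan P -> mlin h t = 0.
Proof.
move=> Ph /asboolP[l Pl ->]; rewrite mlin_sum big_seq big1 // => q /Pl Pq.
by rewrite mlinZ Ph // scaler0.
Qed.

(** A linear map killing the relations descends to the quotient: its value does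
    not depend on the representative. *)
Lemma mlin_repr : (forall r, P r -> mlin h r = 0) ->
  forall t, mlin h (repr (\pi_(lquot P) t)) = mlin h t.
Proof.
move=> Ph t; apply/eqP; rewrite -subr_eq0; apply/eqP.
have : repr (\pi_(lquot P) t) - t \in lspan P by apply/lquot_eqP; rewrite reprK.
move/(lspan_mlin Ph); rewrite -scaleN1r mlinD mlinZ scaleN1r.
exact.
Qed.

Lemma mlin_rel3 a (s t r : S) :
  mlin h (<< s >> - a *: << t >> - << r >>) = h s - a *: h t - h r.
Proof. by rewrite !linearB /= mlinZ !mlinU. Qed.

End Lquot.

Lemma lquot_piK (R : nzRingType) (U : lmodType R) (P : U -> Prop) (x : lquot P) :
  \pi_(lquot P) (repr x) = x.
Proof. exact: reprK. Qed.

Lemma lquot_lin (R : nzRingType) (U : lmodType R) (P : U -> Prop) a (x y : lquot P) :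
  a *: x + y = \pi_(lquot P) (a *: repr x + repr y).
Proof. by rewrite pi_lquotD pi_lquotZ !lquot_piK. Qed.

Lemma mem_lspan (R : nzRingType) (U : lmodType R) (P : U -> Prop) r : P r -> r \in lspan P.
Proof.
move=> Pr; apply/asboolP; exists [:: (1, r)]; last by rewrite big_seq1 scale1r.
by move=> q; rewrite inE => /eqP ->.
Qed.

Lemma pi_lquot0 (R : nzRingType) (U : lmodType R) (P : U -> Prop) :
  \pi_(lquot P) 0 = 0.
Proof. by rewrite -[X in \pi_(_) X](scale0r 0) pi_lquotZ; exact: scale0r. Qed.

Lemma lquot_sum (R : nzRingType) (S : choiceType) (P : {malg R[S]} -> Prop) (x : lquot P) :
  exists l : seq (R * S), x = \sum_(q <- l) q.1 *: (\pi_(lquot P) << q.2 >> : lquot P).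
Proof.
exists [seq ((repr x)@_s, s) | s <- msupp (repr x)].
rewrite big_map -{1}[x]lquot_piK {1}[repr x]monalgE.
elim: (enum_fset _) => [|s l IH]; first by rewrite !big_nil pi_lquot0.
rewrite !big_cons pi_lquotD IH; congr (_ + _) => /=.
rewrite -[RHS]/(lquot_scale _ _) -pi_lquotZ; congr (\pi_(_) _).
by apply/malgP => k; rewrite mcoeffZ !mcoeffU mulrnAr mulr1.
Qed.

Lemma pi_lquot_rel (R : nzRingType) (U : lmodType R) (P : U -> Prop) a (t s r : U) :
  t - a *: s - r \in lspan P ->
  \pi_(lquot P) t = a *: \pi_(lquot P) s + \pi_(lquot P) r.
Proof.
move=> h; rewrite -[a *: _]/(lquot_scale a _) -pi_lquotZ -pi_lquotD.
by apply/lquot_eqP; rewrite opprD addrA.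
Qed.

Section TurnerMap.
Variables (K : fieldType) (V : sspace) (c : sconst K V).
Hypothesis charK : [pchar K] =i pred0.
Hypothesis cgr : graded c.
Local Notation invar := (invar K V).
Local Notation T := (ssum V (sdual V)).
Local Notation cT := (trivial_ext c).
Local Notation linj := (finj (R := K) (@lft V)).
Local Notation rinj := (finj (R := K) (@rgt V)).
Local Notation turner := (turner K V).
Implicit Types (xi eta : invar) (x y : gdual K V) (v w u z : seq V) (e : bool) (F G : turner).

(** The coefficients of xi * kappa(x) in T_X. *)
Definition star_kappa xi x : fn K T := fshuf (linj (iv xi)) (rinj (psi x)).

Lemma star_kappa_linr xi a x y :
  star_kappa xi (a *: x + y) = a *: star_kappa xi x + star_kappa xi y.
Proof. by rewrite /star_kappa (@psi_is_linear K V a x y) finjD finjZ fshufrD fshufrZ. Qed.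
Lemma star_kappa_linl x a xi eta :
  star_kappa (a *: xi + eta) x = a *: star_kappa xi x + star_kappa eta x.
Proof. by rewrite /star_kappa ivD ivZ finjD finjZ fshuflD fshuflZ. Qed.

(** The isomorphism over K, on coefficients. *)
Definition PhiK F : fn K T := mlin (fun p => star_kappa p.1 p.2) (repr F).

Lemma star_kappa_rel (r : {malg K[(invar * gdual K V)%type]}) : bilin_rel r ->
  mlin (fun p => star_kappa p.1 p.2) r = 0.
Proof.
case=> [a xi xi' x|a xi x x']; rewrite mlin_rel3.
  by rewrite -[X in X - _ - _]/(star_kappa (a *: xi + xi') x) star_kappa_linl addrAC addrK subrr.
by rewrite -[X in X - _ - _]/(star_kappa xi (a *: x + x')) star_kappa_linr addrAC addrK subrr.
Qed.

Lemma PhiK_pi t : PhiK (\pi_(lquot (@bilin_rel K invar (gdual K V))) t) =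
  mlin (fun p => star_kappa p.1 p.2) t.
Proof. exact: (mlin_repr star_kappa_rel). Qed.

Lemma PhiK_is_linear : linear PhiK.
Proof. by move=> a F G; rewrite lquot_lin PhiK_pi linearP. Qed.
HB.instance Definition _ :=
  GRing.isLinear.Build K turner (fn K T) _ PhiK PhiK_is_linear.
Lemma PhiK0 : PhiK 0 = 0. Proof. exact: linear0. Qed.
Lemma PhiKD F G : PhiK (F + G) = PhiK F + PhiK G. Proof. exact: linearD. Qed.
Lemma PhiKZ a F : PhiK (a *: F) = a *: PhiK F. Proof. exact: linearZ_LR. Qed.
Lemma PhiK_sum (I : Type) (r : seq I) (P : pred I) (G : I -> turner) :
  PhiK (\sum_(i <- r | P i) G i) = \sum_(i <- r | P i) PhiK (G i).
Proof. exact: linear_sum. Qed.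

Lemma PhiK_pure xi x : PhiK (tpure xi x) = star_kappa xi x.
Proof. by rewrite [LHS]PhiK_pi mlinU. Qed.

(** The product is bilinear in x and y, so that they may be replaced by ev v and
    ev v' below. *)
Definition mul_image xi eta x y := PhiK (turner_mul_pure c xi x eta y).

Lemma mul_imageE xi eta x y : mul_image xi eta x y =
  \sum_(s <- sweedler xi) \sum_(t <- sweedler eta)
  \sum_(a1 : bool) \sum_(a2 : bool) \sum_(b1 : bool) \sum_(b2 : bool)
  \sum_(e : bool)
    (-1) ^+ (a1 * (a2 + (b1 + b2) + e) + b1 * e)%N *:
      star_kappa (inv_mul c (inv_par a2 s.2) (inv_par b1 t.1))
            (gdual_mul (Defs.ract c (gdual_par e x) (inv_par b2 t.2))
                       (Defs.lact c (inv_par a1 s.1) y)).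
Proof.
rewrite /mul_image PhiK_sum; apply: eq_bigr => s _; rewrite PhiK_sum; apply: eq_bigr => t _.
rewrite PhiK_sum; apply: eq_bigr => a1 _; rewrite PhiK_sum; apply: eq_bigr => a2 _.
rewrite PhiK_sum; apply: eq_bigr => b1 _; rewrite PhiK_sum; apply: eq_bigr => b2 _.
by rewrite PhiK_sum; apply: eq_bigr => e _; rewrite PhiKZ PhiK_pure.
Qed.

Lemma gdual_par_lin e a x y :
  gdual_par e (a *: x + y) = a *: gdual_par e x + gdual_par e y.
Proof. by apply: gdual_ext => xi; rewrite gdualE !gdual_parE // gdualE. Qed.
Lemma ract_lin xi a x y :
  Defs.ract c (a *: x + y) xi = a *: Defs.ract c x xi + Defs.ract c y xi.
Proof. by apply: gdual_ext => eta; rewrite gdualE !ract_val // gdualE. Qed.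
Lemma lact_lin xi a x y :
  Defs.lact c xi (a *: x + y) = a *: Defs.lact c xi x + Defs.lact c xi y.
Proof. by apply: gdual_ext => eta; rewrite gdualE !lact_val // gdualE. Qed.

Lemma mul_image_linl xi eta a x x' y : mul_image xi eta (a *: x + x') y = a *: mul_image xi eta x y + mul_image xi eta x' y.
Proof.
rewrite !mul_imageE; do 7 (rewrite scaler_sumr -big_split; apply: eq_bigr => ? _ /=).
by rewrite gdual_par_lin ract_lin gdual_mul_linl // star_kappa_linr scalerDr !scalerA [a * _]mulrC.
Qed.
Lemma mul_image_linr xi eta a x y y' : mul_image xi eta x (a *: y + y') = a *: mul_image xi eta x y + mul_image xi eta x y'.
Proof.
rewrite !mul_imageE; do 7 (rewrite scaler_sumr -big_split; apply: eq_bigr => ? _ /=).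
by rewrite lact_lin gdual_mul_linr // star_kappa_linr scalerDr !scalerA [a * _]mulrC.
Qed.

Lemma star_kappa_mul_ev xi e v v' (tau sigma : invar) :
  star_kappa xi (gdual_mul (Defs.ract c (gdual_par e (ev K v)) tau)
                         (Defs.lact c sigma (ev K v'))) =
  (wpar v == e)%:R *: \sum_(z <- words V (size v)) \sum_(z' <- words V (size v'))
    (fmul c (iv tau) (ew K z) v * fmul c (ew K z') (iv sigma) v' *
     (sg (eps z) * sg (eps z'))) *:
    fshuf (linj (iv xi)) (nw K (map (@ir V) (z ++ z'))).
Proof.
rewrite gdual_par_ev // -[_ *: ev K v]addr0 ract_lin.
have -> : Defs.ract c (0 : gdual K V) tau = 0 by apply: gdual_ext => eta; rewrite ract_val.
rewrite addr0 -[_ *: Defs.ract _ _ _]addr0 gdual_mul_linl // .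
have -> (y : gdual K V) : gdual_mul 0 y = 0.
  apply: gdual_ext => eta; rewrite gdual_mulE // /gmul_val big1 // => s _.
  by rewrite big1 // => e1 _; rewrite big1 // => e2 _; rewrite mul0r mulr0.
rewrite star_kappa_linr [X in _ + X](_ : _ = 0) ?addr0; last first.
  by rewrite /star_kappa (linear0 (@psi K V)) finj0 fshufr0.
congr (_ *: _); rewrite ract_ev // lact_ev //.
rewrite (lin_sum (f := fun x => star_kappa xi (gdual_mul x _))); last first.
  by move=> a x y; rewrite gdual_mul_linl // star_kappa_linr.
apply: eq_bigr => z _.
rewrite (lin_sum (f := fun x => star_kappa xi (gdual_mul _ x))); last first.
  by move=> a x y; rewrite gdual_mul_linr // star_kappa_linr.
rewrite scaler_sumr; apply: eq_bigr => z' _.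
rewrite gdual_mul_ev // /star_kappa psiZ psi_ev // !finjZ !fshufrZ !scalerA.
rewrite (finj_nw K (@irK V) (@rgtK V) (@ir_par V)); congr (_ *: _).
rewrite eps_cat -!mulrA; congr (_ * (_ * _)); rewrite !sgM; congr sg.
by case: (wpar z) (wpar z') (eps z) (eps z') => [] [] [] [].
Qed.

(** The form of the words u and u' acting on v and v', common to both sides of
    [mul_image_ev]. *)
Definition insm2 v v' u u' (P : fn K V) : fn K T :=
  sg (eps v (+) eps v' (+) br v u (+) br u' v') *:
   insm (lconst c) v u (insm (rconst c) v' u' (linj
     (tw (wpar u (+) wpar v (+) wpar u' (+) wpar v') P))).

Lemma insm2_is_linear v v' u u' : linear (insm2 v v' u u').
Proof.
move=> a s t; rewrite /insm2 twD twZ finjD finjZ !insmD !insmZ scalerDr !scalerA.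
by rewrite mulrC.
Qed.
HB.instance Definition _ v v' u u' :=
  GRing.isLinear.Build K (fn K V) (fn K T) _ (insm2 v v' u u') (insm2_is_linear v v' u u').
Lemma insm2_sum v v' u u' (I : Type) (r : seq I) (P : pred I) (F : I -> fn K V) :
  insm2 v v' u u' (\sum_(i <- r | P i) F i) = \sum_(i <- r | P i) insm2 v v' u u' (F i).
Proof. exact: linear_sum. Qed.
Lemma insm2Z v v' u u' a s : insm2 v v' u u' (a *: s) = a *: insm2 v v' u u' s.
Proof. exact: linearZ_LR. Qed.

(** The Turner product of the functionals, rewritten by [sum_fshuf_nw] as a sum
    over the words u and u' at which tau and sigma are evaluated. *)
Lemma star_kappa_mul_ev2 xi e v v' (tau sigma : invar) :
  star_kappa xi (gdual_mul (Defs.ract c (gdual_par e (ev K v)) tau)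
                         (Defs.lact c sigma (ev K v'))) =
  (wpar v == e)%:R *: \sum_(u <- words V (size v)) \sum_(u' <- words V (size v'))
    (iv tau u * iv sigma u') *: insm2 v v' u u' (iv xi).
Proof.
rewrite star_kappa_mul_ev; congr (_ *: _).
transitivity (\sum_(z <- words V (size v)) \sum_(z' <- words V (size v'))
   \sum_(u <- words V (size v)) \sum_(u' <- words V (size v'))
    (iv tau u * iv sigma u') *: (((sg (eps z) * fmul c (ew K u) (ew K z) v) *
     (sg (eps z') * fmul c (ew K z') (ew K u') v')) *:
    fshuf (linj (iv xi)) (nw K (map (@ir V) (z ++ z'))))).
  apply: eq_bigr => z _; apply: eq_bigr => z' _.
  rewrite (fmul_expand_l _ _ _ v) (fmul_expand_r _ _ _ v') !mulr_suml scaler_suml.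
  apply: eq_bigr => u _; rewrite mulr_sumr mulr_suml scaler_suml.
  by apply: eq_bigr => u' _; rewrite scalerA; congr (_ *: _); ring.
under eq_bigr do rewrite exchange_big.
rewrite exchange_big big_seq [RHS]big_seq; apply: eq_bigr => u hu.
under eq_bigr do rewrite exchange_big.
rewrite exchange_big big_seq [RHS]big_seq; apply: eq_bigr => u' hu' /=.
rewrite !mem_words in hu hu'.
rewrite /insm2 -(sum_fshuf_nw cgr _ (eqP hu) (eqP hu')) scaler_sumr; apply: eq_bigr => z _.
by rewrite scaler_sumr.
Qed.

Lemma star_kappa_term v v' a1 a2 b1 b2 e (s1 s2 t1 t2 : invar) :
  star_kappa (inv_mul c (inv_par a2 s2) (inv_par b1 t1))
    (gdual_mul (Defs.ract c (gdual_par e (ev K v)) (inv_par b2 t2))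
               (Defs.lact c (inv_par a1 s1) (ev K v'))) =
  (wpar v == e)%:R *: \sum_(u <- words V (size v)) \sum_(u' <- words V (size v'))
    (proj b2 (iv t2) u * proj a1 (iv s1) u') *:
      insm2 v v' u u' (fmul c (proj a2 (iv s2)) (proj b1 (iv t1))).
Proof.
have G (xi tau sigma : invar) xf tf sf : iv xi = xf -> iv tau = tf -> iv sigma = sf ->
    star_kappa xi (gdual_mul (Defs.ract c (gdual_par e (ev K v)) tau)
                           (Defs.lact c sigma (ev K v'))) =
    (wpar v == e)%:R *: \sum_(u <- words V (size v)) \sum_(u' <- words V (size v'))
      (tf u * sf u') *: insm2 v v' u u' xf.
  by move=> <- <- <-; exact: star_kappa_mul_ev2.
apply: G; [| exact: iv_inv_par | exact: iv_inv_par].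
exact: etrans (iv_inv_mul cgr _ _) (congr2 (fmul c) (iv_inv_par _ _) (iv_inv_par _ _)).
Qed.

Lemma sum_pick (U : lmodType K) (p : bool) (f : bool -> U) :
  \sum_(e : bool) (p == e)%:R *: f e = f p.
Proof. by rewrite big_bool; case: p; rewrite /= scale1r scale0r ?addr0 ?add0r. Qed.

(** The sums over parities become sign automorphisms, the sums over Sweedler
    components become the derivatives of xi along u' and of eta along u, and the
    result is [fmul_double] up to the comparison of signs. *)
Lemma mul_image_ev xi eta v v' :
  mul_image xi eta (ev K v) (ev K v') =
  fmul cT (star_kappa xi (ev K v)) (star_kappa eta (ev K v')).
Proof.
transitivity (\sum_(s <- sweedler xi) \sum_(t <- sweedler eta)
   \sum_(p <- [seq (u, u') | u <- words V (size v), u' <- words V (size v')])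
    (iv s.1 p.2 * iv t.2 p.1 * sg (wpar p.2 && (wpar p.1 (+) wpar v))) *:
     insm2 v v' p.1 p.2 (fmul c (tw (wpar p.2) (iv s.2)) (tw (wpar p.2 (+) wpar v) (iv t.1)))).
  rewrite mul_imageE; apply: eq_bigr => s _; apply: eq_bigr => t _.
  transitivity (\sum_(a1 : bool) \sum_(a2 : bool) \sum_(b1 : bool) \sum_(b2 : bool)
    \sum_(p <- [seq (u, u') | u <- words V (size v), u' <- words V (size v')])
     (sg (a1 && (wpar p.1 (+) wpar v)) * (sg (a1 && a2) * sg ((a1 (+) wpar v) && b1)) *
      ((wpar p.1 == b2)%:R * iv t.2 p.1 * ((wpar p.2 == a1)%:R * iv s.1 p.2))) *:
       insm2 v v' p.1 p.2 (fmul c (proj a2 (iv s.2)) (proj b1 (iv t.1)))).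
    apply: eq_bigr => a1 _; apply: eq_bigr => a2 _; apply: eq_bigr => b1 _.
    apply: eq_bigr => b2 _.
    under eq_bigr do rewrite star_kappa_term scalerA [_ * (_ == _)%:R]mulrC -scalerA.
    rewrite sum_pick scaler_sumr big_allpairs_dep; apply: eq_bigr => u _.
    rewrite scaler_sumr; apply: eq_bigr => u' _ /=.
    rewrite scalerA; congr (_ *: _).
    rewrite /proj; have [E|_] := eqVneq (wpar u) b2; last by rewrite !(mul0r, mulr0).
    congr (_ * _); rewrite -signr_odd -/(sg _) !sgM E; congr sg.
    by rewrite !oddD !oddM !oddD !oddb; case: a1 a2 b1 b2 (wpar v) {E} => [] [] [] [] [].
  under eq_bigr do under eq_bigr do under eq_bigr do rewrite exchange_big.
  under eq_bigr do under eq_bigr do rewrite exchange_big.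
  under eq_bigr do rewrite exchange_big.
  rewrite exchange_big; apply: eq_bigr => -[u u'] _ /=.
  transitivity (\sum_(a1 : bool) (wpar u' == a1)%:R *: (\sum_(a2 : bool) \sum_(b1 : bool)
      (sg (a1 && (wpar u (+) wpar v)) * (sg (a1 && a2) * sg ((a1 (+) wpar v) && b1)) *
      (iv t.2 u * iv s.1 u')) *:
       insm2 v v' u u' (fmul c (proj a2 (iv s.2)) (proj b1 (iv t.1))))).
    apply: eq_bigr => a1 _; rewrite scaler_sumr; apply: eq_bigr => a2 _.
    rewrite scaler_sumr; apply: eq_bigr => b1 _.
    set Z := RHS; apply: etrans (sum_pick (wpar u) (fun=> Z)).
    rewrite /Z; apply: eq_bigr => b2 _.
    by rewrite !scalerA; congr (_ *: _); ring.
  rewrite sum_pick -!sum_sg_proj fmull_sum insm2_sum scaler_sumr; apply: eq_bigr => a2 _.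
  rewrite fmulr_sum insm2_sum scaler_sumr; apply: eq_bigr => b1 _.
  by rewrite !fmulL !insm2Z !scalerA; congr (_ *: _); ring.
under eq_bigr do rewrite exchange_big.
rewrite exchange_big /star_kappa !psi_ev // !finjZ !fshufrZ !fmulL.
rewrite !(finj_nw K (@irK V) (@rgtK V) (@ir_par V)) fmul_double; try exact: sinv_iv; last exact: cgr.
rewrite big_allpairs_dep /= !scaler_sumr; apply: eq_bigr => u _.
rewrite !scaler_sumr; apply: eq_bigr => u' _.
(* Contraction takes place in the first factor for xi; for eta it is in the
   second one, which [sinv_catC] moves to the front. *)
have E1 : derw u' (iv xi) = \sum_(s <- sweedler xi) iv s.1 u' *: iv s.2.
  by apply: funext => z; rewrite fn_sum; apply/esym; exact: sum_sweedler.
have E2 : tw (wpar u) (derw u (iv eta)) = \sum_(t <- sweedler eta) iv t.2 u *: iv t.1.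
  apply: funext => z; rewrite fn_sum /tw /derw -(sinv_catC _ _ (sinv_iv eta)).
  apply: etrans (esym (sum_sweedler charK eta z u)) _.
  by apply: eq_bigr => t _; rewrite fnZ mulrC.
transitivity (sg (wpar u' && (wpar u (+) wpar v)) *: insm2 v v' u u' (fmul c
   (tw (wpar u') (derw u' (iv xi)))
   (tw (wpar u' (+) wpar v) (tw (wpar u) (derw u (iv eta)))))).
  rewrite E1 E2 tw_sum fmull_sum insm2_sum scaler_sumr; apply: eq_bigr => s _.
  rewrite tw_sum fmulr_sum insm2_sum scaler_sumr; apply: eq_bigr => t _.
  by rewrite !twZ !fmulL !insm2Z !scalerA; congr (_ *: _); ring.
rewrite /insm2 tw_fmul // !twK !scalerA !sgM.
congr (sg _ *: insm _ _ _ (insm _ _ _ (linj (fmul c (tw _ _) (tw _ _))))).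
- by case: (wpar u' && _) (eps v) (eps v') (br v u) (br u' v') => [] [] [] [] [].
- by case: (wpar u) (wpar v) (wpar u') (wpar v') => [] [] [] [].
- by case: (wpar u) (wpar v) (wpar u') (wpar v') => [] [] [] [].
Qed.

Lemma PhiK_mul_pure xi eta x y :
  PhiK (turner_mul_pure c xi x eta y) = fmul cT (star_kappa xi x) (star_kappa eta y).
Proof.
rewrite -/(mul_image xi eta x y).
have phi0 (t : invar) : star_kappa t 0 = 0 by rewrite /star_kappa (linear0 (@psi K V)) finj0 fshufr0.
elim/(@gdual_ind K V charK): x => [|a v x IH].
  rewrite phi0 fmull0; apply: (lin0 (f := fun x => mul_image xi eta x y)) => b x x'.
  exact: mul_image_linl.
rewrite mul_image_linl star_kappa_linr !fmulL IH; congr (_ *: _ + _).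
elim/(@gdual_ind K V charK): y {IH} => [|b w y IHy].
  rewrite phi0 fmulr0; apply: (lin0 (f := mul_image xi eta (ev K v))) => b y y'.
  exact: mul_image_linr.
by rewrite mul_image_linr star_kappa_linr !fmulL IHy mul_image_ev.
Qed.

Lemma PhiK_mul F G : PhiK (turner_mul c F G) = fmul cT (PhiK F) (PhiK G).
Proof.
rewrite /turner_mul /mlin2 (mlin_lin _ _ PhiK_is_linear).
rewrite -[PhiK F]/(mlin _ (repr F)).
rewrite (mlin_lin (phi := fun s => fmul cT s (PhiK G))); last exact: fmul_on_is_linear.
apply: eq_mlin => p; rewrite (mlin_lin _ _ PhiK_is_linear).
rewrite -[PhiK G]/(mlin _ (repr G)).
rewrite (mlin_lin (phi := fmul cT _)); last exact: fmul_is_linear.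
by apply: eq_mlin => q; exact: PhiK_mul_pure.
Qed.

End TurnerMap.

(** * Injectivity over the field of fractions *)

Section Split.
Variables (R : comNzRingType) (V : sspace).
Local Notation T := (ssum V (sdual V)).
Local Notation linj := (finj (R := R) (@lft V)).
Local Notation rinj := (finj (R := R) (@rgt V)).

(** A word with the letters of X first occurs in exactly one shuffle of a word
    of X and a word of X^*, without a sign. *)
Lemma fshuf_split (s t : fn R V) (u v : seq V) :
  fshuf (linj s) (rinj t) (map (@il V) u ++ map (@ir V) v) = s u * t v.
Proof.
elim: u s => [|i u IH] s /=.
  elim: v s t => [|k v IH] s t //=.
  have -> : der (ir k) (linj s) = 0 by apply: funext.
  rewrite fshufl0 add0r tw_linj.
  have -> : der (ir k) (rinj t) = rinj (der k t) by apply: funext.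
  by rewrite IH /tw wpar_nil andbF /sg mul1r.
have -> : der (il i) (linj s) = linj (der i s) by apply: funext.
have -> : der (il i) (rinj t) = 0 by apply: funext.
by rewrite fshufr0 addr0 IH.
Qed.

End Split.

Section Injective.
Variables (K : fieldType) (V : sspace).
Hypothesis charK : [pchar K] =i pred0.
Local Notation invar := (invar K V).
Local Notation turner := (turner K V).

Lemma tpure_linl a (xi eta : invar) (x : gdual K V) :
  tpure (a *: xi + eta) x = a *: tpure xi x + tpure eta x.
Proof. by apply/pi_lquot_rel/mem_lspan; exact: BilinL. Qed.
Lemma tpure_linr a (xi : invar) (x y : gdual K V) :
  tpure xi (a *: x + y) = a *: tpure xi x + tpure xi y.
Proof. by apply/pi_lquot_rel/mem_lspan; exact: BilinR. Qed.

Lemma turner_span (F : turner) :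
  exists r : seq (invar * seq V), F = \sum_(q <- r) tpure q.1 (ev K q.2).
Proof.
have [l ->] := lquot_sum F; elim: l => [|[a [xi x]] l [r IH]].
  by exists [::]; rewrite !big_nil.
have [n xE] := gdual_span charK x.
exists ([seq ((a * ((x (inorm K w) : K) / (size w)`!%:R)) *: xi, w)
   | w <- words_upto V n] ++ r).
rewrite big_cons big_cat big_map -IH; congr (_ + _).
transitivity (a *: tpure xi x); first by [].
have := congr1 (fun y => a *: tpure xi y) xE => /= ->.
rewrite (lin_sum (f := tpure xi)); last by move=> b y z; exact: tpure_linr.
rewrite scaler_sumr; apply: eq_bigr => w _; rewrite scalerA.
have L b (y z : invar) : tpure (b *: y + z) (ev K w) = b *: tpure y (ev K w) + tpure z (ev K w).
  exact: tpure_linl.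
by have := L (a * ((x (inorm K w) : K) / (size w)`!%:R)) xi 0;
  rewrite addr0 (lin0 (f := fun xi => tpure xi (ev K w)) L) addr0.
Qed.

(** The Euler identity for functionals, using the symmetry of the norm
    matrix. *)
Lemma ev_norm n v : (size v < n)%N ->
  ev K v = (size v)`!%:R^-1 *: \sum_(w <- words_upto V n) (nw K v w : K) *: ev K w.
Proof.
move=> vn; apply: gdual_ext => xi; rewrite gdual_scaleE gdual_sumE evE.
transitivity ((size v)`!%:R^-1 * (\sum_(w <- words V (size v)) iv xi w *: nw K w) v).
  rewrite euler_words; last exact: sinv_iv.
  by rewrite fnZ /cut eqxx mul1r mulrA mulVf ?mul1r //; exact: fact_neq0.
congr (_ * _); rewrite fn_sum big_words_upto.
rewrite [RHS](bigD1_seq (size v)) ?mem_index_iota ?iota_uniq //= [X in _ + X]big1 ?addr0.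
  by apply: eq_bigr => w _; rewrite fnZ -[nw K v w]nw_sym mulrC.
move=> d dv; rewrite big_seq big1 // => w; rewrite mem_words => /eqP wd.
by rewrite fnZ nw_size ?mul0r // wd eq_sym.
Qed.

Lemma sg_eps_nw (v w : seq V) : sg (eps w) * nw K v w = sg (eps v) * nw K v w :> K.
Proof. by rewrite -[LHS]/(eps_tw (nw K v) w) eps_tw_nw. Qed.

(** Write F as a sum of tensors xi_q (x) ev v_q.  By [fshuf_split], the vanishing
    of the coefficients at the words u v gives sum_q N(v_q)(v) xi_q = 0 for every
    v, and by [ev_norm] F is a combination of these sums tensored with ev v. *)
Lemma PhiK_inj0 (F : turner) : PhiK F = 0 -> F = 0.
Proof.
have [r ->] := turner_span F => h.
have Z (v : seq V) : \sum_(q <- r) (nw K q.2 v : K) *: q.1 = 0.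
  apply: iv_inj; apply: funext => u.
  have iv0 : iv (0 : invar) = 0 by exact: cf0.
  rewrite iv0 iv_sum fn_sum.
  have := congr1 (fun s => sg (eps v) * s (map (@il V) u ++ map (@ir V) v)) h.
  rewrite /= mulr0 PhiK_sum fn_sum mulr_sumr => E; rewrite -[RHS]E.
  apply: eq_bigr => q _; rewrite PhiK_pure /star_kappa psi_ev // fshuf_split !fnZ ivZ fnZ.
  rewrite -(sg_eps_nw q.2 v).
  transitivity ((sg (eps v) * sg (eps v)) * (nw K q.2 v * iv q.1 u) : K); last by ring.
  by rewrite sgK mul1r.
pose n := (\max_(q <- r) size q.2).+1.
have qn q : q \in r -> (size q.2 < n)%N.
  by move=> qr; rewrite /n ltnS; exact: (@leq_bigmax_seq _ _ xpredT (fun q => size q.2)).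
transitivity (\sum_(q <- r) \sum_(w <- words_upto V n)
   ((nw K q.2 w : K) / (size w)`!%:R) *: tpure q.1 (ev K w)).
  rewrite big_seq [RHS]big_seq; apply: eq_bigr => q /qn qnq.
  rewrite {1}(ev_norm qnq) scaler_sumr; under eq_bigr do rewrite scalerA.
  rewrite (lin_sum (f := tpure q.1)); last by move=> a x y; exact: tpure_linr.
  apply: eq_bigr => w _; apply: (congr1 (fun a : K => a *: tpure q.1 (ev K w))).
  have [e|ne] := eqVneq (size q.2) (size w); first by rewrite e mulrC.
  by rewrite nw_size // mulr0 mul0r.
rewrite exchange_big big1 // => w _.
transitivity ((size w)`!%:R^-1 *: tpure (\sum_(q <- r) (nw K q.2 w : K) *: q.1) (ev K w)).
  rewrite (lin_sum (f := fun xi => tpure xi (ev K w))); last first.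
    by move=> a x y; exact: tpure_linl.
  by rewrite scaler_sumr; apply: eq_bigr => q _; rewrite scalerA mulrC.
rewrite Z (lin0 (f := fun xi => tpure xi (ev K w))) ?scaler0 // => a x y.
exact: tpure_linl.
Qed.

Lemma PhiK_inj : injective (@PhiK K V).
Proof.
move=> F G e; apply/eqP; rewrite -subr_eq0; apply/eqP; apply: PhiK_inj0.
by rewrite -scaleN1r PhiKD PhiKZ e scaleN1r subrr.
Qed.

End Injective.

(** * Symmetric superalgebras and norms *)

Section Norm.
Variables (R : comNzRingType) (V : sspace).
Implicit Types (s t : fn R V) (i j k : V) (u v w z : seq V) (f g : talg R V).

(** Inserting two letters in the other order costs their sign, so norms only
    depend on the class of a word in Sym. *)
Lemma fins_comm i j s :
  fins i (fins j s) = sg (spar i && spar j) *: fins j (fins i s).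
Proof.
apply: funext => z; elim: z s => [|k z IH] s; first by rewrite fnZ /= mulr0.
rewrite fnZ -[LHS]/(der k _ z) -[X in _ * X]/(der k _ z) !der_fins.
rewrite !(finsL, fnD, fnZ) IH fnZ !mulrDr.
have E a (b : V) (x : R) : (k == a)%:R * x = sg (spar a && spar b) * (sg (spar b && spar k) * ((k == a)%:R * x)).
  by case: eqP => [->|_]; rewrite ?mul0r ?mulr0 // mul1r andbC mulrA sgK mul1r.
move: (fins j s z) (fins i s z) (fins j (fins i (der k s)) z) => p q r.
rewrite [in LHS](E i j p) [in RHS](E j i q) [spar j && spar i]andbC.
have F : sg (spar i && spar j) * sg (spar i && spar j) = 1 :> R by exact: sgK.
move: (sg (spar i && spar j)) F (sg (spar i && spar k)) (sg (spar j && spar k)) => a aa b d.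
move: (k == i)%:R (k == j)%:R => e f.
transitivity (a * (d * (e * p)) + (a * a) * (b * (f * q)) + a * (b * (d * r)) : R).
  by rewrite aa; ring.
by ring.
Qed.

(** The algebra morphism from the tensor algebra to the shuffle algebra which
    is the identity on vectors; it descends to kappa. *)
Definition wnorm f : fn R V := mlin (@nw R V) f.
Lemma wnormD f g : wnorm (f + g) = wnorm f + wnorm g. Proof. exact: mlinD. Qed.
Lemma wnormZ a f : wnorm (a *: f) = a *: wnorm f. Proof. exact: mlinZ. Qed.
Lemma wnormU w : wnorm << w >> = nw R w. Proof. exact: mlinU. Qed.
Lemma wnorm_linear : linear wnorm. Proof. exact: mlin_is_linear. Qed.

Lemma wnorm_concat f g : wnorm (tconcat f g) = fshuf (wnorm f) (wnorm g).
Proof.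
rewrite /tconcat /mlin2 (mlin_lin _ _ wnorm_linear).
rewrite [wnorm f]/wnorm (mlin_lin (phi := fun s => fshuf s (wnorm g))); last exact: fshuf_on_is_linear.
apply: eq_mlin => w; rewrite (mlin_lin _ _ wnorm_linear).
rewrite [wnorm g]/wnorm (mlin_lin (phi := fshuf _)); last exact: fshuf_is_linear.
by apply: eq_mlin => w'; rewrite wnormU nw_cat.
Qed.

Lemma wnorm_words d f : (forall z, size z != d -> cf f z = 0) ->
  wnorm f = \sum_(w <- words V d) cf f w *: nw R w.
Proof.
move=> h; rewrite /wnorm /mlin.
rewrite [RHS](bigID (fun w => w \in msupp f)) /= [X in _ = _ + X]big1 ?addr0 => [|w wf]; last first.
  by rewrite /cf (mcoeff_outdom wf) scale0r.
rewrite -[RHS]big_filter; apply: perm_big; apply: uniq_perm; first exact: fset_uniq.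
  by rewrite filter_uniq // uniq_words.
move=> w; rewrite mem_filter mem_words; apply/idP/andP => [wf|[]//]; split=> //.
apply/negPn/negP => ne; move: wf; rewrite -mcoeff_neq0 => /negP; apply.
by apply/eqP; exact: h.
Qed.

(** In particular the norm of the tensor power of v is m! times it, so that
    kappa(v^(m)) has no denominator. *)
Lemma wnorm_sinv d f : (forall z, size z != d -> cf f z = 0) -> sinv (cf f) ->
  wnorm f = d`!%:R *: cf f.
Proof.
move=> h hs; rewrite (wnorm_words h) euler_words //; congr (_ *: _).
apply: funext => z; rewrite /cut; case: eqP => [_|/eqP /h ->]; first by rewrite mul1r.
by rewrite mulr0.
Qed.

Lemma cf_tact2 f z : cf (tact (tperm ord0 ord_max : 'S_2) f) z =
  if z is [:: j; i] then sg (spar i && spar j) * cf f [:: i; j] else 0.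
Proof.
have [sz|ne] := eqVneq (size z) 2; last first.
  rewrite /cf coef_tact_size //.
  by case: z ne => [|j [|i [|]]].
case: z sz => [|j [|i [|]]] // _.
pose w : 2.-tuple V := [tuple i; j].
have e2 : enum 'I_2 = [:: ord0; ord_max].
  by apply: (inj_map val_inj); rewrite val_enum_ord.
have kE : keyed (tperm ord0 ord_max : 'S_2) w = [:: (1%N, j); (0%N, i)].
  by rewrite /keyed e2 /= tpermL tpermR !(tnth_nth i).
have := tactE (tperm ord0 ord_max : 'S_2) f w; rewrite kE /= /cf => ->.
by rewrite !(big_cons, big_nil) /= !addbF andbC.
Qed.

End Norm.

Section Sym.
Variables (K : fieldType) (V : sspace).
Hypothesis charK : [pchar K] =i pred0.
Implicit Types (s t : fn K V) (i j k : V) (u v w z : seq V) (f g : talg K V) (x y : symalg K V).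

Lemma wnorm_tvec2 (a b : vect K V) :
  wnorm (tconcat (tvec a) (tvec b)) = \sum_i \sum_j (a i * b j) *: nw K [:: i; j].
Proof.
have E (a' : vect K V) : wnorm (tvec a') = \sum_i a' i *: nw K [:: i].
  rewrite /tvec /wnorm mlin_sum; apply: eq_bigr => i _.
  by rewrite malgUZ mlinZ mlinU.
rewrite wnorm_concat !E fshufl_sum; apply: eq_bigr => i _.
rewrite fshufr_sum; apply: eq_bigr => j _.
by rewrite fshuflL fshufrL scalerA -nw_cat.
Qed.

Lemma wnorm_tact2 (a b : vect K V) :
  wnorm (tact (tperm ord0 ord_max : 'S_2) (tconcat (tvec a) (tvec b))) =
  wnorm (tconcat (tvec a) (tvec b)).
Proof.
set f := tconcat _ _.
have hf z : cf f z = if z is [:: i; j] then a i * b j else 0.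
  rewrite cf_tvec_concat; case: z => [|i [|j [|k z]]] //=.
  - by rewrite cf_tvec_nil mulr0.
  - by rewrite cf_tvec /ew eqxx mulr1.
  - by rewrite cf_tvec /ew mulr0 mulr0.
have h2 z : size z != 2 -> cf f z = 0.
  by rewrite hf; case: z => [|i [|j [|k z]]].
have h2' z : size z != 2 -> cf (tact (tperm ord0 ord_max : 'S_2) f) z = 0.
  by rewrite cf_tact2; case: z => [|i [|j [|k z]]].
have W2 (F : seq V -> fn K V) : \sum_(w <- words V 2) F w = \sum_i \sum_j F [:: i; j].
  by rewrite big_words; apply: eq_bigr => i _; rewrite big_words;
     apply: eq_bigr => j _; rewrite big_seq1.
rewrite (wnorm_words h2) (wnorm_words h2') !W2 exchange_big.
apply: eq_bigr => i _; apply: eq_bigr => j _; rewrite cf_tact2 !hf.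
rewrite [nw K [:: j; i]]fins_comm scalerA; congr (_ *: _).
by rewrite mulrAC [spar i && _]andbC sgK mul1r.
Qed.

Lemma two_neq0 : (2%:R : K) != 0.
Proof. by have /pcharf0P -> := charK. Qed.

(** The norm of v (x) v equals its opposite; it vanishes because 2 is
    invertible. *)
Lemma wnorm_odd2 (v : vect K V) : homog v true ->
  wnorm (tconcat (tvec v) (tvec v)) = 0.
Proof.
move=> hv; rewrite wnorm_tvec2; set A := \sum_i _.
have AN : A = - A.
  rewrite {1}/A exchange_big /A -sumrN; apply: eq_bigr => i _.
  rewrite -sumrN; apply: eq_bigr => j _; rewrite -scaleNr.
  have [->|vi] := eqVneq (v i) 0; first by rewrite mul0r mulr0 oppr0 !scale0r.
  have [->|vj] := eqVneq (v j) 0; first by rewrite mul0r mulr0 oppr0 !scale0r.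
  rewrite [nw K [:: j; i]]fins_comm (hv _ vi) (hv _ vj) scalerA mulrC.
  by congr (_ *: _); rewrite /sg expr1 [v j * _]mulrC mulN1r.
apply: funext => z; have := congr1 (fun s => s z) AN => /= /eqP.
rewrite -subr_eq0 opprK -[A z]/(A z) -mulr2n -mulr_natl mulf_eq0 (negPf two_neq0) /=.
by move/eqP.
Qed.

Lemma wnorm_sym_ideal f : sym_ideal f -> mlin (@nw K V) f = 0.
Proof.
case=> s r t hr; rewrite -/(wnorm _) !wnorm_concat.
suff -> : wnorm r = 0 by rewrite fshufl0 fshufr0.
case: hr => [a b|v hv]; last exact: wnorm_odd2.
by rewrite -scaleN1r wnormD wnormZ wnorm_tact2 scaleN1r subrr.
Qed.

(** The isomorphism kappa over K, on coefficients. *)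
Definition kappaK x : fn K V := wnorm (repr x).

Lemma kappaK_class f : kappaK (sym_class f) = wnorm f.
Proof. exact: (mlin_repr wnorm_sym_ideal). Qed.
Lemma kappaK_linear : linear kappaK.
Proof. by move=> a x y; rewrite [a *: x + y]lquot_lin [LHS]kappaK_class wnormD wnormZ. Qed.
Lemma kappaKD x y : kappaK (x + y) = kappaK x + kappaK y.
Proof. by have := kappaK_linear 1 x y; rewrite !scale1r. Qed.
Lemma kappaK0 : kappaK 0 = 0.
Proof. by apply: (addIr (kappaK 0)); rewrite -kappaKD !add0r. Qed.
Lemma kappaKZ a x : kappaK (a *: x) = a *: kappaK x.
Proof. by have := kappaK_linear a x 0; rewrite kappaK0 !addr0. Qed.
Lemma kappaK_mul x y : kappaK (sym_mul x y) = fshuf (kappaK x) (kappaK y).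
Proof. by rewrite /sym_mul kappaK_class wnorm_concat. Qed.

Lemma sym_swap u k i z :
  sym_class (<< u ++ k :: i :: z >> : talg K V) =
  sg (spar i && spar k) *: sym_class (<< u ++ i :: k :: z >> : talg K V).
Proof.
rewrite -[RHS]addr0 -[X in _ = _ + X](pi_lquot0 (@sym_ideal K V)).
apply: pi_lquot_rel; apply: mem_lspan; rewrite subr0.
have te l : tvec (bvec K l) = << [:: l] >> by apply: cf_inj; rewrite cfU cf_tvec_bvec.
have := @SymIdeal K V << u >> _ << z >> (SymComm (bvec K k) (bvec K i)).
rewrite !te tconcatUU.
have -> : tact (tperm ord0 ord_max : 'S_2) (<< [:: k] ++ [:: i] >> : talg K V) =
    sg (spar i && spar k) *: << [:: i; k] >>.
  apply: cf_inj; rewrite cfZ cfU; apply: funext => w; rewrite cf_tact2 fnZ cfU /ew.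
  case: w => [|a [|b [|d w]]]; rewrite ?mulr0 // ?eqseq_cons ?andbF ?mulr0 //.
  rewrite !andbT; case: (a =P i) => [->|_]; case: (b =P k) => [->|_];
    by rewrite ?andbF /= ?mulr0 // andbC.
have -> : tconcat (<< [:: k] ++ [:: i] >> - sg (spar i && spar k) *: << [:: i; k] >>) << z >> =
   << [:: k, i & z] >> - sg (spar i && spar k) *: << [:: i, k & z] >> :> talg K V.
  rewrite -[LHS]/(tconcat_on << z >> _) linearB /= /tconcat_on tconcatZl.
  by rewrite !tconcatUU.
rewrite linearB /= tconcatZr !tconcatUU.
exact.
Qed.

(** Wherever i is inserted into v, the class in Sym is that of i v, the sign of
    the insertion being compensated by [sym_swap]. *)
Lemma sum_fins_class d u i s :
  \sum_(v <- words V d.+1) (fins i s v : K) *: sym_class (<< u ++ v >> : talg K V) =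
  d.+1%:R *: \sum_(v <- words V d) (s v : K) *: sym_class (<< u ++ i :: v >> : talg K V).
Proof.
elim: d u s => [|d IH] u s.
  rewrite big_words /= scale1r; under eq_bigr do rewrite big_seq1.
  rewrite big_seq1 (bigD1 i) //= big1 ?addr0.
    by rewrite eqxx mul1r mulr0 addr0.
  by move=> k /negPf ki; rewrite ki mul0r mulr0 addr0 scale0r.
rewrite big_words.
transitivity (\sum_(v <- words V d.+1) (s v : K) *: sym_class (<< u ++ i :: v >> : talg K V) +
  \sum_k sg (spar i && spar k) *: \sum_(v <- words V d.+1)
     (fins i (der k s) v : K) *: sym_class (<< rcons u k ++ v >> : talg K V)).
  transitivity (\sum_k (k == i)%:R *: (\sum_(v <- words V d.+1) (s v : K) *: sym_class (<< u ++ i :: v >> : talg K V))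
    + \sum_k sg (spar i && spar k) *: \sum_(v <- words V d.+1)
     (fins i (der k s) v : K) *: sym_class (<< rcons u k ++ v >> : talg K V)).
    rewrite -big_split; apply: eq_bigr => k _ /=.
    rewrite !scaler_sumr -big_split; apply: eq_bigr => v _ /=.
    rewrite scalerDl cat_rcons !scalerA; congr (_ + _).
    by case: eqP => [->|]; rewrite ?mul0r ?scale0r.
  congr (_ + _); rewrite (bigD1 i) //= eqxx scale1r [X in _ + X]big1 ?addr0 // => k /negPf ->.
  by rewrite scale0r.
rewrite -[d.+2%:R]natr1 scalerDl scale1r addrC; congr (_ + _).
under eq_bigr do rewrite IH scalerA.
rewrite big_words scaler_sumr; apply: eq_bigr => k _.
rewrite mulrC -scalerA; congr (_ *: _).
rewrite scaler_sumr; apply: eq_bigr => v _.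
rewrite scalerA cat_rcons sym_swap scalerA mulrAC sgK mul1r.
by [].
Qed.

(** All rearrangements of w in N(w) have the class of w: the class map and the
    norm are inverse to each other up to |w|!. *)
Lemma sum_nw_class u w :
  \sum_(v <- words V (size w)) (nw K w v : K) *: sym_class (<< u ++ v >> : talg K V) =
  (size w)`!%:R *: sym_class (<< u ++ w >> : talg K V).
Proof.
elim: w u => [|i w IH] u; first by rewrite /= big_seq1 /nw /= /ew eqxx.
rewrite -[size _]/(size w).+1 -[nw K (i :: w)]/(fins i (nw K w)) sum_fins_class.
under eq_bigr do rewrite -cat_rcons.
by rewrite IH cat_rcons scalerA -natrM.
Qed.

(** By [sum_nw_class], the class of a tensor is recovered from the coefficients
    of its norm. *)
Lemma kappaK_inj0 x : kappaK x = 0 -> x = 0.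
Proof.
have [r ->] := lquot_sum x => h.
pose cl w : symalg K V := sym_class (<< w >> : talg K V).
have Z (v : seq V) : \sum_(q <- r) q.1 * (nw K q.2 v : K) = 0.
  have := congr1 (fun s => s v) h => /=.
  rewrite (big_morph kappaK kappaKD kappaK0) fn_sum => E.
  apply: etrans E; apply: eq_bigr => q _.
  by rewrite kappaKZ fnZ kappaK_class wnormU.
pose n := (\max_(q <- r) size q.2).+1.
have qn q : q \in r -> (size q.2 < n)%N.
  by move=> qr; rewrite /n ltnS; exact: (@leq_bigmax_seq _ _ xpredT (fun q => size q.2)).
transitivity (\sum_(q <- r) \sum_(w <- words_upto V n)
   (q.1 * (nw K q.2 w : K) / (size w)`!%:R) *: cl w).
  rewrite big_seq [RHS]big_seq; apply: eq_bigr => q /qn qnq.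
  transitivity (q.1 *: ((size q.2)`!%:R^-1 *: ((size q.2)`!%:R *: cl q.2))).
    by congr (_ *: _); rewrite scalerA mulVf ?scale1r //; exact: fact_neq0.
  rewrite -(sum_nw_class [::]) big_words_upto [RHS](bigD1_seq (size q.2)) ?mem_index_iota ?iota_uniq //=.
  rewrite [X in _ + X]big1 ?addr0.
    rewrite !scaler_sumr big_seq [RHS]big_seq; apply: eq_bigr => w.
    rewrite mem_words => /eqP ->; rewrite !scalerA; congr (_ *: _).
    by rewrite mulrAC.
  move=> d dq; rewrite big_seq big1 // => w; rewrite mem_words => /eqP wd.
  by rewrite nw_size ?mulr0 ?mul0r ?scale0r // wd eq_sym.
rewrite exchange_big big1 // => w _.
by rewrite -scaler_suml -mulr_suml Z mul0r scale0r.
Qed.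

Lemma kappaK_inj : injective kappaK.
Proof.
move=> x y e; apply/eqP; rewrite -subr_eq0; apply/eqP; apply: kappaK_inj0.
by rewrite -scaleN1r kappaKD kappaKZ e scaleN1r subrr.
Qed.

Lemma gdual_oneE : gdual_one K V = ev K [::].
Proof. exact: to_gdualE. Qed.
Lemma gdual_natE i : gdual_nat K i = ev K [:: i].
Proof. exact: to_gdualE. Qed.

(** The product of the dual vectors of the letters of w in (Inv X)^*. *)
Lemma gdual_word w :
  foldr (@gdual_mul K V) (gdual_one K V) (map (@gdual_nat K V) w) = sg (eps w) *: ev K w.
Proof.
elim: w => [|i w IH]; first by rewrite /= gdual_oneE /sg scale1r.
rewrite [LHS]/= IH gdual_natE -[sg (eps w) *: _]addr0 gdual_mul_linr //.
have -> : gdual_mul (ev K [:: i]) (0 : gdual K V) = 0.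
  by apply: (lin0 (f := gdual_mul (ev K [:: i]))) => a y z; exact: gdual_mul_linr.
rewrite addr0 gdual_mul_ev // scalerA sgM wpar_cons wpar_nil addbF /=.
by rewrite addbC.
Qed.

Lemma psi_sym_gdual x : psi (sym_gdual x) = kappaK x.
Proof.
rewrite /sym_gdual (mlin_lin _ _ (@psi_is_linear K V)); apply: eq_mlin => w.
by rewrite gdual_word psiZ psi_ev // scalerA sgK scale1r.
Qed.

End Sym.

(** * Decomposition of the invariants of a direct sum *)

Section Ext.
Variables (R S : comNzRingType) (f : {rmorphism R -> S}) (V : sspace).
Implicit Types (s t : fn R V).

Definition fn_map (W : sspace) (s : fn R W) : fn S W := fun z => f (s z).

Lemma fn_mapD (W : sspace) (s t : fn R W) : fn_map (s + t) = fn_map s + fn_map t.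
Proof. by apply: funext => z; rewrite /fn_map fnD rmorphD. Qed.
Lemma fn_mapZ (W : sspace) a (s : fn R W) : fn_map (a *: s) = f a *: fn_map s.
Proof. by apply: funext => z; rewrite /fn_map !fnZ rmorphM. Qed.
Lemma fn_map0 (W : sspace) : fn_map (0 : fn R W) = 0.
Proof. by apply: funext => z; rewrite /fn_map rmorph0. Qed.
Lemma fn_map_sum (W : sspace) (I : Type) (r : seq I) (P : pred I) (F : I -> fn R W) :
  fn_map (\sum_(i <- r | P i) F i) = \sum_(i <- r | P i) fn_map (F i).
Proof. exact: (big_morph _ (@fn_mapD W) (@fn_map0 W)). Qed.
Lemma rmorph_sg b : f (sg b) = sg b. Proof. exact: rmorph_sign. Qed.

Lemma fn_map_tw (W : sspace) b (s : fn R W) : fn_map (tw b s) = tw b (fn_map s).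
Proof. by apply: funext => z; rewrite /fn_map /tw rmorphM rmorph_sg. Qed.

Lemma fn_map_ew (W : sspace) (w : seq W) : fn_map (ew R w) = ew S w.
Proof. by apply: funext => z; rewrite /fn_map /ew rmorph_nat. Qed.

Lemma fn_map_fshuf (W : sspace) (s t : fn R W) : fn_map (fshuf s t) = fshuf (fn_map s) (fn_map t).
Proof.
apply: funext => z; elim: z s t => [|k z IH] s t; first by rewrite /fn_map /= rmorphM.
rewrite [LHS](_ : _ = fn_map (fshuf (der k s) t) z + fn_map (fshuf (tw (spar k) s) (der k t)) z).
  by rewrite !IH fn_map_tw.
by rewrite /fn_map /= rmorphD.
Qed.

Lemma fn_map_fmul (W : sspace) (c : sconst R W) (s t : fn R W) :
  fn_map (fmul c s t) = fmul (scalar_ext f c) (fn_map s) (fn_map t).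
Proof.
apply: funext => z; elim: z s t => [|k z IH] s t; first by rewrite /fn_map /= rmorphM.
rewrite [LHS]rmorph_sum; apply: eq_bigr => i _.
rewrite rmorph_sum; apply: eq_bigr => j _; rewrite rmorphM ffunE; congr (_ * _).
by rewrite -[LHS]/(fn_map _ z) IH fn_map_tw.
Qed.

Lemma fn_map_finj (W : sspace) (h : W -> option V) s : fn_map (finj h s) = finj h (fn_map s).
Proof.
apply: funext => z; elim: z s => [|k z IH] s //.
rewrite /fn_map /=; case: (h k) => [i|]; last exact: rmorph0.
by rewrite -IH.
Qed.

Lemma sinv_fn_map (W : sspace) (s : fn R W) : sinv s -> sinv (fn_map s).
Proof. by move=> h w i j z; rewrite /fn_map h rmorphM rmorph_sg. Qed.

Lemma fn_map_inj (W : sspace) : injective f -> injective (@fn_map W).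
Proof.
by move=> fi s t e; apply: funext => z; apply: fi; exact: (congr1 (fun u : fn S W => u z) e).
Qed.

End Ext.

Section Basis.
Variables (R : comNzRingType) (V : sspace).
Implicit Types (s t : fn R V) (i j k : V) (u v w z r : seq V) (m : V -> nat).

(** The sorted word with the multiplicities m, for the order of the letters
    given by r. *)
Definition mon_word m r : seq V := flatten [seq nseq (m i) i | i <- r].
(** The shuffle product of the tensor powers of the letters, which is the image
    under kappa of the product of their divided powers. *)
Definition mon_fn m r : fn R V :=
  foldr (fun i acc => fshuf (ew R (nseq (m i) i)) acc) (ew R [::]) r.

Lemma der_ew_nseq i j n : i != j -> der i (ew R (nseq n j)) = 0.
Proof.
by case: n => [|n] ij; rewrite ?der_ew_nil //= der_ew_cons eq_sym (negPf ij) scale0r.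
Qed.

Lemma der_mon_fn m r i : i \notin r -> der i (mon_fn m r) = 0.
Proof.
elim: r => [|j r IH] /=; first by rewrite der_ew_nil.
rewrite inE negb_or => /andP[ij ir].
by rewrite der_fshuf der_ew_nseq // fshufl0 IH // fshufr0 addr0.
Qed.

Lemma fshuf_ew_out i w t z : i \notin z -> fshuf (ew R (i :: w)) t z = 0.
Proof.
elim: z t => [|k z IH] t; first by rewrite /= mul0r.
rewrite inE negb_or => /andP[ik iz].
rewrite -[LHS]/(der k _ z) der_fshuf der_ew_cons (negPf ik) scale0r fshufl0.
by rewrite fnD add0r tw_ew fshuflZ fnZ IH // mulr0.
Qed.

Lemma fshuf_nseq i (n k : nat) (E : fn R V) z : der i E = 0 -> i \notin z ->
  fshuf (ew R (nseq n i)) E (nseq k i ++ z) = (n == k)%:R * E z.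
Proof.
move=> dE iz; elim: k n => [|k IH] [|n] /=.
- by rewrite ew0_fshuf mul1r.
- by rewrite fshuf_ew_out // mul0r.
- by rewrite der_ew_nil dE fshufl0 fshufr0 fn0 addr0 mul0r.
- by rewrite der_ew_cons eqxx scale1r dE fshufr0 fn0 addr0 IH eqSS.
Qed.

Lemma mon_word_notin m r i : i \notin r -> i \notin mon_word m r.
Proof.
move=> ir; apply/negP => /flatten_mapP[j jr].
by rewrite mem_nseq => /andP[_ /eqP e]; rewrite e jr in ir.
Qed.

(** Sorted words are dual to the monomials: with the blocks of distinct letters
    in the given order there is at most one shuffle, and no signs. *)
Lemma mon_fn_word m m' r : uniq r ->
  mon_fn m r (mon_word m' r) = (all (fun i => m i == m' i) r)%:R.
Proof.
elim: r => [|i r IH] /=; first by rewrite /ew eqxx.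
move=> /andP[ir ur]; rewrite /mon_word /= -/(mon_word m' r) fshuf_nseq ?der_mon_fn ?mon_word_notin // IH //.
by case: (m i == m' i); rewrite ?mul1r ?mul0r.
Qed.

(** Equal odd letters anticommute, which excludes n > 1 for odd i. *)
Lemma sinv_ew_nseq i n : (spar i -> n <= 1)%N -> sinv (ew R (nseq n i)).
Proof.
move=> hi w a b z; rewrite /ew.
have A x y : w ++ x :: y :: z = nseq n i -> [/\ x = i, y = i & (1 < n)%N].
  move=> e; have al : all (pred1 i) (w ++ x :: y :: z) by rewrite e all_pred1_nseq.
  move: al; rewrite all_cat /= => /and4P[_ /eqP -> /eqP -> _]; split=> //.
  by have := congr1 size e; rewrite size_nseq size_cat /=; lia.
case: (w ++ b :: a :: z =P nseq n i) => [e|ne].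
  have [bi ai n1] := A _ _ e; subst a b.
  rewrite e eqxx; case oi: (spar i); last by rewrite /sg mul1r.
  by have := hi oi; lia.
rewrite mulr0; case: eqP => // e.
by have [ai bi n1] := A _ _ e; subst a b.
Qed.

Lemma sinv_mon_fn m r : (forall i, spar i -> m i <= 1)%N -> sinv (mon_fn m r).
Proof.
move=> h; elim: r => [|i r IH] /=; first exact: sinv_ew0.
by apply: sinv_fshuf => //; apply: sinv_ew_nseq; exact: h.
Qed.

Lemma count_mon_word m r i : uniq r -> count_mem i (mon_word m r) = if i \in r then m i else 0%N.
Proof.
elim: r => [//|j r IH] /= /andP[jr ur]; rewrite /mon_word /= -/(mon_word m r) count_cat count_nseq IH //.
rewrite in_cons /= eq_sym; case: eqP => [->|_] /=; last by rewrite mul0n add0n.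
by rewrite (negPf jr) mul1n addn0.
Qed.

Lemma perm_mon_word w : perm_eq w (mon_word (fun i => count_mem i w) (enum V)).
Proof.
by apply/allP => i _; rewrite /= count_mon_word ?enum_uniq // mem_enum.
Qed.

Lemma mon_word_split m i : (1 < m i)%N -> exists a b, mon_word m (enum V) = a ++ i :: i :: b.
Proof.
move=> mi; have : i \in enum V by rewrite mem_enum.
case/splitPr => p1 p2; rewrite /mon_word map_cat flatten_cat /=.
case: (m i) mi => [|[|n]] // _.
by exists (flatten [seq nseq (m i0) i0 | i0 <- p1]), (nseq n i ++ flatten [seq nseq (m i0) i0 | i0 <- p2]).
Qed.

End Basis.

Section Agree.
Variables (R : comNzRingType) (W : sspace).
Implicit Types (s t : fn R W).

Lemma sinv_eq_perm s t w w' : sinv s -> sinv t -> perm_eq w w' -> s w' = t w' -> s w = t w.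
Proof.
move=> hs ht pw e; apply/eqP.
rewrite (perm_eq_swap (G := fun w => s w == t w) (P := fun=> True) _ _ pw) ?e //.
move=> l1 x y l2 _ /=; rewrite hs ht; apply/eqP/eqP => [h|-> //].
by rewrite -[LHS]mul1r -[RHS]mul1r -(sgK R (spar x && spar y)) -!mulrA h.
Qed.

Lemma sinv_odd2 s a i b : (forall x : R, x + x = 0 -> x = 0) -> sinv s -> spar i ->
  s (a ++ i :: i :: b) = 0.
Proof.
move=> h2 hs oi; apply: h2; rewrite {1}hs oi /sg /= expr1 mulN1r.
exact: addNr.
Qed.

End Agree.

Section Surj.
Variables (R : comNzRingType) (V : sspace).
Hypothesis h2 : forall x : R, x + x = 0 -> x = 0.
Local Notation T := (ssum V (sdual V)).
Local Notation linj := (finj (R := R) (@lft V)).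
Local Notation rinj := (finj (R := R) (@rgt V)).
Implicit Types (u v w : seq V).

Definition lr_word u v : seq T := map (@il V) u ++ map (@ir V) v.

Lemma perm_lr_word (w : seq T) : exists u v, perm_eq w (lr_word u v).
Proof.
elim: w => [|[i|i] w [u [v p]]]; first by exists [::], [::].
  by exists (i :: u), v; rewrite /lr_word /= perm_cons.
exists u, (i :: v); rewrite /lr_word /= perm_sym.
rewrite (perm_catCA (map (@il V) u) [:: ir i] (map (@ir V) v)) /= perm_cons.
by rewrite perm_sym.
Qed.

(** Every word of T_X can be rearranged so that the letters of X come first and
    those of X^* are sorted. *)
Lemma sinv_lr_word_eq (s t : fn R T) : sinv s -> sinv t ->
  (forall u m, s (lr_word u (mon_word m (enum V))) = t (lr_word u (mon_word m (enum V)))) -> s = t.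
Proof.
move=> hs ht h; apply: funext => w; have [u [v p]] := perm_lr_word w.
apply: (sinv_eq_perm hs ht p).
apply: (sinv_eq_perm hs ht _ (h u (fun i => count_mem i v))).
by rewrite perm_cat2l; apply: perm_map; exact: perm_mon_word.
Qed.

Variables (N : nat).
(** Exponents of the monomials in divided powers, bounded by the degree N of the
    tensor under consideration; odd vectors occur at most once. *)
Definition adm (m : {ffun V -> 'I_N}) := [forall i, spar i ==> (m i <= 1)%N].
Definition mult (m : {ffun V -> 'I_N}) (i : V) : nat := m i.
(** The coefficient of t, with values in Inv X, at the sorted word of X^*. *)
Definition slice (t : fn R T) (m : V -> nat) : fn R V :=
  fun u => t (lr_word u (mon_word m (enum V))).

Lemma sinv_slice t m : sinv t -> sinv (slice t m).
Proof.
move=> ht w i j z; rewrite /slice /lr_word !map_cat /= -!catA /=.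
exact: (ht (map (@il V) w) (il i) (il j)).
Qed.

(** Both sides are invariant, and by [fshuf_split] and [mon_fn_word] they agree at
    the words u v with v sorted.  A sorted word with multiplicities outside the
    range of the sum has coefficient 0 on both sides: for a repeated odd letter
    by [sinv_odd2], for a large multiplicity by the bound on the degree. *)
Lemma surj_decomp (t : fn R T) : sinv t -> (forall z, (N <= size z)%N -> t z = 0) ->
  t = \sum_(m : {ffun V -> 'I_N} | adm m)
        fshuf (linj (slice t (mult m))) (rinj (mon_fn R (mult m) (enum V))).
Proof.
move=> ht hN; apply: sinv_lr_word_eq => // [|u m].
  apply: sinv_sum => m /forallP am; apply: sinv_fshuf.
    by apply: sinv_linj; exact: sinv_slice.
  apply: (sinv_finj (@rgtK V) (@ir_par V)); apply: sinv_mon_fn => i.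
  by apply/implyP; exact: am.
rewrite fn_sum; under eq_bigr do rewrite fshuf_split mon_fn_word ?enum_uniq //.
have off (m' : {ffun V -> 'I_N}) i (x : R) : m' i != m i :> nat ->
    x * (all (fun i => mult m' i == m i) (enum V))%:R = 0.
  move=> ne; have /allPn/negPf -> : exists2 i, i \in enum V & ~~ (mult m' i == m i).
    by exists i; rewrite ?mem_enum.
  exact: mulr0.
have [/existsP[i /andP[oi mi]]|] := boolP [exists i : V, spar i && (1 < m i)%N].
  have [a [b e]] := mon_word_split mi.
  have z0 : t (lr_word u (mon_word m (enum V))) = 0.
    rewrite e /lr_word map_cat catA.
    exact: (@sinv_odd2 R T t (map (@il V) u ++ map (@ir V) a) (ir i) (map (@ir V) b)).
  rewrite z0 big1 // => m' /forallP /(_ i); rewrite oi /= => m'i.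
  by apply: (off _ i); apply/eqP => E; rewrite E leqNgt mi in m'i.
move=> /existsPn nodd.
have [/existsP[i mi]|] := boolP [exists i : V, (N <= m i)%N].
  have z0 : t (lr_word u (mon_word m (enum V))) = 0.
    apply: hN; rewrite /lr_word size_cat !size_map; apply: leq_trans mi _.
    apply: leq_trans (leq_addl _ _).
    have <- : count_mem i (mon_word m (enum V)) = m i by rewrite count_mon_word ?enum_uniq // mem_enum.
    exact: count_size.
  rewrite z0 big1 // => m' _.
  by apply: (off _ i); apply/eqP => E; have := ltn_ord (m' i); rewrite E ltnNge mi.
move=> /existsPn mN.
have ltm i : (m i < N)%N by rewrite ltnNge.
pose m0 : {ffun V -> 'I_N} := [ffun i => Ordinal (ltm i)].
have am0 : adm m0.
  apply/forallP => i; apply/implyP => oi; rewrite ffunE /=.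
  by have := nodd i; rewrite oi /= -leqNgt.
rewrite (bigD1 m0) //= big1 ?addr0.
  have -> : all (fun i => mult m0 i == m i) (enum V).
    by apply/allP => i _; rewrite /mult ffunE.
  rewrite mulr1 /slice; congr (t (lr_word u _)); rewrite /mon_word; congr flatten.
  by apply: eq_map => i; rewrite /mult ffunE.
move=> m' /andP[_ mm'].
have [i hi] : exists i, m' i != m0 i.
  apply/existsP; rewrite -negb_forall; apply: contra mm' => /forallP h.
  by apply/eqP/ffunP => i; apply/eqP.
by apply: (off _ i); move: hi; rewrite ffunE -val_eqE.
Qed.

End Surj.

(** * Homogeneous tensors and the sign automorphism *)

Section Parity.
Variables (R : comNzRingType) (W : sspace).

Lemma cf_homog e (t : talg R W) z : tpar e t = t -> cf t z != 0 -> wpar z = e.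
Proof.
move=> h; have := cf_tpar e t z; rewrite h => ->.
by have [//|_] := eqVneq (wpar z) e; rewrite mul0r eqxx.
Qed.

Lemma tw_cf_homog e (t : talg R W) : tpar e t = t -> tw true (cf t) = sg e *: cf t.
Proof.
move=> h; apply: funext => z; rewrite fnZ /tw /=.
have [->|nz] := eqVneq (cf t z) 0; first by rewrite !mulr0.
by rewrite (cf_homog h nz).
Qed.

Lemma tw_wnorm_homog e (t : talg R W) : tpar e t = t -> tw true (wnorm t) = sg e *: wnorm t.
Proof.
move=> h; rewrite /wnorm /mlin (big_morph _ (@twD R W true) (@tw0 R W true)) scaler_sumr.
rewrite big_seq [RHS]big_seq; apply: eq_bigr => w; rewrite -mcoeff_neq0 => wt.
rewrite twZ /nw tw_nact tw_ew wpar_nil /= !scalerA mulrC.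
by rewrite (cf_homog h wt) [sg false]expr0 scale1r.
Qed.

End Parity.

(** * Integral forms *)

Section Tpow.
Variables (R : comNzRingType) (V : sspace).
Implicit Types (v : vect R V).

Lemma cf_tpow v n z : cf (tpow v n) z = (size z == n)%:R * \prod_(i <- z) v i.
Proof.
elim: n z => [|n IH] z; first by rewrite cfU /ew; case: z => [|k z]; rewrite ?big_nil ?mulr1 ?mul0r.
rewrite [tpow v n.+1]/(tconcat (tvec v) (tpow v n)) cf_tvec_concat.
case: z => [|k z]; first by rewrite mul0r.
by rewrite IH big_cons eqSS mulrCA.
Qed.

Lemma sinv_tpow v n : homog v false -> sinv (cf (tpow v n)).
Proof.
move=> hv w i j z; rewrite !cf_tpow !size_cat /= !big_cat !big_cons /=.
have [->|vi] := eqVneq (v i) 0; first by rewrite !(mul0r, mulr0).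
by rewrite (hv _ vi) /sg /= expr0 mul1r [v i * _]mulrCA.
Qed.

Lemma cf_tpow_bvec (i : V) n : cf (tpow (bvec R i) n) = ew R (nseq n i).
Proof.
apply: funext => z; rewrite cf_tpow /ew.
elim: z n => [|k z IH] [|n] /=; rewrite ?big_nil ?mulr1 ?mul0r //.
rewrite big_cons eqSS mulrCA IH ffunE eqseq_cons.
by case: (k == i); rewrite /= ?mul1r ?mul0r.
Qed.

End Tpow.

Section Main.
Variables (O : idomainType) (V : sspace).
Local Notation K := {fraction O}.
Hypothesis charK : [pchar K] =i pred0.
Local Notation T := (ssum V (sdual V)).
Local Notation fr := (@fn_map O K (@tofrac O) _).
Local Notation linj R := (finj (R := R) (@lft V)).
Local Notation rinj R := (finj (R := R) (@rgt V)).

Lemma tofrac_injective : injective (@tofrac O).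
Proof. by move=> a b e; apply/eqP; rewrite -tofrac_eq e. Qed.

Lemma fn_frac_inj (W : sspace) : injective (fr : fn O W -> fn K W).
Proof. exact: fn_map_inj tofrac_injective. Qed.

Lemma double_eq0 (x : O) : x + x = 0 -> x = 0.
Proof.
move=> e; apply: tofrac_injective; rewrite rmorph0.
have := congr1 (@tofrac O) e; rewrite rmorphD rmorph0 -mulr2n -mulr_natl => /eqP.
by rewrite mulf_eq0 (negPf (two_neq0 charK)) => /eqP.
Qed.

Lemma cf_talg_frac (t : talg O V) : cf (talg_frac t) = fr (cf t).
Proof.
apply: funext => z; rewrite /talg_frac cf_sum fn_sum [in RHS]cf_mlin /mlin /fn_map fn_sum.
rewrite rmorph_sum; apply: eq_bigr => w _; rewrite fnZ rmorphM /cf mcoeffU /ew.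
by rewrite eq_sym; case: eqP => _; rewrite /= ?mulr1n ?mulr0n ?rmorph1 ?rmorph0 ?mulr1 ?mulr0.
Qed.

Lemma iv_inv_frac (xi : invar O V) : iv (inv_frac xi) = fr (iv xi).
Proof.
by rewrite /inv_frac iv_to_inv cf_talg_frac //; apply: sinv_fn_map; exact: sinv_iv.
Qed.

Lemma cf_tvec_frac (v : vect O V) : cf (tvec (vect_frac v)) = fr (cf (tvec v)).
Proof.
apply: funext => -[|k z]; rewrite /fn_map; first by rewrite !cf_tvec_nil rmorph0.
by rewrite !cf_tvec ffunE rmorphM /ew rmorph_nat.
Qed.

Lemma cf_tpow_frac (v : vect O V) n : cf (tpow (vect_frac v) n) = fr (cf (tpow v n)).
Proof.
apply: funext => z; rewrite /fn_map !cf_tpow rmorphM rmorph_nat rmorph_prod.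
by congr (_ * _); apply: eq_bigr => i _; rewrite ffunE.
Qed.

Lemma homog_frac (v : vect O V) e : homog v e -> homog (vect_frac v) e.
Proof. by move=> hv i; rewrite ffunE tofrac_eq0; exact: hv. Qed.

Lemma kappaK_divpow (v : vect O V) n : homog v false ->
  kappaK (divpow v n) = fr (cf (tpow v n)).
Proof.
move=> hv; rewrite kappaKZ // kappaK_class // (@wnorm_sinv _ _ n).
- by rewrite scalerA mulVf ?scale1r ?cf_tpow_frac //; exact: fact_neq0.
- by move=> z /negPf ne; rewrite cf_tpow ne mul0r.
- by apply: sinv_tpow; exact: homog_frac.
Qed.

Lemma wnorm_tvec (R : comNzRingType) (v : vect R V) : wnorm (tvec v) = cf (tvec v).
Proof.
rewrite /wnorm /tvec mlin_sum cf_sum; apply: eq_bigr => i _.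
by rewrite malgUZ mlinZ mlinU cfZ cfU /nw /= fins_ew0.
Qed.

Lemma kappaK_tvec (v : vect O V) :
  kappaK (sym_class (tvec (vect_frac v))) = fr (cf (tvec v)).
Proof. by rewrite kappaK_class // wnorm_tvec cf_tvec_frac. Qed.

Lemma sinv_tvec (R : comNzRingType) (v : vect R V) : sinv (cf (tvec v)).
Proof.
by move=> [|k w] i j z; rewrite !cf_tvec /ew ?mulr0 //; case: w => [|? ?] /=; rewrite !mulr0.
Qed.

(** True for the generators, with denominators cancelled in [kappaK_divpow],
    and stable under the operations. *)
Lemma dsym_integral (x : symalg K V) : dsym x -> exists t : invar O V, fr (iv t) = kappaK x.
Proof.
elim=> {x} [v m hv|v hv|x y _ [t ht] _ [u hu]|a x _ [t ht]|x y _ [t ht] _ [u hu]].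
- by exists (to_inv (tpow v m)); rewrite iv_to_inv ?kappaK_divpow //; exact: sinv_tpow.
- by exists (to_inv (tvec v)); rewrite iv_to_inv ?kappaK_tvec //; exact: sinv_tvec.
- by exists (t + u); rewrite ivD fn_mapD ht hu kappaKD.
- by exists (a *: t); rewrite ivZ fn_mapZ ht kappaKZ.
exists (to_inv (shuffle (inv_val t) (inv_val u))).
rewrite iv_to_inv cf_shuffle; last by apply: sinv_fshuf; exact: sinv_iv.
by rewrite fn_map_fshuf kappaK_mul // -ht -hu.
Qed.

(** The n-th divided power of the i-th vector.  An odd vector has no
    higher powers, and [divpow 0 0] is the unit. *)
Definition dpow_gen (i : V) (n : nat) : symalg K V :=
  if spar i then
    if n == 1%N then sym_class (tvec (vect_frac (bvec O i))) else divpow 0 0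
  else divpow (bvec O i) n.

Lemma homog0 e : homog (0 : vect O V) e.
Proof. by move=> i; rewrite ffunE eqxx. Qed.

Lemma dsym_gen i n : dsym (dpow_gen i n).
Proof.
rewrite /dpow_gen; case oi: (spar i); last first.
  by apply: DSymEven; rewrite -oi; exact: homog_bvec.
case: eqP => _; last by apply: DSymEven; exact: homog0.
by apply: DSymOdd; rewrite -oi; exact: homog_bvec.
Qed.

Lemma kappaK_gen i n : (spar i -> n <= 1)%N -> kappaK (dpow_gen i n) = ew K (nseq n i).
Proof.
rewrite /dpow_gen => h; case oi: (spar i) h => h; last first.
  by rewrite kappaK_divpow ?cf_tpow_bvec ?fn_map_ew // -oi; exact: homog_bvec.
case: n {h} (h isT) => [|[|n]] //= _; last by rewrite kappaK_tvec cf_tvec_bvec fn_map_ew.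
rewrite kappaK_divpow; last exact: homog0.
by rewrite /tpow /= cfU fn_map_ew.
Qed.

Definition dpow_mon (m : V -> nat) : symalg K V :=
  foldr (fun i acc => sym_mul (dpow_gen i (m i)) acc) (divpow 0 0) (enum V).

Lemma dsym_mon m : dsym (dpow_mon m).
Proof.
rewrite /dpow_mon; elim: (enum V) => [|i r IH] /=; first by apply: DSymEven; exact: homog0.
by apply: DSymMul => //; exact: dsym_gen.
Qed.

Lemma kappaK_mon m : (forall i, spar i -> m i <= 1)%N -> kappaK (dpow_mon m) = fr (mon_fn O m (enum V)).
Proof.
move=> h; rewrite /dpow_mon; elim: (enum V) => [|i r IH] /=.
  by rewrite kappaK_divpow ?fn_map_ew ?cfU ?fn_map_ew //; exact: homog0.
by rewrite kappaK_mul // IH fn_map_fshuf fn_map_ew kappaK_gen //; exact: h.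
Qed.

Lemma talg_bound (R : comNzRingType) (W : sspace) (t : talg R W) :
  exists N, forall z, (N <= size z)%N -> cf t z = 0.
Proof.
exists (\max_(w <- msupp t) size w).+1 => z h; apply/eqP; rewrite mcoeff_eq0.
apply: contraL h => hz; rewrite -ltnNge ltnS.
exact: (@leq_bigmax_seq _ _ xpredT size).
Qed.

Lemma invar_of (R : comNzRingType) (W : sspace) (s : fn R W) N : sinv s ->
  (forall z, (N <= size z)%N -> s z = 0) -> exists t : invar R W, iv t = s.
Proof.
move=> hs hN; pose f : talg R W := \sum_(w <- words_upto W N) s w *: << w >>.
have cff : cf f = s.
  apply: funext => z; rewrite /f cf_sum.
  under eq_bigr do rewrite cfZ cfU.
  rewrite big_words_upto fn_sum.
  under eq_bigr do rewrite sum_ew.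
  case: (ltnP (size z) N) => h.
    rewrite (bigD1_seq (size z)) ?mem_index_iota ?iota_uniq //= eqxx mul1r big1 ?addr0 //.
    by move=> d; rewrite eq_sym => /negPf ->; rewrite mul0r.
  by rewrite hN // big1 // => d _; rewrite mulr0.
by exists (to_inv f); rewrite iv_to_inv cff.
Qed.

Lemma PhiK_dturner_pure (xi : invar O V) (x : symalg K V) :
  PhiK (dturner_pure xi x) = fshuf (linj K (fr (iv xi))) (rinj K (kappaK x)).
Proof. by rewrite /dturner_pure PhiK_pure /star_kappa iv_inv_frac psi_sym_gdual. Qed.

Lemma sinv_split (R : comNzRingType) (xi y : invar R V) :
  sinv (fshuf (linj R (iv xi)) (rinj R (iv y))).
Proof.
apply: sinv_fshuf; first by apply: sinv_linj; exact: sinv_iv.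
by apply: (sinv_finj (@rgtK V) (@ir_par V)); exact: sinv_iv.
Qed.

Lemma dturner_integral (F : turner K V) : dturner F ->
  exists t : invar O T, fr (iv t) = PhiK F.
Proof.
case=> l hl ->; elim: l hl => [|[xi x] l IH] hl.
  exists 0; rewrite big_nil PhiK0 -(@fn_map0 O K (@tofrac O) T); congr (fr _).
  by rewrite -(scale0r (0 : invar O T)) ivZ scale0r.
have [|t ht] := IH; first by move=> p pl; apply: hl; rewrite inE pl orbT.
have [y hy] := dsym_integral (hl _ (mem_head _ _)).
have [u hu] : exists u : invar O T, iv u = fshuf (linj O (iv xi)) (rinj O (iv y)).
  exists (to_inv (shuffle (in_left (inv_val xi)) (in_right (inv_val y)))).
  by rewrite iv_to_inv cf_shuffle cf_in_left cf_in_right //; exact: sinv_split.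
exists (u + t); rewrite big_cons PhiKD PhiK_dturner_pure -ht -hy ivD fn_mapD hu.
by rewrite fn_map_fshuf !fn_map_finj.
Qed.

(** In the decomposition [surj_decomp] of t, the slices are invariants of X over
    O, and the monomials are images of elements of 'Sym under kappa. *)
Lemma dturner_surj (t : invar O T) : exists2 F : turner K V, dturner F & PhiK F = fr (iv t).
Proof.
have [N hN] := talg_bound (inv_val t).
have tE := surj_decomp double_eq0 (sinv_iv t) hN.
pose sl (m : {ffun V -> 'I_N}) := slice (iv t) (mult m).
have ex m : exists xi : invar O V, iv xi = sl m.
  apply: (@invar_of _ _ _ N); first by apply: sinv_slice; exact: sinv_iv.
  move=> z hz; apply: hN; rewrite /lr_word size_cat !size_map.
  exact: leq_trans hz (leq_addr _ _).
pose xi m := xget (0 : invar O V) (fun xi => iv xi = sl m).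
have xiE m : iv (xi m) = sl m := xgetPex _ (ex m).
pose l := [seq (xi m, dpow_mon (mult m)) | m <- index_enum {ffun V -> 'I_N} & adm m].
exists (\sum_(p <- l) dturner_pure p.1 p.2).
  by exists l => // p /mapP[m _ ->]; exact: dsym_mon.
rewrite PhiK_sum /l big_map big_filter [in RHS]tE fn_map_sum; apply: eq_bigr => m am.
rewrite [PhiK _]PhiK_dturner_pure xiE kappaK_mon; last first.
  by move=> i; apply/implyP; exact: (forallP am).
by rewrite fn_map_fshuf !fn_map_finj.
Qed.

(** If the image t of F is integral, [dturner_surj] provides an element of 'DX
    with image t, and it is F by injectivity over K. *)
Lemma dturnerP (F : turner K V) : dturner F <-> exists t : invar O T, fr (iv t) = PhiK F.
Proof.
split=> [|[t e]]; first exact: dturner_integral.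
have [G dG] := dturner_surj t; rewrite e => /(PhiK_inj charK) <-.
exact: dG.
Qed.

Lemma kappa_ex : {kappa : symalg K V -> invar O V |
  forall x, dsym x -> fr (iv (kappa x)) = kappaK x}.
Proof.
exists (fun x => xget 0 (fun t : invar O V => fr (iv t) = kappaK x)) => x.
by move=> /dsym_integral h; exact: (xgetPex _ h).
Qed.
Definition kappa := sval kappa_ex.

Lemma Phi_ex : {Phi : turner K V -> invar O T |
  forall F, dturner F -> fr (iv (Phi F)) = PhiK F}.
Proof.
exists (fun F => xget 0 (fun t : invar O T => fr (iv t) = PhiK F)) => F.
by move=> /dturnerP h; exact: (xgetPex _ h).
Qed.
Definition Phi := sval Phi_ex.

Lemma kappaE x : dsym x -> fr (iv (kappa x)) = kappaK x.
Proof. exact: (svalP kappa_ex). Qed.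
Lemma PhiE F : dturner F -> fr (iv (Phi F)) = PhiK F.
Proof. exact: (svalP Phi_ex). Qed.

Lemma kappa_unique x t : dsym x -> fr (iv t) = kappaK x -> kappa x = t.
Proof. by move=> /kappaE e h; apply: iv_inj; apply: fn_frac_inj; rewrite e h. Qed.
Lemma Phi_unique F t : fr (iv t) = PhiK F -> Phi F = t.
Proof.
move=> h; apply: iv_inj; apply: fn_frac_inj; rewrite h; apply: PhiE.
by apply/dturnerP; exists t.
Qed.

Lemma dsym_sum (I : Type) (r : seq I) (P : pred I) (F : I -> symalg K V) :
  (forall i, P i -> dsym (F i)) -> dsym (\sum_(i <- r | P i) F i).
Proof.
move=> h; apply: (big_ind (@dsym O V)) => //; last exact: DSymAdd.
have := DSymScale 0 (dsym_mon (fun=> 0%N)).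
by rewrite rmorph0 scale0r.
Qed.

(** The case of [surj_decomp] for a tensor without letters of X: each slice is a
    scalar, its coefficient at the empty word. *)
Lemma kappa_onto (t : invar O V) : exists2 x, dsym x & kappa x = t.
Proof.
have [N hN] := talg_bound (inv_val t).
have sR : sinv (rinj O (iv t)).
  by apply: (sinv_finj (@rgtK V) (@ir_par V)); exact: sinv_iv.
have hR (z : seq T) : (N <= size z)%N -> rinj O (iv t) z = 0.
  have gen (s : fn O V) n : (forall z, (n <= size z)%N -> s z = 0) ->
      (n <= size z)%N -> rinj O s z = 0.
    elim: z s n => [|[k|k] z IH] s n hs /= hz //; first exact: hs.
    apply: (IH _ n.-1) => [u hu|]; last by case: n hz {hs}.
    by apply: hs => /=; case: n hu {hz}.
  exact: gen.
have tE := surj_decomp double_eq0 sR hR.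
pose x := \sum_(m : {ffun V -> 'I_N} | adm m)
   tofrac (slice (rinj O (iv t)) (mult m) [::] : O) *: dpow_mon (mult m).
have dx : dsym x by apply: dsym_sum => m _; apply: DSymScale; exact: dsym_mon.
exists x => //; apply: kappa_unique => //.
have kx : kappaK x = \sum_(m : {ffun V -> 'I_N} | adm m)
   tofrac (slice (rinj O (iv t)) (mult m) [::] : O) *: fr (mon_fn O (mult m) (enum V)).
  rewrite /x (big_morph (@kappaK K V) (@kappaKD _ V charK) (@kappaK0 _ V charK)).
  apply: eq_bigr => m am; rewrite kappaKZ // kappaK_mon // => i.
  by apply/implyP; exact: (forallP am).
rewrite kx; apply: funext => w.
have := congr1 (fun s : fn O T => s (lr_word [::] w)) tE.
rewrite /= (finj_map (@irK V)) => E.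
rewrite [LHS](congr1 (@tofrac O) E) [in LHS]fn_sum rmorph_sum fn_sum.
apply: eq_bigr => m _; rewrite (fshuf_split _ _ [::] w) rmorphM.
by [].
Qed.

Lemma is_kappa_kappa : is_kappa kappa.
Proof.
split.
- move=> x y dx dy; apply: (kappa_unique (DSymAdd dx dy)).
  by rewrite (ivD (kappa x) (kappa y)) fn_mapD (kappaE dx) (kappaE dy) kappaKD.
- move=> a x dx; apply: (kappa_unique (DSymScale a dx)).
  by rewrite (ivZ a (kappa x)) fn_mapZ (kappaE dx) kappaKZ.
- move=> x y dx dy; apply: cf_inj; apply: fn_frac_inj.
  rewrite cf_shuffle -/(iv (kappa x)) -/(iv (kappa y)).
  rewrite -/(iv (kappa (sym_mul x y))).
  by rewrite fn_map_fshuf (kappaE (DSymMul dx dy)) (kappaE dx) (kappaE dy) kappaK_mul.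
- move=> v m hv; apply: cf_inj; apply: fn_frac_inj.
  by rewrite -/(iv _) kappaE ?kappaK_divpow //; exact: DSymEven.
- move=> v hv; apply: cf_inj; apply: fn_frac_inj.
  by rewrite -/(iv _) kappaE ?kappaK_tvec //; exact: DSymOdd.
- by move=> x y dx dy e; apply: (kappaK_inj charK); rewrite -!kappaE // e.
- exact: kappa_onto.
Qed.

(** * Parity and the isomorphism over the domain *)

(** As 2 is invertible, tensors of parity e are the eigenvectors of the sign
    automorphism for (-1)^e.  The shuffle product and the norms commute with
    this automorphism, which reduces questions of parity to signs. *)
Lemma proj_hom (W : sspace) e (s : fn K W) : tw true s = sg e *: s -> proj e s = s.
Proof.
move=> h; apply: funext => z; rewrite /proj; case: eqP => [_|ne]; first by rewrite mul1r.
have := congr1 (fun s : fn K W => s z) h; rewrite /tw fnZ /= => {h} E.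
rewrite mul0r; apply/esym/eqP; move: E ne.
have [->//|sz] := eqVneq (s z) 0.
have h2 : s z + s z != 0.
  by rewrite -mulr2n -mulr_natl mulf_neq0 ?(two_neq0 charK).
case: e (wpar z) => [] [] //= /eqP E _; move: E h2.
  by rewrite /sg expr1 expr0 mulN1r mul1r -addr_eq0 => ->.
by rewrite /sg expr1 expr0 mulN1r mul1r eq_sym -addr_eq0 => ->.
Qed.

Lemma tw_PhiK_homog e (F : turner K V) : dturner_homog e F ->
  tw true (PhiK F) = sg e *: PhiK F.
Proof.
case=> l hl ->; elim: l hl => [|[xi x] l IH] hl.
  by rewrite big_nil PhiK0 tw0 scaler0.
have h1 : tw true (PhiK (\sum_(p <- l) dturner_pure p.1 p.2)) =
          sg e *: PhiK (\sum_(p <- l) dturner_pure p.1 p.2).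
  by apply: IH => p pl; apply: hl; rewrite inE pl orbT.
have [_ [e1 hxi [t ht xE]]] := hl _ (mem_head _ _).
rewrite big_cons PhiKD twD scalerDr h1; congr (_ + _).
move: hxi xE => /= hxi xE.
rewrite PhiK_dturner_pure tw_fshuf tw_linj (tw_finj (@rgtK V) (@ir_par V)).
rewrite -fn_map_tw (tw_cf_homog hxi) xE kappaK_class // (tw_wnorm_homog ht).
rewrite fn_mapZ !finjZ fshufrZ fshuflZ scalerA rmorph_sg; congr (_ *: _).
by rewrite sgM addbAC addbb.
Qed.

Lemma Phi_homog e (F : turner K V) : dturner_homog e F -> 
  tpar e (inv_val (Phi F)) = inv_val (Phi F).
Proof.
move=> hF; have dF : dturner F.
  by case: hF => l hl ->; exists l => // p /hl[].
apply: cf_inj; apply: fn_frac_inj.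
have -> : fr (cf (tpar e (Phi F))) = proj e (fr (cf (Phi F))).
  apply: funext => z; rewrite -[LHS]/(tofrac (cf (tpar e (Phi F)) z : O)).
  by rewrite cf_tpar rmorphM rmorph_nat.
by rewrite -/(iv (Phi F)) (PhiE dF) (proj_hom (tw_PhiK_homog hF)).
Qed.

Variable c : sconst O V.
Hypothesis cgr : graded c.
Local Notation cK := (scalar_ext (@tofrac O) c).

Lemma graded_frac : graded cK.
Proof. by move=> i j k; rewrite ffunE tofrac_eq0; exact: cgr. Qed.

Lemma trivial_frac : trivial_ext cK = scalar_ext (@tofrac O) (trivial_ext c).
Proof.
apply: funext => p; apply: funext => q; apply/ffunP => r; rewrite !ffunE.
by case: p q r => [i|i] [j|j] [k|k]; rewrite ?ffunE ?rmorph0.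
Qed.

(** The product of the images, formed over O, is the image of the product formed
    over K; so the latter is integral, which is closure of 'DX. *)
Lemma fn_frac_tmul (F G : turner K V) : dturner F -> dturner G ->
  fr (cf (tmul (trivial_ext c) (Phi F) (Phi G))) = PhiK (turner_mul cK F G).
Proof.
move=> dF dG; rewrite cf_tmul fn_map_fmul -trivial_frac.
by rewrite -/(iv (Phi F)) -/(iv (Phi G)) (PhiE dF) (PhiE dG) PhiK_mul //; exact: graded_frac.
Qed.

Lemma sinv_tmul_Phi (F G : turner K V) :
  sinv (cf (tmul (trivial_ext c) (Phi F) (Phi G))).
Proof.
by rewrite cf_tmul; apply: sinv_fmul; [exact: graded_trivial | exact: sinv_iv | exact: sinv_iv].
Qed.

Lemma dturner_mul (F G : turner K V) : dturner F -> dturner G -> dturner (turner_mul cK F G).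
Proof.
move=> dF dG; apply/dturnerP.
exists (to_inv (tmul (trivial_ext c) (Phi F) (Phi G))).
by rewrite iv_to_inv ?fn_frac_tmul //; exact: sinv_tmul_Phi.
Qed.

Lemma Phi_mul (F G : turner K V) : dturner F -> dturner G ->
  inv_val (Phi (turner_mul cK F G)) = tmul (trivial_ext c) (Phi F) (Phi G).
Proof.
move=> dF dG; apply: cf_inj; apply: fn_frac_inj.
by rewrite fn_frac_tmul // -/(iv (Phi _)) (PhiE (dturner_mul dF dG)).
Qed.

Lemma PhiD (F G : turner K V) : dturner F -> dturner G -> Phi (F + G) = Phi F + Phi G.
Proof.
by move=> dF dG; apply: Phi_unique; rewrite ivD fn_mapD (PhiE dF) (PhiE dG) PhiKD.
Qed.

Lemma PhiZ (a : O) (F : turner K V) : dturner F -> Phi (tofrac a *: F) = a *: Phi F.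
Proof. by move=> dF; apply: Phi_unique; rewrite ivZ fn_mapZ (PhiE dF) PhiKZ. Qed.

Lemma Phi_inj (F G : turner K V) : dturner F -> dturner G -> Phi F = Phi G -> F = G.
Proof. by move=> dF dG e; apply: (PhiK_inj charK); rewrite -(PhiE dF) e (PhiE dG). Qed.

Lemma Phi_onto (t : invar O T) : exists2 F, dturner F & Phi F = t.
Proof.
by have [F dF e] := dturner_surj t; exists F => //; exact: Phi_unique.
Qed.

Lemma Phi_pure (xi : invar O V) (x : symalg K (sdual V)) : dsym x ->
  inv_val (Phi (dturner_pure xi x)) = shuffle (in_left xi) (in_right (kappa x)).
Proof.
move=> dx; apply: cf_inj; apply: fn_frac_inj.
rewrite -/(iv (Phi _)) PhiE; last first.
  by exists [:: (xi, x)]; [move=> p; rewrite inE => /eqP -> | rewrite big_seq1].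
rewrite PhiK_dturner_pure -(kappaE dx).
by rewrite cf_shuffle cf_in_left cf_in_right fn_map_fshuf !fn_map_finj.
Qed.

End Main.

Theorem theorem4p26 (O : idomainType)
    (charK : [pchar {fraction O}] =i pred0) (X : superalgebra O) :
  exists2 kappa : symalg {fraction O} (sdual (sa_space X)) ->
                  invar O (sdual (sa_space X)),
    is_kappa kappa &
  exists Phi : turner {fraction O} (sa_space X) ->
               invar O (ssum (sa_space X) (sdual (sa_space X))),
  [/\ (* 'DX is a superalgebra for the product of the Turner double of X_K *)
      forall F G, dturner F -> dturner G ->
        dturner (turner_mul (frac_const X) F G),
      (* Phi is an even O-linear multiplicative map on 'DX *)
      [/\ forall F G, dturner F -> dturner G ->
            Phi (F + G) = Phi F + Phi G,
          forall (a : O) F, dturner F ->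
            Phi (tofrac a *: F) = a *: Phi F,
          forall F G, dturner F -> dturner G ->
            inv_val (Phi (turner_mul (frac_const X) F G)) =
            tmul (trivial_ext (sa_const X)) (Phi F) (Phi G) &
          forall e F, dturner_homog e F ->
            tpar e (inv_val (Phi F)) = inv_val (Phi F)],
      (* Phi is a bijection from 'DX to Inv T_X *)
      forall F G, dturner F -> dturner G -> Phi F = Phi G -> F = G,
      forall t, exists2 F, dturner F & Phi F = t &
      forall (xi : invar O (sa_space X))
             (x : symalg {fraction O} (sdual (sa_space X))), dsym x ->
        inv_val (Phi (dturner_pure xi x)) =
        shuffle (in_left xi) (in_right (kappa x))].
Proof.
have cgr : graded (sa_const X) by move=> i j; exact: sa_mul_par.
exists (kappa charK); first exact: is_kappa_kappa.
exists (Phi charK); split.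
- exact: dturner_mul.
- split; [exact: PhiD | exact: PhiZ | exact: Phi_mul | exact: Phi_homog].
- exact: Phi_inj.
- exact: Phi_onto.
- exact: Phi_pure.
Qed.
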